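(* Under the setting and hypotheses of the context, the Euler scheme $X^{n,x}$ converges to the true solution $X^x$ with order $\frac12$; i.e. there is a constant $C$ (independent of $n$) such that $$\mathbb{E}\Big(\sup_{0\le t\le T}|X_t^x-X_t^{n,x}|^2\Big)\le C\,\Delta t,\qquad \Delta t=\frac Tn.$$
   Context: Let $T>0$, $\mathbb{R}_0=\mathbb{R}\setminus\{0\}$. $(\Omega_1,\mathcal F^W,P^W)$ carries a $d$-dimensional Brownian motion $W$ with independent components; $(\Omega_2,\mathcal F^N,P^N)$ carries a Poisson random measure $N(dz,dt)$ with compensator $\mu(dz)dt$, $\mu$ a finite measure on $\mathbb{R}_0$; $\tilde N=N-\mu\,dt$. On $\Omega=\Omega_1\times\Omega_2$, $P=P^W\times P^N$; $\mathbb{F}$ is the right-continuous complete filtration generated by $W$ and $N$. Fix $k\ge1$, $x\in\mathbb{R}^k\setminus\{0\}$. $X^x$ is the solution of $$dX_t^x=b(t,\rho_{X_t^x})X_t^xdt+\sum_{m=1}^d\sigma_m(t,X_t^x,\pi_{X_t^x})dW_t^m+\int_{\mathbb{R}_0}\lambda(t,X_t^x,z,\eta_{X_t^x})\tilde N(dz,dt),\quad X_0^x=x,$$ where $\rho_X=\mathbb{E}X$, $\pi_X=\mathbb{E}\psi(X)$, $\eta_X=\mathbb{E}\xi(X)$; $b:[0,T]\times\mathbb{R}^k\to\mathbb{R}^k$, $\sigma_m:\Omega\times[0,T]\times\mathbb{R}^k\times\mathbb{R}^k\to\mathbb{R}^k$, $\lambda:\Omega\times[0,T]\times\mathbb{R}^k\times\mathbb{R}_0\times\mathbb{R}^k\to\mathbb{R}^k$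 are $\mathbb{F}$-measurable, $\psi,\xi:\mathbb{R}^k\to\mathbb{R}^k$ measurable; products of vectors are componentwise. Hypotheses. (i) $\sigma_m,\lambda,\psi,\xi$ are continuously differentiable and Lipschitz with parameter $K>0$; there is $\varrho:\mathbb{R}_0\to\mathbb{R}$ with $\int\varrho^pd\mu<\infty$ for all $p\ge1$ such that for all $t,s\in[0,T]$, processes $X,Z$ and $m$: $|\sigma_m(t,X_t,\pi_{X_t})-\sigma_m(s,Z_s,\pi_{Z_s})|^2\le K(|t-s|^2+|X_t-Z_s|^2+\mathbb{E}|X_t-Z_s|^2)$ and $|\lambda(t,X_t,z,\eta_{X_t})-\lambda(s,Z_s,z,\eta_{Z_s})|^2\le\varrho(z)(|t-s|^2+|X_t-Z_s|^2+\mathbb{E}|X_t-Z_s|^2)$. (ii) $b,\sigma_m,\lambda,\psi,\xi$ have linear growth. (iii) $\dot f(t)=b(t,f(t))f(t)$, $f(0)=x$, has a unique bounded non-zero solution on $[0,T]$. (iv) $b$ is Lipschitz. Euler scheme: for $n\in\mathbb{N}$ let $t_i=iT/n$, $i=0,\dots,n$, $X_0^{n,x}=x$ and, for $t\in[t_k,t_{k+1}]$, $$X_t^{n,x}=X_{t_k}^{n,x}+\int_{t_k}^tb(t_k,\rho_{t_k})X_{t_k}^{n,x}ds+\sum_{m=1}^d\int_{t_k}^t\sigma_m(t_k,X_{t_k}^{n,x},\pi_{t_k})dW_s^m+\int_{t_k}^t\int_{\mathbb{R}_0}\lambda(t_k,X_{t_k}^{n,x},z,\eta_{t_k})\tilde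 N(dz,ds),$$ with $\rho_{t_k}=\mathbb{E}(X_{t_k}^{n,x})$, $\pi_{t_k}=\mathbb{E}(\psi(X_{t_k}^{n,x}))$, $\eta_{t_k}=\mathbb{E}(\xi(X_{t_k}^{n,x}))$. *)

(* Defs.v *)
From HB Require Import structures.
From mathcomp Require Import all_boot all_order all_algebra.
From mathcomp Require Import all_classical all_reals all_analysis.
From mathcomp Require Import measurable_realfun.

Set Implicit Arguments.
Unset Strict Implicit.
Unset Printing Implicit Defensive.

Import Order.TTheory GRing.Theory Num.Theory.
Import numFieldNormedType.Exports.

Local Open Scope classical_set_scope.
Local Open Scope ring_scope.

Section vectors.
Context {R : realType} {k : nat}.


(* The norm `|x| of the library on row vectors is the maximum norm. *)
Definition enorm (x : 'rV[R]_k) : R := Num.sqrt (\sum_i x 0 i ^+ 2).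

Definition cmul (x y : 'rV[R]_k) : 'rV[R]_k := \row_i (x 0 i * y 0 i).

(* The Borel sigma-algebra of R^k, as the product sigma-algebra. *)
Definition borel_vector :=
  g_sigma_algebraType [set A : set 'rV[R]_k | exists i, exists2 B : set R,
    measurable B & A = [set x | B (x 0 i)]].
HB.instance Definition _ := Measurable.on borel_vector.

Definition continuously_differentiable {V W : normedModType R} (f : V -> W) :=
  (forall x, differentiable f x) /\ (forall v, continuous (fun x => 'd f x v)).

Definition mean {e} {O : measurableType e} (P : {measure set O -> \bar R})
    (Y : O -> 'rV[R]_k) : 'rV[R]_k :=
  \row_i \int[P]_w Y w 0 i.

Definition cadlag (a b : R) (f : R -> R) : Prop :=
  (forall t, a <= t < b -> f s @[s --> t^'+] --> f t) /\
  (forall t, a < t <= b -> cvg (f s @[s --> t^'-])).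

End vectors.

Arguments borel_vector : clear implicits.

Section noises.
Context {R : realType} {e : measure_display} {O : measurableType e}.
Variable P : probability O R.

Definition mutually_independent {I : finType} {e'} {E : measurableType e'}
    (Y : I -> O -> E) : Prop :=
  forall B : I -> set E, (forall i, measurable (B i)) ->
  P [set w | forall i, B i (Y i w)] =
  (\prod_(i : I) P [set w | B i (Y i w)])%E.

(* The independence clause covers at once the independence of the components
   and that of the increments. *)
Definition brownian_motion (T : R) (d : nat) (W : 'I_d -> R -> O -> R) : Prop :=
  [/\ forall m t, 0 <= t <= T -> measurable_fun setT (W m t),
      forall m w, W m 0 w = 0,
      forall m w, {within `[0, T], continuous (fun t => W m t w)},
      forall m s t, 0 <= s -> s < t -> t <= T -> forall B : set R,
        measurable B ->
        P [set w | B (W m t w - W m s w)] = normal_prob 0 (Num.sqrt (t - s)) B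
    & forall (p : nat) (s : nat -> R), 0 <= s 0%N ->
        (forall j, (j < p)%N -> s j <= s j.+1) -> s p <= T ->
        mutually_independent
          (fun (mj : 'I_d * 'I_p) w =>
             W mj.1 (s mj.2.+1) w - W mj.1 (s mj.2) w)].

(* Measures on R \ {0} are encoded as measures on R without mass at 0; points
   of N are pairs (z, t). *)
Definition nonzero_mark : set R := [set z | z != 0].

Definition marked_times (t : R) : set (R * R) :=
  [set p | p.1 != 0 /\ 0 <= p.2 <= t].

Definition poisson_random_measure (T : R)
    (mu : {finite_measure set (measurableTypeR R) -> \bar R})
    (N : R.-ker O ~> (R * R)%type) : Prop :=
  [/\ forall w (B : set (R * R)), measurable B -> B `<=` marked_times T ->
        exists j : nat, N w B = j%:R%:E,
      forall B : set (R * R), measurable B -> B `<=` marked_times T ->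
        forall j : nat,
        let rate := fine ((mu \x lebesgue_measure)%E B) in
        P [set w | N w B = j%:R%:E] =
        (expR (- rate) * rate ^+ j / j`!%:R)%:E
    & forall (p : nat) (B : 'I_p -> set (R * R)),
        (forall i, measurable (B i)) -> (forall i, B i `<=` marked_times T) ->
        trivIset setT B -> mutually_independent (fun i w => N w (B i))].

End noises.

Section stochastic_basis.
Context {R : realType} {e1 e2 : measure_display}
  {O1 : measurableType e1} {O2 : measurableType e2}.
Local Notation O := (O1 * O2)%type.
Variables (P : {measure set O -> \bar R}) (T : R) (d : nat).
Variables (W : 'I_d -> R -> O1 -> R)
  (mu : {finite_measure set (measurableTypeR R) -> \bar R})
  (N : R.-ker O2 ~> (R * R)%type).

Definition noise_events (t : R) : set (set O) :=
  [set A | exists m s (B : set R),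
     [/\ 0 <= s <= t, measurable B & A = [set w | B (W m s w.1)]]] `|`
  [set A | exists (B : set (R * R)) (C : set (\bar R)),
     [/\ measurable B, B `<=` marked_times t, measurable C &
         A = [set w | C (N w.2 B)]]].

(* The right-continuous augmentation by the P-null events. Time stops at T. *)
Definition filtration (t : R) : set (set O) :=
  \bigcap_(u in [set u | t < u])
    <<s noise_events (Num.min u T) `|` [set A | measurable A /\ P A = 0%E] >>.

Definition at_time (t : R) := g_sigma_algebraType (filtration t).
HB.instance Definition _ t := Measurable.on (at_time t).

Implicit Types (a b : R) (H I : R -> O -> R) (F : R -> R -> O -> R).

Definition adapted a b I : Prop :=
  forall t, a <= t <= b -> measurable_fun setT (I t : at_time t -> R).

Definition progressive a b H : Prop :=
  forall t, a <= t <= b ->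
  measurable_fun [set p : at_time t * R | a <= p.2 <= t]
    (fun p => H p.2 p.1).

Definition progressive_field a b F : Prop :=
  forall t, a <= t <= b ->
  measurable_fun
    [set p : at_time t * R * R | a <= p.1.2 <= t /\ nonzero_mark p.2]
    (fun p => F p.1.2 p.2 p.1.1).

(* E (sup_{a <= t <= b} I_t^2) *)
Definition sup_norm2 a b I : \bar R :=
  (\int[P]_w ereal_sup [set (I t w ^+ 2)%:E | t in `[a, b]])%E.

Record simple_process a b := SimpleProcess {
  sp_size : nat ;
  sp_grid : nat -> R ;
  sp_val : nat -> O -> R ;
  sp_grid0 : sp_grid 0 = a ;
  sp_gridn : sp_grid sp_size = b ;
  sp_grid_le : forall j, (j < sp_size)%N -> sp_grid j <= sp_grid j.+1 ;
  sp_meas : forall j, (j < sp_size)%N ->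
    measurable_fun setT (sp_val j : at_time (sp_grid j) -> R) ;
  sp_bounded : exists M : R, forall j w, (j < sp_size)%N -> `|sp_val j w| <= M }.

Definition simple_fun a b (G : simple_process a b) : R -> O -> R := fun s w =>
  \sum_(j < sp_size G)
    sp_val G j w * \1_(`]sp_grid G j, sp_grid G j.+1]) s.

Definition simple_integral a b (G : simple_process a b) m : R -> O -> R :=
  fun t w => \sum_(j < sp_size G) sp_val G j w *
    (W m (Num.min (sp_grid G j.+1) t) w.1 - W m (Num.min (sp_grid G j) t) w.1).

(* I is the process t |-> \int_a^t H_s dW^m_s, t in [a, b], with the Ito
   integral defined as usual as the L^2-limit of integrals of simple processes;
   it is determined up to indistinguishability. *)
Definition brownian_integral m a b H I : Prop :=
  [/\ progressive a b H, adapted a b I, forall w, cadlag a b (I ^~ w) &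
   exists G : nat -> simple_process a b,
     (\int[P]_w \int[lebesgue_measure]_(s in `[a, b])
        ((H s w - simple_fun (G j) s w) ^+ 2)%:E)%E @[j --> \oo] --> 0%E /\
     sup_norm2 a b (fun t w => I t w - simple_integral (G j) m t w)
       @[j --> \oo] --> 0%E].

Record simple_field a b := SimpleField {
  sf_size : nat ;
  sf_grid : nat -> R ;
  sf_cells : nat ;
  sf_cell : 'I_sf_cells -> set R ;
  sf_val : nat -> 'I_sf_cells -> O -> R ;
  sf_grid0 : sf_grid 0 = a ;
  sf_gridn : sf_grid sf_size = b ;
  sf_grid_le : forall j, (j < sf_size)%N -> sf_grid j <= sf_grid j.+1 ;
  sf_cell_meas : forall l, measurable (sf_cell l) ;
  sf_cell_neq0 : forall l, sf_cell l `<=` nonzero_mark ;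
  sf_cell_triv : trivIset setT sf_cell ;
  sf_meas : forall j l, (j < sf_size)%N ->
    measurable_fun setT (sf_val j l : at_time (sf_grid j) -> R) ;
  sf_bounded : exists M : R, forall j l w,
    (j < sf_size)%N -> `|sf_val j l w| <= M }.

Arguments sf_cell {a b} s _.
Arguments sf_val {a b} s _ _ _.

Definition simple_field_fun a b (G : simple_field a b) : R -> R -> O -> R :=
  fun s z w => \sum_(j < sf_size G) \sum_(l < sf_cells G) sf_val G j l w *
    \1_(`]sf_grid G j, sf_grid G j.+1]) s * \1_(sf_cell G l) z.

Definition compensated (A : set R) (s t : R) (w : O2) : R :=
  fine (N w (A `*` `]s, t])) - fine (mu A) * (t - s).

Definition simple_field_integral a b (G : simple_field a b) : R -> O -> R :=
  fun t w => \sum_(j < sf_size G) \sum_(l < sf_cells G) sf_val G j l w *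
    compensated (sf_cell G l)
      (Num.min (sf_grid G j) t) (Num.min (sf_grid G j.+1) t) w.2.

(* I is the process t |-> \int_a^t \int_{R \ {0}} F_s(z) (N(dz, ds) - mu(dz)ds),
   t in [a, b]. As it depends on F through its dP ds mu(dz)-class only, an
   integrand built from a cadlag process X is integrated as the predictable one
   built from X_{s-}. *)
Definition poisson_integral a b F I : Prop :=
  [/\ progressive_field a b F, adapted a b I, forall w, cadlag a b (I ^~ w) &
   exists G : nat -> simple_field a b,
     (\int[P]_w \int[lebesgue_measure]_(s in `[a, b])
        \int[mu]_(z in nonzero_mark)
        ((F s z w - simple_field_fun (G j) s z w) ^+ 2)%:E)%E
       @[j --> \oo] --> 0%E /\
     sup_norm2 a b (fun t w => I t w - simple_field_integral (G j) t w)
       @[j --> \oo] --> 0%E].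

End stochastic_basis.

Section equation.
Context {R : realType} {e1 e2 : measure_display}
  {O1 : measurableType e1} {O2 : measurableType e2}.
Local Notation O := (O1 * O2)%type.
Variables (P : {measure set O -> \bar R}) (T : R) (d k : nat).
Local Notation Rk := 'rV[R]_k.
Variables (W : 'I_d -> R -> O1 -> R)
  (mu : {finite_measure set (measurableTypeR R) -> \bar R})
  (N : R.-ker O2 ~> (R * R)%type).
Variables (b : R -> Rk -> Rk) (sigma : 'I_d -> O -> R -> Rk -> Rk -> Rk)
  (lam : O -> R -> Rk -> R -> Rk -> Rk) (psi xi : Rk -> Rk) (x : Rk).

Local Notation at_time := (at_time P T W N).
Implicit Types X Z : R -> O -> Rk.

Definition measurable_coefficients : Prop :=
  [/\ forall i, measurable_fun
        [set p : R * borel_vector R k | 0 <= p.1 <= T]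
        (fun p => b p.1 p.2 0 i),
      forall m t i, 0 <= t <= T -> measurable_fun
        [set p : at_time t * R * borel_vector R k * borel_vector R k |
           0 <= p.1.1.2 <= t]
        (fun p => sigma m p.1.1.1 p.1.1.2 p.1.2 p.2 0 i),
      forall t i, 0 <= t <= T -> measurable_fun
        [set p : at_time t * R * borel_vector R k * R * borel_vector R k |
           0 <= p.1.1.1.2 <= t /\ nonzero_mark p.1.2]
        (fun p => lam p.1.1.1.1 p.1.1.1.2 p.1.1.2 p.1.2 p.2 0 i),
      forall i, measurable_fun setT (fun y : borel_vector R k => psi y 0 i)
    & forall i, measurable_fun setT (fun y : borel_vector R k => xi y 0 i)].

Definition C1_coefficients : Prop :=
  [/\ forall m w t, 0 <= t <= T ->
        continuously_differentiable
          (fun p : Rk * Rk => sigma m w t p.1 p.2),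
      forall w t z, 0 <= t <= T -> z != 0 ->
        continuously_differentiable
          (fun p : Rk * Rk => lam w t p.1 z p.2),
      continuously_differentiable psi
    & continuously_differentiable xi].

Definition lipschitz_coefficients (K : R) : Prop :=
  [/\ forall m w t y1 y2 u1 u2, 0 <= t <= T ->
        enorm (sigma m w t y1 u1 - sigma m w t y2 u2)
          <= K * (enorm (y1 - y2) + enorm (u1 - u2)),
      forall w t z y1 y2 u1 u2, 0 <= t <= T -> z != 0 ->
        enorm (lam w t y1 z u1 - lam w t y2 z u2)
          <= K * (enorm (y1 - y2) + enorm (u1 - u2)),
      forall y1 y2, enorm (psi y1 - psi y2) <= K * enorm (y1 - y2)
    & forall y1 y2, enorm (xi y1 - xi y2) <= K * enorm (y1 - y2)].

Definition square_integrable_process X : Prop :=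
  (forall i, adapted P T W N 0 T (fun t w => X t w 0 i)) /\
  (forall t, 0 <= t <= T -> (\int[P]_w (enorm (X t w) ^+ 2)%:E < +oo)%E).

Definition distance2 X Z (t s : R) (w : O) : R :=
  `|t - s| ^+ 2 + enorm (X t w - Z s w) ^+ 2
    + \int[P]_v (enorm (X t v - Z s v) ^+ 2).

Definition process_lipschitz (K : R) (vrho : R -> R) : Prop :=
  forall X Z, square_integrable_process X -> square_integrable_process Z ->
  forall t s, 0 <= t <= T -> 0 <= s <= T ->
  (forall m, {ae P, forall w,
     enorm (sigma m w t (X t w) (mean P (psi \o X t))
            - sigma m w s (Z s w) (mean P (psi \o Z s))) ^+ 2
       <= K * distance2 X Z t s w}) /\
  (forall z, z != 0 -> {ae P, forall w,
     enorm (lam w t (X t w) z (mean P (xi \o X t))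
            - lam w s (Z s w) z (mean P (xi \o Z s))) ^+ 2
       <= vrho z * distance2 X Z t s w}).

Definition linear_growth : Prop :=
  exists C : R,
  [/\ forall t y, 0 <= t <= T -> enorm (b t y) <= C * (1 + enorm y),
      forall m w t y u, 0 <= t <= T ->
        enorm (sigma m w t y u) <= C * (1 + enorm y + enorm u),
      forall w t y z u, 0 <= t <= T -> z != 0 ->
        enorm (lam w t y z u) <= C * (1 + enorm y + enorm u),
      forall y, enorm (psi y) <= C * (1 + enorm y)
    & forall y, enorm (xi y) <= C * (1 + enorm y)].

Definition drift_lipschitz : Prop :=
  exists L : R, forall t s y u, 0 <= t <= T -> 0 <= s <= T ->
  enorm (b t y - b s u) <= L * (`|t - s| + enorm (y - u)).

Definition bounded_nonzero_mean_ode_solution (f : R -> Rk) : Prop :=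
  [/\ f 0 = x,
      {within `[0, T], continuous f},
      forall t i, 0 < t < T ->
        is_derive t 1 (fun s => f s 0 i) (cmul (b t (f t)) (f t) 0 i),
      exists M : R, forall t, 0 <= t <= T -> enorm (f t) <= M
    & forall t, 0 <= t <= T -> f t != 0].

Definition mean_ode_well_posed : Prop :=
  exists2 f, bounded_nonzero_mean_ode_solution f &
  forall g, bounded_nonzero_mean_ode_solution g ->
  forall t, 0 <= t <= T -> g t = f t.

Definition cadlag_adapted X : Prop :=
  (forall i, adapted P T W N 0 T (fun t w => X t w 0 i)) /\
  (forall i w, cadlag 0 T (fun t => X t w 0 i)).

Definition sde_solution X : Prop :=
  [/\ cadlag_adapted X,
      (\int[P]_w ereal_sup [set (enorm (X t w) ^+ 2)%:E | t in `[0%R, T]]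
         < +oo)%E
    & exists (I : 'I_d -> 'I_k -> R -> O -> R) (J : 'I_k -> R -> O -> R),
      [/\ forall m i, brownian_integral P T W N m 0 T
            (fun s w => sigma m w s (X s w) (mean P (psi \o X s)) 0 i) (I m i),
          forall i, poisson_integral P T W mu N 0 T
            (fun s z w => lam w s (X s w) z (mean P (xi \o X s)) 0 i) (J i)
        & {ae P, forall w, forall t, 0 <= t <= T -> forall i,
            X t w 0 i = x 0 i
              + \int[lebesgue_measure]_(s in `[0, t])
                  cmul (b s (mean P (X s))) (X s w) 0 i
              + \sum_m I m i t w + J i t w}]].

(* On each [t_j, t_{j+1}] the stochastic integrals start at t_j. *)
Definition euler_scheme (n : nat) X : Prop :=
  let grid (j : nat) : R := j%:R * T / n%:R in
  [/\ cadlag_adapted X,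
      {ae P, forall w, X 0 w = x}
    & forall j, (j < n)%N ->
      let tj := grid j in let tj1 := grid j.+1 in
      exists (I : 'I_d -> 'I_k -> R -> O -> R) (J : 'I_k -> R -> O -> R),
      [/\ forall m i, brownian_integral P T W N m tj tj1
            (fun _ w => sigma m w tj (X tj w) (mean P (psi \o X tj)) 0 i)
            (I m i),
          forall i, poisson_integral P T W mu N tj tj1
            (fun _ z w => lam w tj (X tj w) z (mean P (xi \o X tj)) 0 i) (J i)
        & {ae P, forall w, forall t, tj <= t <= tj1 -> forall i,
            X t w 0 i = X tj w 0 i
              + \int[lebesgue_measure]_(s in `[tj, t])
                  cmul (b tj (mean P (X tj))) (X tj w) 0 i
              + \sum_m I m i t w + J i t w}]].

End equation.

(* Main.v *)
(* Let e_j = E sup_{t <= t_j} |X_t - X^n_t|^2 and h = T/n. On [0, t_j] each coordinate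
   of X - X^n is a drift integral plus stochastic integrals of differences of the form
   c(s, X_s, E phi(X_s)) - c(t_l, X^n_{t_l}, E phi(X^n_{t_l})), s in ]t_l, t_{l+1}].
   Doob's L^2 maximal inequality, the isometries of the two integrals, the Lipschitz
   bounds and E|X_s - X_{t_l}|^2 <= C h give e_j <= a h + c h (e_0 + ... + e_{j-1}),
   hence e_j <= a h (1 + c h)^j <= a h exp(c T).
   The drift b(t, E X) X being a product, a and c depend on a bound for b at E X^n_{t_l}.
   For small h the induction itself provides it, since e_l <= 1 bounds E|X^n_{t_l}|^2
   uniformly in n; the finitely many other n only enlarge the final constant. *)
Require Import Defs.
From HB Require Import structures.
From mathcomp Require Import all_boot all_order all_algebra.
From mathcomp Require Import all_classical all_reals all_analysis.
From mathcomp Require Import measurable_realfun.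
From mathcomp Require Import ring lra.
Import Order.TTheory GRing.Theory Num.Theory.
Import numFieldNormedType.Exports.
Local Open Scope classical_set_scope.
Local Open Scope ring_scope.

Set Implicit Arguments.
Unset Strict Implicit.
Unset Printing Implicit Defensive.

(** The two stochastic integrals are given only as L^2-limits of simple integrals. Both are reduced
    to one predicate [isint] over an abstract [noise] with marks, so that isometry, martingale
    property and maximal inequality are proved once. The Euler integrals live on separate cells;
    freezing each of them outside its cell by [clamp] makes it a process on [0, T], so that the
    error has one martingale for each driving noise and the maximal inequality covers all cells at
    once. Two features of the setting shape the rest. The filtration is right-continuous, whereas an
    increment starting at u is known to be independent only of the events generated up to u;
    identities at time s are therefore obtained at times u > s and carried over by letting u
    decrease to s. A supremum over uncountably many times is not known to be measurable, so it is
    always compared with a measurable majorant. Constants are not optimised: passing to L^2-limits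
    costs a factor 4 in the isometry and the two-sided maximal inequality a factor 8, whence the 32
    in the final estimates. *)

Section square_integrable.
Context {d : measure_display} {T : measurableType d} {R : realType}
  (m : {measure set T -> \bar R}).
Implicit Types (f g h : T -> R) (c : R).

(** * Calculus of square integrable functions *)

Definition sqnorm f : \bar R := (\int[m]_x (f x ^+ 2)%:E)%E.

Definition L2 f := measurable_fun setT f /\ (sqnorm f < +oo)%E.

Definition ip f g : R := \int[m]_x (f x * g x).

Lemma sqnorm_ge0 f : (0 <= sqnorm f)%E.
Proof. by apply: integral_ge0 => x _; rewrite lee_fin sqr_ge0. Qed.

Lemma measurable_sqE f : measurable_fun setT f ->
  measurable_fun setT (fun x => (f x ^+ 2)%:E).
Proof. by move=> mf; apply/measurable_EFinP; exact: measurable_funX. Qed.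

Lemma sqnorm_le f g c : measurable_fun setT f -> measurable_fun setT g ->
  0 <= c -> (forall x, f x ^+ 2 <= c * g x ^+ 2) ->
  (sqnorm f <= c%:E * sqnorm g)%E.
Proof.
move=> mf mg c0 fg; rewrite /sqnorm -ge0_integralZl//; last 2 first.
- exact: measurable_sqE.
- by move=> x _; rewrite lee_fin sqr_ge0.
apply: ge0_le_integral => //.
- by move=> x _; rewrite lee_fin sqr_ge0.
- exact: measurable_sqE.
- by apply: measurable_funeM; exact: measurable_sqE.
- by move=> x _; rewrite -EFinM lee_fin.
Qed.

Lemma sqnormD_le f g : measurable_fun setT f -> measurable_fun setT g ->
  (sqnorm (fun x => f x + g x)%R <= 2%:E * sqnorm f + 2%:E * sqnorm g)%E.
Proof.
move=> mf mg; rewrite /sqnorm.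
rewrite -ge0_integralZl//; [|exact: measurable_sqE|by move=> x _; rewrite lee_fin sqr_ge0].
rewrite -ge0_integralZl//; [|exact: measurable_sqE|by move=> x _; rewrite lee_fin sqr_ge0].
rewrite -ge0_integralD//; last 4 first.
- by move=> x _; rewrite mule_ge0 ?lee_fin// sqr_ge0.
- by apply: measurable_funeM; exact: measurable_sqE.
- by move=> x _; rewrite mule_ge0 ?lee_fin// sqr_ge0.
- by apply: measurable_funeM; exact: measurable_sqE.
apply: ge0_le_integral => //.
- by move=> x _; rewrite lee_fin sqr_ge0.
- by apply: measurable_sqE; exact: measurable_funD.
- by apply: emeasurable_funD; apply: measurable_funeM; exact: measurable_sqE.
- by move=> x _; rewrite -!EFinM -EFinD lee_fin; have := sqr_ge0 (f x - g x); lra.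
Qed.

Lemma L2D f g : L2 f -> L2 g -> L2 (fun x => f x + g x).
Proof.
move=> [mf f2] [mg g2]; split; first exact: measurable_funD.
apply: le_lt_trans (sqnormD_le mf mg) _.
by rewrite lte_add_pinfty// lte_mul_pinfty.
Qed.

Lemma sqnormZ c f : measurable_fun setT f ->
  sqnorm (fun x => c * f x) = ((c ^+ 2)%:E * sqnorm f)%E.
Proof.
move=> mf; rewrite /sqnorm -ge0_integralZl//; last 3 first.
- exact: measurable_sqE.
- by move=> x _; rewrite lee_fin sqr_ge0.
- by rewrite lee_fin sqr_ge0.
by apply: eq_integral => x _; rewrite exprMn EFinM.
Qed.

Lemma sqnormN f : sqnorm (fun x => - f x) = sqnorm f.
Proof. by apply: eq_integral => x _; rewrite sqrrN. Qed.

Lemma L2Z c f : L2 f -> L2 (fun x => c * f x).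
Proof.
move=> [mf f2]; split; first exact: measurable_funM.
by rewrite sqnormZ// lte_mul_pinfty// ?lee_fin ?sqr_ge0// ltry.
Qed.

Lemma L2N f : L2 f -> L2 (fun x => - f x).
Proof. by move=> [mf f2]; split; [exact: measurable_funN|rewrite sqnormN]. Qed.

Lemma L2B f g : L2 f -> L2 g -> L2 (fun x => f x - g x).
Proof. by move=> f2 g2; apply: L2D => //; exact: L2N. Qed.

Lemma L20 : L2 (fun=> 0).
Proof.
split; first exact: measurable_cst.
by rewrite /sqnorm; under eq_integral do rewrite expr0n; rewrite integral0.
Qed.

Lemma L2_sum (I : Type) (r : seq I) (F : I -> T -> R) : (forall i, L2 (F i)) ->
  L2 (fun x => \sum_(i <- r) F i x).
Proof.
move=> F2; elim: r => [|i r IH].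
  by rewrite (_ : (fun _ => _) = fun=> 0); [exact: L20|
     apply/funext => x; rewrite big_nil].
rewrite (_ : (fun _ => _) = fun x => F i x + \sum_(i <- r) F i x); last first.
  by apply/funext => x; rewrite big_cons.
exact: L2D.
Qed.

Lemma L2_le f g c : measurable_fun setT f -> L2 g -> 0 <= c ->
  (forall x, f x ^+ 2 <= c * g x ^+ 2) -> L2 f.
Proof.
move=> mf [mg g2] c0 fg; split => //.
by apply: le_lt_trans (sqnorm_le mf mg c0 fg) _; rewrite lte_mul_pinfty.
Qed.

Lemma L2_bounded_mul f h c : measurable_fun setT h -> (forall x, `|h x| <= c) ->
  L2 f -> L2 (fun x => h x * f x).
Proof.
move=> mh hc f2; apply: (@L2_le _ f (c ^+ 2)) => //.
- by apply: measurable_funM => //; exact: f2.1.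
- exact: sqr_ge0.
- move=> x; rewrite exprMn ler_wpM2r ?sqr_ge0// -real_normK ?num_real//.
  by rewrite ler_sqr ?nnegrE//; exact: le_trans (hc x).
Qed.

Lemma integrable_sqr f : L2 f -> m.-integrable setT (fun x => (f x ^+ 2)%:E).
Proof.
move=> [mf f2]; apply/integrableP; split; first exact: measurable_sqE.
by under eq_integral do rewrite /= ger0_norm ?sqr_ge0//.
Qed.

Lemma integrable_mul f g : L2 f -> L2 g ->
  m.-integrable setT (fun x => (f x * g x)%:E).
Proof.
move=> f2 g2.
apply: (@le_integrable _ _ _ m setT _ _
    (fun x => (f x ^+ 2)%:E + (g x ^+ 2)%:E)%E) => //.
- by apply/measurable_EFinP; apply: measurable_funM; [exact: f2.1|exact: g2.1].
- move=> x _ /=; rewrite lee_fin [leRHS]ger0_norm ?addr_ge0 ?sqr_ge0//.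
  rewrite ler_norml; have := sqr_ge0 (f x - g x); have := sqr_ge0 (f x + g x).
  have := sqr_ge0 (f x); have := sqr_ge0 (g x).
  by move=> *; apply/andP; split; lra.
- by apply: integrableD => //; exact: integrable_sqr.
Qed.

Lemma integrable_EFinD f g : m.-integrable setT (EFin \o f) ->
  m.-integrable setT (EFin \o g) ->
  m.-integrable setT (EFin \o (fun x => f x + g x)).
Proof.
by move=> fi gi; apply: eq_integrable (integrableD _ fi gi) => // x _ /=.
Qed.

Lemma ipC f g : ip f g = ip g f.
Proof. by apply: eq_Rintegral => x _; rewrite mulrC. Qed.

Lemma ipDr f g h : L2 f -> L2 g -> L2 h ->
  ip f (fun x => g x + h x) = ip f g + ip f h.
Proof.
move=> f2 g2 h2; rewrite /ip -RintegralD//; try exact: integrable_mul.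
by apply: eq_Rintegral => x _; rewrite mulrDr.
Qed.

Lemma ipZr f g c : L2 f -> L2 g -> ip f (fun x => c * g x) = c * ip f g.
Proof.
move=> f2 g2; rewrite /ip -RintegralZl//; try exact: integrable_mul.
by apply: eq_Rintegral => x _; rewrite mulrCA.
Qed.

Lemma ipNr f g : L2 f -> L2 g -> ip f (fun x => - g x) = - ip f g.
Proof.
move=> f2 g2; rewrite -mulN1r -ipZr//.
by apply: eq_Rintegral => x _; rewrite mulN1r.
Qed.

Lemma ipBr f g h : L2 f -> L2 g -> L2 h ->
  ip f (fun x => g x - h x) = ip f g - ip f h.
Proof. by move=> f2 g2 h2; rewrite ipDr// ?ipNr//; exact: L2N. Qed.

Lemma ipDl f g h : L2 f -> L2 g -> L2 h ->
  ip (fun x => g x + h x) f = ip g f + ip h f.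
Proof. by move=> *; rewrite ipC ipDr// (ipC f g) (ipC f h). Qed.

Lemma ipBl f g h : L2 f -> L2 g -> L2 h ->
  ip (fun x => g x - h x) f = ip g f - ip h f.
Proof. by move=> *; rewrite ipC ipBr// (ipC f g) (ipC f h). Qed.

Lemma ipZl f g c : L2 f -> L2 g -> ip (fun x => c * g x) f = c * ip g f.
Proof. by move=> *; rewrite ipC ipZr// (ipC f g). Qed.

Lemma ip0r f : ip f (fun=> 0) = 0.
Proof.
rewrite /ip; under eq_Rintegral do rewrite mulr0.
by rewrite /Rintegral integral0.
Qed.

Lemma ip_sumr (I : Type) (r : seq I) f (F : I -> T -> R) :
  L2 f -> (forall i, L2 (F i)) ->
  ip f (fun x => \sum_(i <- r) F i x) = \sum_(i <- r) ip f (F i).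
Proof.
move=> f2 F2; elim: r => [|i r IH].
  by rewrite big_nil -[RHS](ip0r f); apply: eq_Rintegral => x _; rewrite big_nil.
rewrite big_cons -IH -ipDr//; last exact: L2_sum.
by apply: eq_Rintegral => x _; rewrite big_cons.
Qed.

Lemma eq_ip f g f' g' : (forall x, f x * g x = f' x * g' x) -> ip f g = ip f' g'.
Proof. by move=> fg; apply: eq_Rintegral => x _; rewrite fg. Qed.

Lemma sqnormE f : L2 f -> sqnorm f = (ip f f)%:E.
Proof.
move=> f2; rewrite /ip /Rintegral fineK//; last first.
  by apply: integrable_fin_num => //; exact: integrable_mul.
Qed.

Lemma ip_ge0 f : 0 <= ip f f.
Proof. by apply: Rintegral_ge0 => x _; rewrite -expr2 sqr_ge0. Qed.

Lemma ip_sqrD f g : L2 f -> L2 g ->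
  ip (fun x => f x + g x) (fun x => f x + g x) = ip f f + 2 * ip f g + ip g g.
Proof.
move=> f2 g2; rewrite ipDl//; last exact: L2D.
by rewrite !ipDr// (ipC g f); ring.
Qed.

(** The polynomial c |-> ||f + c g||^2 is nonnegative. *)
Lemma cauchy_schwarz f g : L2 f -> L2 g -> ip f g ^+ 2 <= ip f f * ip g g.
Proof.
move=> f2 g2.
have H c : 0 <= ip f f + 2 * c * ip f g + c ^+ 2 * ip g g.
  have := ip_ge0 (fun x => f x + c * g x); rewrite ip_sqrD//; last exact: L2Z.
  by rewrite !ipZr// ?ipZl//; [move=> H; apply: le_trans H _; lra|exact: L2Z].
have [g0|gN0] := eqVneq (ip g g) 0.
  rewrite g0 mulr0; suff -> : ip f g = 0 by rewrite expr0n.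
  apply/eqP; rewrite -[_ == _]negbK; apply/negP => fg0.
  (* When ||g|| = 0 the polynomial is affine in c; this c would make it equal to -1. *)
  have := H (- (ip f f + 1) / (2 * ip f g)).
  rewrite g0 mulr0 addr0 (_ : _ + _ = - 1); first by rewrite ler0N1.
  by field.
have gp : 0 < ip g g by rewrite lt_neqAle eq_sym gN0 ip_ge0.
(* The minimiser of the polynomial. *)
have := H (- ip f g / ip g g).
rewrite (_ : _ + _ + _ = (ip f f * ip g g - ip f g ^+ 2) / ip g g); last by field.
by rewrite pmulr_lge0 ?invr_gt0// subr_ge0.
Qed.

(** By Cauchy-Schwarz a^2 <= ||f||^2 ||g_n||^2, which tends to 0. The martingale property of a limit
    is proved this way: h_n is an increment already known to be orthogonal to f and g_n the error
    made by using it. *)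
Lemma ip_small_eq a f (g h : nat -> T -> R) : L2 f ->
  (forall n, L2 (g n)) -> (forall n, L2 (h n)) ->
  (forall n, ip f (h n) = 0) ->
  (forall n, a = ip f (g n) + ip f (h n)) ->
  sqnorm (g n) @[n --> \oo] --> 0%E -> a = 0.
Proof.
move=> f2 g2 h2 fh afg gn; apply/eqP; rewrite -[_ == _]negbK; apply/negP => a0.
(* The added 1 keeps the divisor positive when f has norm 0. *)
have f1 : 0 < ip f f + 1 by rewrite ltr_wpDl ?ip_ge0.
have e0 : (0 < ((a ^+ 2) / (ip f f + 1))%:E)%E.
  by rewrite lte_fin divr_gt0// exprn_even_gt0.
move: e0; rewrite lte_fin => e0.
have /fine_cvgP[_ /cvgrPdist_lt /(_ _ e0)[n _ /(_ n (leqnn n)) /=]] := gn.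
rewrite sqnormE//= sub0r normrN ger0_norm ?ip_ge0//.
rewrite ltr_pdivlMr// => /lt_geF.
have := cauchy_schwarz f2 (g2 n); rewrite -[ip f (g n)]addr0 -(fh n) -afg => H.
suff -> : a ^+ 2 <= ip (g n) (g n) * (ip f f + 1) by [].
by apply: le_trans H _; rewrite mulrC ler_wpM2l ?ip_ge0// lerDl.
Qed.

Lemma sqnorm_cvgD (f g : nat -> T -> R) :
  (forall n, measurable_fun setT (f n)) -> (forall n, measurable_fun setT (g n)) ->
  sqnorm (f n) @[n --> \oo] --> 0%E -> sqnorm (g n) @[n --> \oo] --> 0%E ->
  sqnorm (fun x => f n x + g n x) @[n --> \oo] --> 0%E.
Proof.
move=> mf mg f0 g0.
apply: (@squeeze_cvge _ _ _ _ (cst 0%E) _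
  (fun n => 2%:E * sqnorm (f n) + 2%:E * sqnorm (g n))%E).
- by apply: nearW => n; rewrite sqnorm_ge0 sqnormD_le.
- exact: cvg_cst.
- rewrite [X in _ --> X](_ : _ = 2%:E * 0 + 2%:E * 0)%E; last by rewrite !mule0 adde0.
  by apply: cvgeD; [rewrite mule0|exact: cvgeZl|exact: cvgeZl].
Qed.

End square_integrable.

Lemma le_of_cvge0 {R : realType} (x y : \bar R) (c : R) (u : nat -> \bar R) :
  u n @[n --> \oo] --> 0%E ->
  (forall n, (x <= c%:E * u n + y)%E) -> (x <= y)%E.
Proof.
move=> u0 xuy; rewrite -[leRHS]add0e -(mule0 c%:E).
have H : (fun n => c%:E * u n + y)%E @ \oo --> (c%:E * 0 + y)%E.
  by apply: cvgeD; [rewrite mule0|exact: cvgeZl|exact: cvg_cst].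
by apply: (cvge_ge _ H); exact: nearW.
Qed.

(** * Upper bounds for integrals of functions not known to be measurable *)

Section unmeasurable_bounds.
Context {d : measure_display} {T : measurableType d} {R : realType}
  (m : {measure set T -> \bar R}).
Local Open Scope ereal_scope.

(** The integral of a nonnegative function is the supremum of the integrals of the simple functions
    below it, measurable or not, and this supremum is monotone. *)
Lemma ge0_le_integral_any (f g : T -> \bar R) :
  (forall x, 0 <= f x) -> (forall x, f x <= g x) ->
  \int[m]_x f x <= \int[m]_x g x.
Proof.
move=> f0 fg; rewrite !ge0_integralTE//; last first.
  by move=> x; exact: le_trans (f0 x) (fg x).
apply: le_ereal_sup => _ [h hf <-]; exists h => // x.
exact: le_trans (hf x) (fg x).
Qed.

(** This is how suprema over uncountably many times are estimated: only the majorant has to be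
    measurable. *)
Lemma ae_le_integral_any (f g : T -> \bar R) :
  (forall x, 0 <= f x) -> (forall x, 0 <= g x) -> measurable_fun setT g ->
  {ae m, forall x, f x <= g x} -> \int[m]_x f x <= \int[m]_x g x.
Proof.
move=> f0 g0 mg [N [mN N0 fgN]].
(* Raising the majorant to +oo on the exceptional null set makes the comparison hold everywhere and
   leaves its integral unchanged. *)
pose h x := if x \in N then +oo else g x.
have mh : measurable_fun setT h.
  apply: measurable_fun_ifT => //.
  apply: (@measurable_fun_bool _ _ _ _ true).
  rewrite setTI (_ : _ @^-1` _ = N)//.
  by apply/seteqP; split => x /= => [/set_mem|/mem_set].
apply: (@le_trans _ _ (\int[m]_x h x)).
  apply: ge0_le_integral_any => // x; rewrite /h; case: ifPn => [_|xN].
    by rewrite leey.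
  move: xN; apply: contraNT => fg; rewrite inE; apply: fgN => /=.
  exact/negP.
rewrite le_eqVlt; apply/orP; left; apply/eqP; apply: ge0_ae_eq_integral => //.
- by move=> x _; rewrite /h; case: ifPn => // _; rewrite leey.
- exists N; split => // x /= H; apply: contrapT => xN; apply: H => _.
  by rewrite /h memNset.
Qed.

End unmeasurable_bounds.

Lemma at_right_near {R : realType} (Q : R -> Prop) (t : R) :
  (\forall s \near t^'+, Q s) ->
  exists2 e, 0 < e & forall s, t < s -> s < t + e -> Q s.
Proof.
move=> [e /= e0 H]; exists e => // s ts se; apply: H => //=.
by rewrite ltr0_norm ?subr_lt0// opprB ltrBlDl.
Qed.

(** * Doob's maximal inequality in L^2 for right-continuous martingales *)

Section maximal_inequality.
Context {d : measure_display} {O : measurableType d} {R : realType}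
  (P : {measure set O -> \bar R}).
Variable F : R -> set (set O).
Hypothesis F_mono : forall s t, s <= t -> F s `<=` F t.
Hypothesis F_meas : forall t, F t `<=` measurable.
Implicit Types (Y : O -> R) (D : R -> O -> R).

Definition mfun s Y := measurable_fun setT (Y : g_sigma_algebraType (F s) -> R).

Lemma mfun_mono s t Y : s <= t -> mfun s Y -> mfun t Y.
Proof.
move=> st mY mT B mB; have := mY measurableT B mB.
by apply: sub_sigma_algebra2; exact: F_mono.
Qed.

Lemma mfun_measurable s Y : mfun s Y -> measurable_fun setT Y.
Proof.
move=> mY _ B mB; have := mY measurableT B mB.
apply: smallest_sub; last exact: F_meas.
exact: sigma_algebra_measurable.
Qed.

Definition adapted_L2 (u : R) D := forall t, 0 <= t <= u ->
  mfun t (D t) /\ L2 P (D t).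

(** Orthogonality of the increments to all square integrable variables known at time s stands in for
    conditional expectations; it passes to L^2-limits by Cauchy-Schwarz. *)
Definition martingale (u : R) D := forall s t, 0 <= s -> s <= t -> t <= u ->
  forall Y, mfun s Y -> L2 P Y -> ip P Y (fun w => D t w - D s w) = 0.

(** The value 0 is included to keep the maximum nonnegative. It controls D from above only; the
    other side comes from applying it to -D. *)
Fixpoint running_max D (q : nat -> R) n : O -> R := fun w =>
  if n is k.+1 then Num.max (running_max D q k w) (D (q n) w)
  else Num.max 0 (D (q 0%N) w).

Lemma running_max_ge0 D q n w : 0 <= running_max D q n w.
Proof. by elim: n => [|n IH] /=; rewrite le_max ?lexx// IH. Qed.

Lemma running_max_ub D q n k w : (k <= n)%N -> D (q k) w <= running_max D q n w.
Proof.
elim: n => [|n IH] /=; first by rewrite leqn0 => /eqP ->; rewrite le_max lexx orbT.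
rewrite leq_eqVlt => /orP[/eqP ->|]; first by rewrite le_max lexx orbT.
by rewrite ltnS => /IH H; rewrite le_max H.
Qed.

Lemma running_max_le D q n c w : 0 <= c -> (forall k, (k <= n)%N -> D (q k) w <= c) ->
  running_max D q n w <= c.
Proof.
move=> c0; elim: n => [|n IH] /= H; rewrite ge_max ?c0 ?H//.
by rewrite IH// => k kn; apply: H; exact: leq_trans kn _.
Qed.

Lemma running_max_adapted u D (q : nat -> R) n : adapted_L2 u D ->
  (forall k, (k <= n)%N -> 0 <= q k <= u) ->
  (forall k, (k < n)%N -> q k <= q k.+1) ->
  mfun (q n) (running_max D q n) /\ L2 P (running_max D q n).
Proof.
move=> aD; elim: n => [|n IH] qb qm /=.
  have [mD D2] := aD _ (qb 0%N (leqnn _)).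
  have mx : mfun (q 0%N) (fun w => Num.max 0 (D (q 0%N) w)).
    exact: (@measurable_maxr _ (g_sigma_algebraType (F (q 0%N)))).
  split => //; apply: (@L2_le _ _ _ _ _ (D (q 0%N)) 1) => //.
    exact: mfun_measurable mx.
  by move=> w; rewrite mul1r; case: (leP 0 (D _ w)) => _ //; rewrite expr0n/= sqr_ge0.
have [mD D2] := aD _ (qb n.+1 (leqnn _)).
have [||mm m2] := IH.
- by move=> k kn; apply: qb; exact: leq_trans kn _.
- by move=> k kn; apply: qm; exact: leq_trans kn _.
have mx : mfun (q n.+1) (fun w => Num.max (running_max D q n w) (D (q n.+1) w)).
  apply: (@measurable_maxr _ (g_sigma_algebraType (F (q n.+1)))) => //.
  by apply: (@mfun_mono (q n)) => //; exact: qm.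
split => //.
have /(L2D m2) : L2 P (fun w => `|D (q n.+1) w|).
  apply: (@L2_le _ _ _ _ _ (D (q n.+1)) 1) => //.
  - by apply: measurableT_comp => //; exact: D2.1.
  - by move=> w; rewrite mul1r real_normK// num_real.
move=> /L2_le -/(_ _ 1); apply => //; first exact: mfun_measurable mx.
move=> w; rewrite mul1r; have := running_max_ge0 D q n w.
have := normr_ge0 (D (q n.+1) w); have := ler_norm (D (q n.+1) w).
case: (leP (running_max D q n w)) => H1 H2 H3 H4; rewrite ler_sqr ?nnegrE//; lra.
Qed.

(* With running maximum m_n of S, pathwise m_{n+1}^2 - m_n^2 <= 2 (m_{n+1} - m_n) S_{n+1}
   since S_{n+1} = m_{n+1} whenever the maximum increases; the martingale property
   turns this into E m_n^2 <= 2 E (m_n S_n). *)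
Lemma running_max_ip u D (q : nat -> R) n : adapted_L2 u D -> martingale u D ->
  (forall k, (k <= n)%N -> 0 <= q k <= u) ->
  (forall k, (k < n)%N -> q k <= q k.+1) ->
  ip P (running_max D q n) (running_max D q n) <=
  2 * ip P (running_max D q n) (D (q n)).
Proof.
move=> aD MD; elim: n => [|n IH] qb qm.
  have [_ m2] := running_max_adapted aD qb qm.
  have [_ D2] := aD _ (qb 0%N (leqnn _)).
  rewrite -ipZr// /ip; apply: le_Rintegral => //; try exact: integrable_mul.
    by apply: integrable_mul => //; exact: L2Z.
  by move=> w _; rewrite [running_max _ _ _ _]/=; case: (leP 0 (D _ w)) => H; nra.
have qbn k : (k <= n)%N -> 0 <= q k <= u.
  by move=> kn; apply: qb; exact: leq_trans kn _.
have qmn k : (k < n)%N -> q k <= q k.+1.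
  by move=> kn; apply: qm; exact: leq_trans kn _.
have [_ m2'] := running_max_adapted aD qb qm.
have [mm m2] := running_max_adapted aD qbn qmn.
have [_ D2'] := aD _ (qb n.+1 (leqnn _)).
have [_ D2] := aD _ (qb n (leqnSn _)).
have {IH} := IH qbn qmn.
set m := running_max D q n in mm m2 *; set m' := running_max D q n.+1 in m2' *.
(* The maximum m is known at time [q n], so it is orthogonal to the next increment. *)
have MmD : ip P m (D (q n.+1)) = ip P m (D (q n)).
  apply/eqP; rewrite -subr_eq0 -ipBr//; apply/eqP; apply: MD => //.
  - by have /andP[] := qb n (leqnSn _).
  - exact: qm.
  - by have /andP[] := qb n.+1 (leqnn _).
have : ip P m' m' <= ip P m m + 2 * (ip P m' (D (q n.+1)) - ip P m (D (q n.+1))).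
  have mm2 : L2 P (fun w => 2 * (m' w - m w)) by apply: L2Z; exact: L2B.
  rewrite (_ : 2 * _ = ip P (fun w => 2 * (m' w - m w)) (D (q n.+1))); last first.
    rewrite ipZl//; last exact: L2B.
    by rewrite ipBl.
  rewrite /ip -RintegralD//; try exact: integrable_mul.
  apply: le_Rintegral => //; try exact: integrable_mul.
    by apply: integrable_EFinD; exact: integrable_mul.
  by move=> w _; rewrite /m' [running_max _ _ n.+1 _]/= -/m; case: (leP (m w)) => H; nra.
rewrite MmD; lra.
Qed.

(** Combining ||m||^2 <= 2 <m, S> with 0 <= ||m - 2 S||^2 = ||m||^2 - 4 <m, S> + 4 ||S||^2 gives
    ||m||^2 <= 4 ||S||^2 without dividing by ||m||. *)
Lemma sqnorm_running_max u D (q : nat -> R) n : adapted_L2 u D -> martingale u D ->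
  (forall k, (k <= n)%N -> 0 <= q k <= u) ->
  (forall k, (k < n)%N -> q k <= q k.+1) ->
  (sqnorm P (running_max D q n) <= 4%:E * sqnorm P (D (q n)))%E.
Proof.
move=> aD MD qb qm; have [_ m2] := running_max_adapted aD qb qm.
have [_ D2] := aD _ (qb n (leqnn _)).
rewrite !sqnormE// -EFinM lee_fin.
have := running_max_ip aD MD qb qm.
have := ip_ge0 P (fun w => running_max D q n w + (- 2) * D (q n) w).
rewrite ip_sqrD//; last exact: L2Z.
rewrite !ipZr// ?ipZl//; last exact: L2Z.
lra.
Qed.

Let dyadic (u : R) N (k : nat) : R := k%:R * u / (2 ^ N)%:R.

Lemma dyadic_in u N k : 0 <= u -> (k <= 2 ^ N)%N -> 0 <= dyadic u N k <= u.
Proof.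
move=> u0 kN; rewrite /dyadic divr_ge0 ?mulr_ge0 ?ler0n//=.
by rewrite ler_pdivrMr ?ltr0n ?expn_gt0// mulrC ler_wpM2l// ler_nat.
Qed.

Lemma dyadic_le u N k : 0 <= u -> dyadic u N k <= dyadic u N k.+1.
Proof.
by move=> u0; rewrite /dyadic ler_wpM2r ?invr_ge0 ?ler0n// ler_wpM2r// ler_nat.
Qed.

Lemma dyadic_double u N k : dyadic u N k = dyadic u N.+1 (2 * k).
Proof.
by rewrite /dyadic expnS !natrM; field.
Qed.

Lemma dyadic_end u N : dyadic u N (2 ^ N) = u.
Proof.
by rewrite /dyadic mulrAC divff ?mul1r// pnatr_eq0 -lt0n expn_gt0.
Qed.

Lemma dyadic_dense u (s t : R) : 0 <= s -> s < t -> t <= u ->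
  exists N k, [/\ (k <= 2 ^ N)%N, s < dyadic u N k & dyadic u N k < t].
Proof.
move=> s0 st tu.
have u0 : 0 < u by apply: lt_le_trans tu; exact: le_lt_trans st.
have [N HN] : exists N, u / (t - s) < (2 ^ N)%:R.
  exists (Num.truncn (u / (t - s))).+1.
  apply: lt_trans (truncnS_gt _) _; rewrite ltr_nat; exact: ltn_expl.
have p0 : 0 < (2 ^ N)%:R :> R by rewrite ltr0n expn_gt0.
(* x is s in units of the mesh u / 2^N, which is smaller than t - s; hence the first grid point
   beyond s, of index floor(x) + 1, lies before t. *)
pose x := s * (2 ^ N)%:R / u.
have x0 : 0 <= x by apply: divr_ge0; [apply: mulr_ge0 => //; exact: ltW|exact: ltW].
have xs : s = x * u / (2 ^ N)%:R by rewrite /x; field; rewrite !gt_eqF.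
have ts : u / (2 ^ N)%:R < t - s.
  by rewrite ltr_pdivrMr// mulrC -ltr_pdivrMr// subr_gt0.
have lo : s < dyadic u N (Num.truncn x).+1.
  by rewrite {1}xs /dyadic ltr_pM2r ?invr_gt0// ltr_pM2r// truncnS_gt.
have hi : dyadic u N (Num.truncn x).+1 < t.
  rewrite /dyadic -natr1 mulrDl mul1r mulrDl -[t](subrK s) [ltRHS]addrC.
  apply: ler_ltD ts; rewrite [leRHS]xs ler_pM2r ?invr_gt0// ler_pM2r//.
  by rewrite truncn_le.
exists N, (Num.truncn x).+1; split => //.
rewrite -(ler_nat R) -(ler_pM2r u0) -(ler_pM2r (_ : 0 < (2 ^ N)%:R^-1)) ?invr_gt0//.
by rewrite -/(dyadic u N _) mulrAC divff ?gt_eqF// mul1r (le_trans (ltW hi)).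
Qed.

(** Dyadic grids are nested, so the running maxima over them increase, their limit is a measurable
    majorant and monotone convergence applies. D and -D each contribute the constant 4, whence 8. *)
Lemma maximal_inequality (u : R) D : 0 <= u -> adapted_L2 u D -> martingale u D ->
  (forall w (t : R), 0 <= t < u -> D s w @[s --> t^'+] --> D t w) ->
  exists Z : O -> \bar R, [/\ measurable_fun setT Z,
    forall w (t : R), 0 <= t <= u -> ((D t w ^+ 2)%:E <= Z w)%E &
    (\int[P]_w Z w <= 8%:E * sqnorm P (D u))%E].
Proof.
move=> u0 aD MD rD.
pose D' := fun t w => - D t w.
have aD' : adapted_L2 u D'.
  move=> t tu; have [mD D2] := aD _ tu; split; last exact: L2N.
  exact: (@measurable_funN _ (g_sigma_algebraType (F t))).
have MD' : martingale u D'.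
  move=> s t s0 st tu Y mY Y2; rewrite -[RHS]oppr0 -(MD _ _ s0 st tu _ mY Y2).
  rewrite -ipNr//; first by apply: eq_ip => w; rewrite /D'; ring.
  by apply: L2B; apply: (aD _ _).2; rewrite ?s0 ?tu ?(le_trans st) ?(le_trans s0).
pose Z N w := running_max D (dyadic u N) (2 ^ N) w ^+ 2 +
              running_max D' (dyadic u N) (2 ^ N) w ^+ 2.
have qb N k : (k <= 2 ^ N)%N -> 0 <= dyadic u N k <= u by exact: dyadic_in.
have qm N k : (k < 2 ^ N)%N -> dyadic u N k <= dyadic u N k.+1.
  by move=> _; exact: dyadic_le.
have mono E N w : running_max E (dyadic u N) (2 ^ N) w <=
                  running_max E (dyadic u N.+1) (2 ^ N.+1) w.
  apply: running_max_le => [|k kN]; first exact: running_max_ge0.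
  by rewrite dyadic_double running_max_ub// expnS leq_mul2l kN orbT.
have Zmono w : {homo (fun N => (Z N w)%:E) : N M / (N <= M)%N >-> (N <= M)%E}.
  apply/nondecreasing_seqP => N; rewrite lee_fin lerD// ler_sqr ?nnegrE//;
  exact: running_max_ge0.
have mZ N : measurable_fun setT (fun w => (Z N w)%:E).
  apply/measurable_EFinP; apply: measurable_funD; apply: measurable_funX.
    exact: (running_max_adapted aD (qb N) (qm N)).2.1.
  exact: (running_max_adapted aD' (qb N) (qm N)).2.1.
have Z0 N w : (0 <= (Z N w)%:E)%E by rewrite lee_fin addr_ge0// sqr_ge0.
have cZ w : cvgn (fun N => (Z N w)%:E).
  exact: ereal_nondecreasing_is_cvgn (Zmono w).
exists (fun w => limn (fun N => (Z N w)%:E)); split.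
- by apply: emeasurable_fun_cvg mZ _ => w _; exact: cZ.
- move=> w t /andP[t0 tu].
  have Hd N k : (k <= 2 ^ N)%N ->
      ((D (dyadic u N k) w ^+ 2)%:E <= limn (fun N => (Z N w)%:E))%E.
    move=> kN; apply: (@le_trans _ _ (Z N w)%:E); last first.
      by apply: lime_ge => //; exists N => // M /= NM; exact: Zmono.
    rewrite lee_fin /Z.
    have := @running_max_ub D (dyadic u N) _ _ w kN.
    have := @running_max_ub D' (dyadic u N) _ _ w kN.
    have := running_max_ge0 D (dyadic u N) (2 ^ N) w.
    have := running_max_ge0 D' (dyadic u N) (2 ^ N) w.
    rewrite {2}/D'; move: (D _ w) (running_max _ _ _ _) (running_max _ _ _ _).
    move=> x y z; case: (lerP 0 x) => x0 z0 y0 H1 H2; nra.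
  (* The end point u lies on every grid; right-continuity, assumed only before u, handles the other
     times. *)
  have [->|tu'] := eqVneq t u.
    by rewrite -(dyadic_end u 0); exact: Hd.
  have {}tu : t < u by rewrite lt_neqAle tu'.
  (* If D_t^2 exceeded the limit, so would D^2 on a right neighbourhood of t, which contains a
     dyadic point. *)
  rewrite leNgt; apply/negP => H.
  move: H (Hd); set l := limn _; case: l => [l| |] H Hl //.
  + rewrite lte_fin in H.
    have cD : (D s w) ^+ 2 @[s --> t^'+] --> D t w ^+ 2.
      rewrite expr2; under eq_fun do rewrite expr2.
      by apply: cvgM; apply: rD; rewrite t0.
    have [e e0 He] := at_right_near (cvgr_gt _ cD _ H).
    have [||N [k [kN tk ke]]] := @dyadic_dense u t (Num.min u (t + e)) t0.
    + by rewrite lt_min tu ltrDl.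
    + by rewrite ge_min lexx.
    have := Hl N k kN; rewrite lee_fin leNgt => /negP; apply.
    apply: He => //.
    by move: ke; rewrite lt_min => /andP[].
  + by have := Hl 0%N 0%N isT; rewrite leeNy_eq.
- rewrite monotone_convergence//; apply: lime_le.
    apply: ereal_nondecreasing_is_cvgn => N M NM.
    by apply: ge0_le_integral => // w _; exact: Zmono.
  apply: nearW => N; rewrite /Z; under eq_integral do rewrite EFinD.
  rewrite ge0_integralD//=; last 4 first.
  + by move=> w _; rewrite lee_fin sqr_ge0.
  + by apply: measurable_sqE; exact: (running_max_adapted aD (qb N) (qm N)).2.1.
  + by move=> w _; rewrite lee_fin sqr_ge0.
  + by apply: measurable_sqE; exact: (running_max_adapted aD' (qb N) (qm N)).2.1.
  rewrite (_ : 8 = 4 + 4)%R; last by ring.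
  rewrite EFinD ge0_muleDl ?lee_fin//.
  have := sqnorm_running_max aD MD (qb N) (qm N).
  have := sqnorm_running_max aD' MD' (qb N) (qm N).
  by rewrite dyadic_end sqnormN => H1 H2; apply: leeD.
Qed.

End maximal_inequality.

(** * Products of measures *)

Lemma Rintegral_tensor {d1 d2 : measure_display} {T1 : measurableType d1}
    {T2 : measurableType d2} {R : realType}
    (m1 : {sigma_finite_measure set T1 -> \bar R})
    (m2 : {sigma_finite_measure set T2 -> \bar R}) (g : T1 -> R) (h : T2 -> R) :
  m1.-integrable setT (EFin \o g) -> m2.-integrable setT (EFin \o h) ->
  (m1 \x m2)%E.-integrable setT (EFin \o (fun p => g p.1 * h p.2)) /\
  \int[(m1 \x m2)%E]_p (g p.1 * h p.2) = \int[m1]_x g x * \int[m2]_y h y.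
Proof.
move=> gi hi.
have mgh : measurable_fun setT (EFin \o (fun p => g p.1 * h p.2)).
  apply/measurable_EFinP; apply: measurable_funM.
    by apply: measurableT_comp => //; exact/measurable_EFinP/(measurable_int m1).
  by apply: measurableT_comp => //; exact/measurable_EFinP/(measurable_int m2).
have ghi : (m1 \x m2)%E.-integrable setT (EFin \o (fun p => g p.1 * h p.2)).
  apply/(integrable12ltyP _ _ mgh).
  under eq_integral => x _.
    under eq_integral do rewrite /= normrM EFinM.
    rewrite integralZl//; last exact: integrable_norm hi.
    over.
  rewrite ge0_integralZr//=; last 2 first.
  + apply/measurable_EFinP; apply: measurableT_comp => //.
    exact/measurable_EFinP/(measurable_int m1).
  + by apply: integral_ge0 => x _; rewrite lee_fin.
  rewrite lte_mul_pinfty//.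
  + by apply: integral_ge0 => x _; rewrite lee_fin.
  + exact: integrable_fin_num (integrable_norm gi).
  + by have /integrableP[_] := hi.
split => //; rewrite /Rintegral -integral12_prod_meas1// /fubini_F.
rewrite [in LHS](eq_integral (fun x => (g x)%:E * \int[m2]_y (h y)%:E)%E); last first.
  by move=> x _ /=; rewrite -integralZl//; apply: eq_integral => y _; rewrite EFinM.
have /fineK <- : (\int[m2]_y (h y)%:E)%E \is a fin_num by exact: integrable_fin_num.
by rewrite integralZr// fineM// integrable_fin_num.
Qed.

Section product_of_finite_and_sigma_finite.
Context {d1 d2 : measure_display} {T1 : measurableType d1}
  {T2 : measurableType d2} {R : realType}.
Variables (m1 : {finite_measure set T1 -> \bar R})
  (m2 : {sigma_finite_measure set T2 -> \bar R}).

(** A named copy that carries a sigma-finite structure, so that P x Lebesgue can in turn be the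
    first factor of a product with the measure of the marks. *)
Definition product_measure : set (T1 * T2) -> \bar R := (m1 \x m2)%E.

HB.instance Definition _ := Measure.copy product_measure (m1 \x m2)%E.

Lemma product_measure_sigma_finite : sigma_finite setT product_measure.
Proof.
have [G GT G_fin] := sigma_finiteT m2.
exists (fun n => setT `*` G n).
  by rewrite -setX_bigcupr -GT setXTT.
move=> n; have [mG Goo] := G_fin n; split; first exact: measurableX.
rewrite /product_measure product_measure1E// lte_mul_pinfty//.
exact: fin_num_measure.
Qed.

HB.instance Definition _ := Measure_isSigmaFinite.Build _ _ _ product_measure
  product_measure_sigma_finite.

End product_of_finite_and_sigma_finite.

Lemma indic_oc {R : realType} (s t x : R) :
  \1_(`]s, t]) x = (s < x <= t)%R%:R :> R.
Proof.
rewrite indicE; congr (_ %:R); congr nat_of_bool.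
by apply/idP/idP; rewrite inE /= in_itv.
Qed.

(* What Brownian motion and the compensated Poisson measure have in common: M A t is the
   noise up to time t carried by the marks in A, nu the intensity of the marks. A Brownian
   motion is the case of one atom, nu = \d_1, with setT as only cell. *)
Record noise {d : measure_display} {O : measurableType d} {R : realType}
    (P : {measure set O -> \bar R}) (T : R) (F : R -> set (set O))
    (nu : set R -> \bar R) (cell : set R -> Prop) (M : set R -> R -> O -> R)
    : Prop := Noise {
  noise_adapted : forall A t, cell A -> 0 <= t <= T ->
    mfun F t (M A t) /\ L2 P (M A t) ;
  noise_martingale : forall A s t, cell A -> 0 <= s -> s <= t -> t <= T ->
    forall Y, mfun F s Y -> L2 P Y -> ip P Y (fun w => M A t w - M A s w) = 0 ;
  noise_isometry : forall A A' s t, cell A -> cell A' ->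
    0 <= s -> s <= t -> t <= T -> forall Y B, mfun F s Y ->
    (forall w, `|Y w| <= B) ->
    ip P (fun w => Y w * (M A t w - M A s w)) (fun w => M A' t w - M A' s w) =
    (\int[P]_w Y w) * fine (nu (A `&` A')) * (t - s) }.

(** * Simple integrands as lists of atoms, their isometry and their L^2-closure *)

Section elementary_integrals.
Context {d : measure_display} {O : measurableType d} {R : realType}
  (P : probability O R) (T : R).
Variable F : R -> set (set O).
Hypothesis F_mono : forall s t, s <= t -> F s `<=` F t.
Hypothesis F_meas : forall t, F t `<=` measurable.
Variable nu : {finite_measure set (measurableTypeR R) -> \bar R}.
Variable cell : set R -> Prop.
Hypothesis cell_meas : forall A, cell A -> measurable A.
Variable M : set R -> R -> O -> R.
Hypothesis M_noise : noise P T F nu cell M.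

Lemma mfunM s (Y Z : O -> R) : mfun F s Y -> mfun F s Z ->
  mfun F s (fun w => Y w * Z w).
Proof. exact: (@measurable_funM _ (g_sigma_algebraType (F s))). Qed.

Lemma mfunD s (Y Z : O -> R) : mfun F s Y -> mfun F s Z ->
  mfun F s (fun w => Y w + Z w).
Proof. exact: (@measurable_funD _ (g_sigma_algebraType (F s))). Qed.

Lemma mfunB s (Y Z : O -> R) : mfun F s Y -> mfun F s Z ->
  mfun F s (fun w => Y w - Z w).
Proof. exact: (@measurable_funB _ (g_sigma_algebraType (F s))). Qed.

Lemma mfun_cst s (c : R) : mfun F s (fun=> c).
Proof. exact: (@measurable_cst _ _ (g_sigma_algebraType (F s))). Qed.

(** One summand of a simple integrand, with its own time interval and set of marks. In a list of
    atoms these may overlap, so integrands are added by concatenation, without a common refinement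
    of two grids. *)
Record atom := Atom {
  atom_start : R ; atom_end : R ; atom_cell : set R ; atom_val : O -> R ;
  atom_start_ge0 : 0 <= atom_start ; atom_le : atom_start <= atom_end ;
  atom_end_le : atom_end <= T ; atom_cellP : cell atom_cell ;
  atom_mfun : mfun F atom_start atom_val ;
  atom_bounded : exists B : R, forall w, `|atom_val w| <= B }.
Implicit Types a : atom.

Definition atom_fun a (p : O * R * R) : R :=
  atom_val a p.1.1 * \1_(`]atom_start a, atom_end a]) p.1.2 *
  \1_(atom_cell a) p.2.

Definition atom_int a (r : R) (w : O) : R := atom_val a w *
  (M (atom_cell a) (Num.min (atom_end a) r) w -
   M (atom_cell a) (Num.min (atom_start a) r) w).

Definition atom_total a (w : O) : R := atom_val a w *
  (M (atom_cell a) (atom_end a) w - M (atom_cell a) (atom_start a) w).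

Let Q := (product_measure P (@lebesgue_measure R) \x nu)%E.

Lemma atom_measurable a : measurable_fun setT (atom_val a).
Proof. exact: mfun_measurable (@atom_mfun a). Qed.

Lemma atom_mulL2 a Z : L2 P Z -> L2 P (fun w => atom_val a w * Z w).
Proof.
have [B aB] := atom_bounded a; apply: (L2_bounded_mul _ aB).
exact: atom_measurable.
Qed.

Lemma noise_incL2 A s t : cell A -> 0 <= s <= T -> 0 <= t <= T ->
  L2 P (fun w => M A t w - M A s w).
Proof.
by move=> cA sT tT; apply: L2B; exact: (noise_adapted M_noise cA _).2.
Qed.

Lemma noise_inc_mfun A s t u : cell A -> 0 <= s <= T -> 0 <= t <= T ->
  s <= u -> t <= u -> mfun F u (fun w => M A t w - M A s w).
Proof.
move=> cA sT tT su tu; apply: mfunB.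
  exact: (mfun_mono F_mono tu (noise_adapted M_noise cA tT).1).
exact: (mfun_mono F_mono su (noise_adapted M_noise cA sT).1).
Qed.

(** The bounded factor [c] is absorbed into the test variable, to which the martingale property of
    the noise applies. *)
Lemma ip_noise_inc0 A s t (c Z : O -> R) (B : R) : cell A -> 0 <= s -> s <= t -> t <= T ->
  mfun F s c -> (forall w, `|c w| <= B) -> mfun F s Z -> L2 P Z ->
  ip P Z (fun w => c w * (M A t w - M A s w)) = 0.
Proof.
move=> cA s0 st tT mc cB mZ Z2.
rewrite -(noise_martingale M_noise cA s0 st tT (mfunM mc mZ)); last first.
  by apply: (L2_bounded_mul _ cB) => //; exact: mfun_measurable mc.
by apply: eq_ip => w; ring.
Qed.

(** Cutting both increments at the ends of the common interval ]s', min t t'] leaves one pair of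
    simultaneous increments, evaluated by the isometry of the noise. In every other pair one
    increment starts when all remaining factors are already known, so the product has mean 0. *)
Lemma ip_atom_total a a' : atom_start a <= atom_start a' ->
  ip P (atom_total a) (atom_total a') =
  (\int[P]_w (atom_val a w * atom_val a' w)) *
  fine (nu (atom_cell a `&` atom_cell a')) *
  fine (lebesgue_measure (`]atom_start a, atom_end a] `&`
                          `]atom_start a', atom_end a'] : set R)).
Proof.
case: a a' => s t A c s0 st tT cA mc [B cB] [s' t' A' c' s0' st' tT' cA' mc' [B' cB']].
rewrite /atom_total /= => ss'.
have sT : 0 <= s <= T by rewrite s0 (le_trans st).
have sT' : 0 <= s' <= T by rewrite s0' (le_trans st').
have tT0 : 0 <= t <= T by rewrite tT (le_trans s0).
have tT0' : 0 <= t' <= T by rewrite tT' (le_trans s0').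
have mcT := mfun_measurable F_meas mc; have mcT' := mfun_measurable F_meas mc'.
have cL2 Z : L2 P Z -> L2 P (fun w => c w * Z w) by exact: L2_bounded_mul.
have cL2' Z : L2 P Z -> L2 P (fun w => c' w * Z w) by exact: L2_bounded_mul.
have mcs' : mfun F s' c by exact: mfun_mono mc.
have [ts'|s't] := leP t s'.
  rewrite (@ip_noise_inc0 A' s' t' c' _ B')//; last 2 first.
  - apply: mfunM => //; apply: noise_inc_mfun => //; exact: (le_trans st).
  - by apply: cL2; exact: noise_incL2.
  rewrite (_ : _ `&` `]s', t'] = set0) ?measure0 ?mulr0//.
  apply/seteqP; split => // x /= []; rewrite !in_itv/= => /andP[_ xt] /andP[s'x _].
  by move: (lt_le_trans s'x xt); rewrite ltNge ts'.
have -> : `]s, t] `&` `]s', t'] = `]s', Num.min t t']%classic.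
  apply/seteqP; split => x /=; rewrite !in_itv/= le_min.
    by move=> [/andP[_ ->] /andP[-> ->]].
  by move=> /andP[s'x /andP[-> ->]]; rewrite s'x (le_lt_trans ss').
rewrite lebesgue_measure_itv/= lte_fin.
(* If the interval is empty then t' = s', because s' < t and s' <= t'; both sides are then 0. *)
rewrite (_ : fine _ = Num.min t t' - s'); last first.
  case: ltP => [//|/=]; rewrite ge_min leNgt s't/= => t's'.
  by rewrite min_r ?(le_trans t's') ?ltW//; apply/esym/eqP; rewrite subr_eq0 eq_le t's'.
rewrite (@eq_ip _ _ _ _ _ _ (fun w => c w * (M A s' w - M A s w) +
    c w * (M A t w - M A s' w)) (fun w => c' w * (M A' t' w - M A' s' w))); last first.
  by move=> w; ring.
have L_A u v : 0 <= u <= T -> 0 <= v <= T -> L2 P (fun w => M A v w - M A u w).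
  exact: noise_incL2.
have L_A' u v : 0 <= u <= T -> 0 <= v <= T -> L2 P (fun w => M A' v w - M A' u w).
  exact: noise_incL2.
rewrite ipDl; [|by apply: cL2'; exact: L_A'|by apply: cL2; exact: L_A..].
rewrite (@ip_noise_inc0 A' s' t' c' _ B')//; last 2 first.
- by apply: mfunM => //; exact: noise_inc_mfun.
- by apply: cL2; exact: L_A.
rewrite add0r.
have mcc' : mfun F s' (fun w => c w * c' w) by exact: mfunM.
have ccB w : `|c w * c' w| <= B * B' by rewrite normrM ler_pM.
have [tt'|t't] := leP t t'.
  rewrite (@eq_ip _ _ _ _ _ _ (fun w => c w * (M A t w - M A s' w))
    (fun w => c' w * (M A' t w - M A' s' w) + c' w * (M A' t' w - M A' t w))); last first.
    by move=> w; ring.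
  rewrite ipDr; [|by apply: cL2; exact: L_A|by apply: cL2'; exact: L_A'..].
  rewrite (@ip_noise_inc0 A' t t' c' _ B')//; last 4 first.
  - by case/andP: tT0.
  - exact: mfun_mono (ltW s't) mc'.
  - by apply: mfunM; [exact: mfun_mono mc|apply: noise_inc_mfun => //; exact: ltW].
  - by apply: cL2; exact: L_A.
  rewrite addr0 -(noise_isometry M_noise cA cA' s0' (ltW s't) tT mcc' ccB).
  by apply: eq_ip => w; ring.
rewrite (@eq_ip _ _ _ _ _ _ (fun w => c w * (M A t' w - M A s' w) +
    c w * (M A t w - M A t' w)) (fun w => c' w * (M A' t' w - M A' s' w))); last first.
  by move=> w; ring.
rewrite ipDl; [|by apply: cL2'; exact: L_A'|by apply: cL2; exact: L_A..].
rewrite [X in _ + X]ipC (@ip_noise_inc0 A t' t c _ B)//; last 5 first.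
- by case/andP: tT0'.
- exact: ltW.
- exact: mfun_mono mcs'.
- by apply: mfunM; [exact: mfun_mono mc'|apply: noise_inc_mfun].
- by apply: cL2'; exact: L_A'.
rewrite addr0 -(noise_isometry M_noise cA cA' s0' st' tT' mcc' ccB).
by apply: eq_ip => w; ring.
Qed.

Lemma ip_atom_totalE a a' :
  ip P (atom_total a) (atom_total a') =
  (\int[P]_w (atom_val a w * atom_val a' w)) *
  fine (nu (atom_cell a `&` atom_cell a')) *
  fine (lebesgue_measure (`]atom_start a, atom_end a] `&`
                          `]atom_start a', atom_end a'] : set R)).
Proof.
have [aa'|/ltW a'a] := leP (atom_start a) (atom_start a').
  exact: ip_atom_total.
rewrite ipC ip_atom_total// setIC [X in lebesgue_measure X]setIC.
by under eq_Rintegral do rewrite mulrC.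
Qed.

(** The integrand of an atom is a product of functions of w, s and z, so Fubini yields the same
    three factors as the covariance of the integrals. *)
Lemma ip_atom_fun a a' : L2 Q (atom_fun a) /\
  ip Q (atom_fun a) (atom_fun a') =
  (\int[P]_w (atom_val a w * atom_val a' w)) *
  fine (nu (atom_cell a `&` atom_cell a')) *
  fine (lebesgue_measure (`]atom_start a, atom_end a] `&`
                          `]atom_start a', atom_end a'] : set R)).
Proof.
have mf a1 : measurable_fun setT (atom_fun a1).
  apply: measurable_funM; last first.
    apply: measurableT_comp => //; apply: measurable_indic.
    exact: (cell_meas (@atom_cellP _)).
  apply: measurable_funM.
    by apply: measurableT_comp => //; [exact: atom_measurable|exact: measurableT_comp].
  by apply: measurableT_comp => //; exact: measurableT_comp.
have prodE a1 a2 :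
  Q.-integrable setT (EFin \o (fun p => atom_fun a1 p * atom_fun a2 p)) /\
  ip Q (atom_fun a1) (atom_fun a2) =
  (\int[P]_w (atom_val a1 w * atom_val a2 w)) *
  fine (nu (atom_cell a1 `&` atom_cell a2)) *
  fine (lebesgue_measure (`]atom_start a1, atom_end a1] `&`
                          `]atom_start a2, atom_end a2] : set R)).
  have [B1 aB1] := atom_bounded a1; have [B2 aB2] := atom_bounded a2.
  have i1 : P.-integrable setT
      (EFin \o (fun w => atom_val a1 w * atom_val a2 w)).
    apply: measurable_bounded_integrable => //.
    - exact: (le_lt_trans (probability_le1 P measurableT) (ltry _)).
    - by apply: measurable_funM; exact: atom_measurable.
    - exists (B1 * B2); split; first exact: num_real.
      move=> x xB w _ /=; apply: le_trans (ltW xB).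
      by rewrite normrM ler_pM.
  pose I := `]atom_start a1, atom_end a1] `&` `]atom_start a2, atom_end a2].
  have mI : measurable I by exact: measurableI.
  have i2 : (@lebesgue_measure R).-integrable setT (EFin \o (\1_I : R -> R)).
    apply: le_integrable (integrable_indic_itv (atom_start a1) (atom_end a1) false false) => //.
      exact/measurable_EFinP/measurable_indic.
    move=> x _; rewrite lee_fin /= !ger0_norm// /I indicI/=.
    by rewrite ler_piMr// indicE lern1 leq_b1.
  pose A := atom_cell a1 `&` atom_cell a2.
  have mA : measurable A by apply: measurableI; exact: (cell_meas (@atom_cellP _)).
  have i3 : nu.-integrable setT (EFin \o (\1_A : R -> R)).
    exact: integrable_indic.
  have [j1 E1] := Rintegral_tensor i1 i2.
  have [j2 E2] := @Rintegral_tensor _ _ _ _ _ (product_measure P lebesgue_measure) nu _ _ j1 i3.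
  have eqf p : atom_fun a1 p * atom_fun a2 p =
      atom_val a1 p.1.1 * atom_val a2 p.1.1 * \1_I p.1.2 * \1_A p.2.
    by rewrite /atom_fun /I /A !indicI /=; ring.
  split.
    apply: eq_integrable j2 => // p _ /=; by rewrite eqf.
  have -> : ip Q (atom_fun a1) (atom_fun a2) = \int[Q]_p
      (atom_val a1 p.1.1 * atom_val a2 p.1.1 * \1_I p.1.2 * \1_A p.2).
    by apply: eq_Rintegral => p _; exact: eqf.
  rewrite E2 E1.
  by rewrite mulrAC /Rintegral !integral_indic// !setIT.
split; last by have [] := prodE a a'.
split; first exact: mf.
have [+ _] := prodE a a; move=> /integrableP[_].
by under eq_integral do rewrite /= -expr2 ger0_norm ?sqr_ge0//.
Qed.

Lemma atom_total_fun a a' :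
  ip P (atom_total a) (atom_total a') = ip Q (atom_fun a) (atom_fun a').
Proof. by rewrite ip_atom_totalE (ip_atom_fun a a').2. Qed.

Lemma atom_totalL2 a : L2 P (atom_total a).
Proof.
apply: atom_mulL2; apply: noise_incL2; first exact: atom_cellP.
  by rewrite atom_start_ge0 (le_trans (atom_le a))// atom_end_le.
by rewrite atom_end_le andbT (le_trans (atom_start_ge0 a))// atom_le.
Qed.

(** Both sides are quadratic forms in the list; they agree because the corresponding bilinear forms
    agree on every pair of atoms. *)
Lemma isometry (L : seq atom) :
  sqnorm P (fun w => \sum_(a <- L) atom_total a w) =
  sqnorm Q (fun p => \sum_(a <- L) atom_fun a p).
Proof.
have f2 a : L2 Q (atom_fun a) by have [] := ip_atom_fun a a.
have t2 := atom_totalL2.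
rewrite !sqnormE; try exact: L2_sum.
rewrite (@ip_sumr _ _ _ P)//; last exact: L2_sum.
rewrite (@ip_sumr _ _ _ Q)//; last exact: L2_sum.
congr (_%:E); apply: eq_bigr => a _; rewrite ipC ip_sumr// ipC ip_sumr//.
by apply: eq_bigr => a' _; exact: atom_total_fun.
Qed.

(** For u <= v the projection onto [u, v]; composing a path with it freezes the path outside
    [u, v]. *)
Definition clamp (u v x : R) := Num.max u (Num.min v x).

Lemma clamp_le u v x y : x <= y -> clamp u v x <= clamp u v y.
Proof.
by move=> xy; rewrite /clamp; case: (leP v x) => ?; case: (leP v y) => ?;
  case: (leP u v) => ?; case: (leP u x) => ?; case: (leP u y) => ?; lra.
Qed.

(** An atom starting after v is moved back to the empty interval at v, where its value need not be
    known yet; the value is therefore replaced by 0. In all other cases the start can only move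
    forward. *)
Definition restrict_atom (u v : R) (u0 : 0 <= u) (uv : u <= v) (vT : v <= T) a : atom.
Proof.
apply: (@Atom (clamp u v (atom_start a)) (clamp u v (atom_end a)) (atom_cell a)
  (fun w => if atom_start a <= v then atom_val a w else 0)).
- by rewrite /clamp le_max u0.
- by apply: clamp_le; exact: atom_le.
- by rewrite /clamp ge_max (le_trans uv)//= (le_trans _ vT)// ge_min lexx.
- exact: atom_cellP.
- have [av|av] := leP (atom_start a) v; last exact: mfun_cst.
  by apply: mfun_mono (@atom_mfun a) => //; rewrite /clamp min_r// le_max lexx orbT.
- have [B aB] := atom_bounded a; exists B => w.
  by case: ifPn => // _; rewrite normr0 (le_trans _ (aB w)).
Defined.

Lemma restrict_atom_fun u v u0 uv vT a p :
  atom_fun (@restrict_atom u v u0 uv vT a) p =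
  atom_fun a p * \1_(`]u, v]) p.1.2.
Proof.
rewrite /atom_fun /= !indic_oc /clamp; have [av|av] := leP (atom_start a) v.
  rewrite (_ : _ && _ = (atom_start a < p.1.2 <= atom_end a) && (u < p.1.2 <= v)).
    by rewrite -mulnb natrM; ring.
  rewrite gt_max le_max le_min; case: (ltP u p.1.2) => up /=; last by rewrite andbF.
  by rewrite -andbA; congr (_ && _); rewrite andbC.
rewrite !mul0r; have [pa|ap] := leP p.1.2 (atom_start a); first by rewrite !(mulr0, mul0r).
by rewrite [p.1.2 <= v]leNgt (lt_trans av ap) andbF mulr0.
Qed.

Lemma restrict_atom_total u v u0 uv vT a w :
  atom_total (@restrict_atom u v u0 uv vT a) w = atom_int a v w - atom_int a u w.
Proof.
rewrite /atom_total /atom_int /= /clamp.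
have := atom_le a; case: (leP (atom_start a) v) => ?;
  case: (leP (atom_end a) v) => ?; case: (leP u (atom_start a)) => ?;
  case: (leP u (atom_end a)) => ?; case: (leP u v) => ? ?;
  try ring; exfalso; lra.
Qed.

Definition list_fun (L : seq atom) (p : O * R * R) : R :=
  \sum_(a <- L) atom_fun a p.

Definition list_int (L : seq atom) (r : R) (w : O) : R :=
  \sum_(a <- L) atom_int a r w.

Lemma list_funL2 L : L2 Q (list_fun L).
Proof. by apply: L2_sum => a; have [] := ip_atom_fun a a. Qed.

Lemma atom_int_adapted a : adapted_L2 P F T (atom_int a).
Proof.
move=> r /andP[r0 rT]; have ca := @atom_cellP a.
have s0 := atom_start_ge0 a; have st := atom_le a; have tT := atom_end_le a.
have [sr|rs] := leP (atom_start a) r; last first.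
  rewrite (_ : atom_int a r = fun=> 0); first by split; [exact: mfun_cst|exact: L20].
  apply/funext => w; rewrite /atom_int !min_r ?subrr ?mulr0// ltW//.
  exact: lt_le_trans st.
have min_in x : 0 <= x -> x <= T -> 0 <= Num.min x r <= T.
  by move=> x0 xT; rewrite le_min x0 r0/= ge_min xT.
split.
  apply: mfunM; first exact: mfun_mono (@atom_mfun a).
  apply: noise_inc_mfun; [exact: ca|apply: min_in|apply: min_in|..] => //.
  - exact: (le_trans st).
  - exact: (le_trans s0).
  - by rewrite ge_min lexx orbT.
  - by rewrite ge_min lexx orbT.
apply: atom_mulL2; apply: noise_incL2; rewrite // min_in//.
  exact: (le_trans st).
exact: (le_trans s0).
Qed.

Lemma list_int_adapted L : adapted_L2 P F T (list_int L).
Proof.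
move=> t tT; elim: L => [|a L [IH1 IH2]].
  rewrite (_ : list_int [::] t = fun=> 0).
    by split; [exact: mfun_cst|exact: L20].
  by apply/funext => w; rewrite /list_int big_nil.
have [H1 H2] := atom_int_adapted a tT.
rewrite (_ : list_int (a :: L) t = fun w => atom_int a t w + list_int L t w).
  by split; [exact: mfunD|exact: L2D].
by apply/funext => w; rewrite /list_int big_cons.
Qed.

Lemma list_int_isometry L u v : 0 <= u -> u <= v -> v <= T ->
  sqnorm P (fun w => list_int L v w - list_int L u w) =
  sqnorm Q (fun p => list_fun L p * \1_(`]u, v]) p.1.2).
Proof.
move=> u0 uv vT; pose L' := [seq restrict_atom u0 uv vT a | a <- L].
transitivity (sqnorm P (fun w => \sum_(a <- L') atom_total a w)).
  apply: eq_integral => w _; rewrite /list_int big_map -sumrB; congr (_ ^+ 2)%:E.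
  by apply: eq_bigr => a _; rewrite restrict_atom_total.
rewrite isometry; apply: eq_integral => p _; rewrite /list_fun big_map mulr_suml.
by congr (_ ^+ 2)%:E; apply: eq_bigr => a _; rewrite restrict_atom_fun.
Qed.

Lemma list_int_martingale L : martingale P F T (list_int L).
Proof.
move=> s t s0 st tT Y mY Y2.
transitivity (ip P Y (fun w => \sum_(a <- L) atom_total (restrict_atom s0 st tT a) w)).
  apply: eq_ip => w; rewrite /list_int -sumrB; congr (_ * _).
  by apply: eq_bigr => a _; rewrite restrict_atom_total.
rewrite ip_sumr//; last by move=> a; exact: atom_totalL2.
apply: big1 => a _; set a' := restrict_atom s0 st tT a.
have [B aB] := atom_bounded a'.
apply: (@ip_noise_inc0 _ _ _ _ _ B) => //.
- exact: atom_cellP.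
- exact: atom_start_ge0.
- exact: atom_le.
- exact: atom_end_le.
- exact: atom_mfun.
- by apply: mfun_mono mY => //; rewrite /a' /= /clamp le_max lexx.
Qed.

(** Convergence is required at each time separately, not uniformly in time. This is stable under the
    gluing of integrals from different cells, and the maximal inequality recovers the supremum
    afterwards. *)
Definition isint (f : O * R * R -> R) (I : R -> O -> R) : Prop :=
  [/\ measurable_fun setT f, forall t, 0 <= t <= T -> mfun F t (I t) &
   exists L : nat -> seq atom,
     sqnorm Q (fun p => f p - list_fun (L j) p) @[j --> \oo] --> 0%E /\
     forall t, 0 <= t <= T ->
       sqnorm P (fun w => I t w - list_int (L j) t w) @[j --> \oo] --> 0%E].

Lemma cvge0_ltpinfty (u : nat -> \bar R) : u j @[j --> \oo] --> 0%E ->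
  exists j, (u j < +oo)%E.
Proof.
move=> /fine_cvgP[[j _ /(_ j (leqnn j)) /= uj] _]; exists j.
by move: uj; rewrite fin_numE => /andP[_]; rewrite ltey.
Qed.

(** Square integrability comes from the convergence: the distance to some simple integral is
    finite. *)
Lemma isint_adapted f I : isint f I -> adapted_L2 P F T I.
Proof.
move=> [mf mI [L [fL IL]]] t tT; split; first exact: mI.
have [j Hj] := cvge0_ltpinfty (IL t tT).
have [_ L2j] := list_int_adapted (L j) tT.
rewrite (_ : I t = fun w => (I t w - list_int (L j) t w) + list_int (L j) t w).
  apply: L2D => //; split => //; apply: measurable_funB; last exact: L2j.1.
  by apply: (mfun_measurable F_meas); exact: mI tT.
by apply/funext => w; rewrite subrK.
Qed.

(** Simple integrals are martingales; the increment of the approximation error tends to 0 in L^2. *)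
Lemma isint_martingale f I : isint f I -> martingale P F T I.
Proof.
move=> iI s t s0 st tT Y mY Y2; have aI := isint_adapted iI.
case: iI => mf mI [L [fL IL]].
have sT : 0 <= s <= T by rewrite s0 (le_trans st).
have tT' : 0 <= t <= T by rewrite tT (le_trans s0).
pose e r j w := I r w - list_int (L j) r w.
have e2 r j : 0 <= r <= T -> L2 P (e r j).
  by move=> rT; apply: L2B; [exact: (aI r rT).2|exact: (list_int_adapted _ rT).2].
apply: (@ip_small_eq _ _ _ P _ Y (fun j w => e t j w - e s j w)
  (fun j w => list_int (L j) t w - list_int (L j) s w)) => //.
- by move=> n; apply: L2B; exact: e2.
- by move=> n; apply: L2B; exact: (list_int_adapted _ _).2.
- by move=> n; exact: list_int_martingale.
- move=> n; rewrite -ipDr//; last 2 first.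
  + by apply: L2B; exact: e2.
  + by apply: L2B; exact: (list_int_adapted _ _).2.
  by apply: eq_ip => w; rewrite /e; ring.
- apply: sqnorm_cvgD => [n|n||]; [exact: (e2 _ _ _).1| |exact: IL|].
    by apply: measurable_funN; exact: (e2 _ _ _).1.
  by under eq_fun do rewrite sqnormN; exact: IL.
Qed.

(** An inequality is enough for the error estimate. The simple approximation is inserted on the side
    of I and again on the side of f, each time with (x + y)^2 <= 2 x^2 + 2 y^2; the two factors 2
    give the 4. *)
Lemma isint_isometry f I u v : isint f I -> 0 <= u -> u <= v -> v <= T ->
  (sqnorm P (fun w => I v w - I u w)%R <=
   4%:E * sqnorm Q (fun p => f p * \1_(`]u, v]) p.1.2)%R)%E.
Proof.
move=> iI u0 uv vT; have aI := isint_adapted iI.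
case: iI => mf mI [L [fL IL]].
have uT : 0 <= u <= T by rewrite u0 (le_trans uv).
have vT' : 0 <= v <= T by rewrite vT (le_trans u0).
pose e r j w := I r w - list_int (L j) r w.
have e2 r j : 0 <= r <= T -> L2 P (e r j).
  by move=> rT; apply: L2B; [exact: (aI r rT).2|exact: (list_int_adapted _ rT).2].
have me r j : 0 <= r <= T -> measurable_fun setT (e r j) by move=> /e2 -/(_ j)[].
have mw : measurable_fun setT (fun p : O * R * R => \1_(`]u, v]) p.1.2 : R).
  by apply: measurableT_comp => //; exact: measurableT_comp.
have mL j : measurable_fun setT (list_fun (L j)) by have [] := list_funL2 (L j).
have mg j : measurable_fun setT (fun p => f p - list_fun (L j) p).
  exact: measurable_funB.
have mfw : measurable_fun setT (fun p => f p * \1_(`]u, v]) p.1.2).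
  exact: measurable_funM.
pose Eu j := (sqnorm P (e v j) + sqnorm P (e u j) +
              sqnorm Q (fun p => f p - list_fun (L j) p)%R)%E.
have E0 : Eu j @[j --> \oo] --> 0%E.
  rewrite -[X in _ --> X](_ : (0 + 0 + 0 = 0)%E); last by rewrite !adde0.
  by apply: cvgeD => //; apply: cvgeD => //; exact: IL.
apply: (@le_of_cvge0 _ _ _ 4 Eu) => // j.
rewrite (_ : (fun w => I v w - I u w) = (fun w => (e v j w - e u j w) +
    (list_int (L j) v w - list_int (L j) u w))); last first.
  by apply/funext => w; rewrite /e; ring.
have m1 : measurable_fun setT (fun w => list_int (L j) v w - list_int (L j) u w).
  by apply: measurable_funB; exact: (list_int_adapted _ _).2.1.
apply: (le_trans (@sqnormD_le _ _ _ P (fun w => e v j w - e u j w) _ _ m1)).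
  by apply: measurable_funB; exact: me.
rewrite list_int_isometry//.
have H1 : (sqnorm P (fun w => e v j w - e u j w)%R <=
           2%:E * sqnorm P (e v j) + 2%:E * sqnorm P (e u j))%E.
  by rewrite -(sqnormN _ (e u j)); apply: sqnormD_le; [|apply: measurable_funN]; exact: me.
have H2 : (sqnorm Q (fun p => list_fun (L j) p * \1_(`]u, v]) p.1.2)%R <=
    2%:E * sqnorm Q (fun p => f p * \1_(`]u, v]) p.1.2)%R +
    2%:E * sqnorm Q (fun p => f p - list_fun (L j) p)%R)%E.
  rewrite (_ : (fun p => _) = (fun p => f p * \1_(`]u, v]) p.1.2 +
      - ((f p - list_fun (L j) p) * \1_(`]u, v]) p.1.2))); last first.
    by apply/funext => p; ring.
  have mgw0 : measurable_fun setT
      (fun p : O * R * R => (f p - list_fun (L j) p) * \1_(`]u, v]) p.1.2).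
    exact: measurable_funM.
  have mgw : measurable_fun setT
      (fun p : O * R * R => - ((f p - list_fun (L j) p) * \1_(`]u, v]) p.1.2)).
    by apply: measurable_funN; exact: mgw0.
  apply: (le_trans (@sqnormD_le _ _ _ Q (fun p => f p * \1_(`]u, v]) p.1.2) _ mfw mgw)).
  rewrite leeD2l// lee_wpmul2l// sqnormN -[leRHS]mul1e.
  apply: (@sqnorm_le _ _ _ Q _ _ 1 mgw0 (mg j)) => // p; rewrite mul1r exprMn ler_piMr ?sqr_ge0// indic_oc.
apply: (le_trans (leeD (lee_wpmul2l _ H1) (lee_wpmul2l _ H2))) => //.
have := sqnorm_ge0 P (e v j); have := sqnorm_ge0 P (e u j).
have := sqnorm_ge0 Q (fun p => f p - list_fun (L j) p)%R.
have := sqnorm_ge0 Q (fun p => f p * \1_(`]u, v]) p.1.2)%R.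
rewrite /Eu; move: (sqnorm _ _) (sqnorm _ _) (sqnorm _ _) (sqnorm _ _).
move=> [x| |] [y| |] [z| |] [t| |] //; rewrite ?lee_fin => x0 y0 z0 t0 *;
  rewrite ?(gt0_muley, mulry, gtr0_sg, mul1e, addey, addye)//= ?leey// -?EFinM -?EFinD ?lee_fin; lra.
Qed.

Definition neg_atom a : atom.
Proof.
apply: (@Atom (atom_start a) (atom_end a) (atom_cell a) (fun w => - atom_val a w)).
- exact: atom_start_ge0.
- exact: atom_le.
- exact: atom_end_le.
- exact: atom_cellP.
- exact: (@measurable_funN _ (g_sigma_algebraType (F (atom_start a))) _ _ _ (@atom_mfun a)).
- by have [B aB] := atom_bounded a; exists B => w; rewrite normrN.
Defined.

Lemma isintD f g I J : isint f I -> isint g J ->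
  isint (fun p => f p + g p) (fun t w => I t w + J t w).
Proof.
move=> iI iJ; have aI := isint_adapted iI; have aJ := isint_adapted iJ.
move: iI iJ => [mf mI [L [fL IL]]] [mg mJ [L' [gL' JL']]].
split; first exact: measurable_funD.
  by move=> t tT; apply: mfunD; [exact: mI|exact: mJ].
exists (fun j => L j ++ L' j); split.
  have -> : (fun j => sqnorm Q (fun p => f p + g p - list_fun (L j ++ L' j) p)) =
     (fun j => sqnorm Q (fun p => (f p - list_fun (L j) p) + (g p - list_fun (L' j) p))).
    apply/funext => j; apply: eq_integral => p _; rewrite /list_fun big_cat/=.
    by congr (_ ^+ 2)%:E; ring.
  by apply: sqnorm_cvgD => // n; apply: measurable_funB => //; exact: (list_funL2 _).1.
move=> t tT.
have -> : (fun j => sqnorm P (fun w => I t w + J t w - list_int (L j ++ L' j) t w)) =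
    (fun j => sqnorm P (fun w => (I t w - list_int (L j) t w) + (J t w - list_int (L' j) t w))).
  apply/funext => j; apply: eq_integral => p _; rewrite /list_int big_cat/=.
  by congr (_ ^+ 2)%:E; ring.
apply: sqnorm_cvgD => [n|n||]; [| |exact: IL|exact: JL'].
  by apply: measurable_funB; [exact: (aI _ tT).2.1|exact: (list_int_adapted _ tT).2.1].
by apply: measurable_funB; [exact: (aJ _ tT).2.1|exact: (list_int_adapted _ tT).2.1].
Qed.

Lemma list_fun_neg L p : list_fun [seq neg_atom a | a <- L] p = - list_fun L p.
Proof.
rewrite /list_fun big_map -sumrN; apply: eq_bigr => a _.
by rewrite /atom_fun /=; ring.
Qed.

Lemma list_int_neg L t w : list_int [seq neg_atom a | a <- L] t w = - list_int L t w.
Proof.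
rewrite /list_int big_map -sumrN; apply: eq_bigr => a _.
by rewrite /atom_int /=; ring.
Qed.

Lemma isintN f I : isint f I -> isint (fun p => - f p) (fun t w => - I t w).
Proof.
move=> [mf mI [L [fL IL]]]; split; first exact: measurable_funN.
  by move=> t tT; apply: (@measurable_funN _ (g_sigma_algebraType (F t))); exact: mI.
exists (fun j => [seq neg_atom a | a <- L j]); split.
  suff -> : (fun j => sqnorm Q (fun p => - f p - list_fun [seq neg_atom a | a <- L j] p)) =
    (fun j => sqnorm Q (fun p => f p - list_fun (L j) p)) by [].
  apply/funext => j; rewrite -sqnormN; apply: eq_integral => p _.
  by rewrite list_fun_neg; congr (_ ^+ 2)%:E; ring.
move=> t tT.
suff -> : (fun j => sqnorm P (fun w => - I t w - list_int [seq neg_atom a | a <- L j] t w)) =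
  (fun j => sqnorm P (fun w => I t w - list_int (L j) t w)) by exact: IL.
apply/funext => j; rewrite -sqnormN; apply: eq_integral => p _.
by rewrite list_int_neg; congr (_ ^+ 2)%:E; ring.
Qed.

Lemma isint0 : isint (fun=> 0) (fun _ _ => 0).
Proof.
split; [exact: measurable_cst|by move=> t tT; exact: mfun_cst|].
exists (fun=> [::]); split => [|t tT].
  rewrite (_ : (fun _ => _) = cst 0%E); first exact: cvg_cst.
  apply/funext => j; rewrite -[RHS](integral0 Q setT); apply: eq_integral => p _.
  by rewrite /list_fun big_nil subr0 expr0n.
rewrite (_ : (fun _ => _) = cst 0%E); first exact: cvg_cst.
apply/funext => j; rewrite -[RHS](integral0 P setT); apply: eq_integral => p _.
by rewrite /list_int big_nil subr0 expr0n.
Qed.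

Lemma isint_sum n (f : nat -> O * R * R -> R) (I : nat -> R -> O -> R) :
  (forall i, (i < n)%N -> isint (f i) (I i)) ->
  isint (fun p => \sum_(i < n) f i p) (fun t w => \sum_(i < n) I i t w).
Proof.
elim: n => [|n IH] H.
  rewrite (_ : (fun _ => _) = fun=> 0); last by apply/funext => p; rewrite big_ord0.
  rewrite [X in isint _ X](_ : _ = fun _ _ => 0); first exact: isint0.
  by apply/funext => t; apply/funext => w; rewrite big_ord0.
rewrite (_ : (fun _ => _) = fun p => \sum_(i < n) f i p + f n p); last first.
  by apply/funext => p; rewrite big_ord_recr.
rewrite [X in isint _ X](_ : _ = fun t w => \sum_(i < n) I i t w + I n t w).
  by apply: isintD; [apply: IH => i ni; apply: H; exact: ltnW|exact: H].
by apply/funext => t; apply/funext => w; rewrite big_ord_recr.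
Qed.

End elementary_integrals.

(** [harmonic n] is 1 / (n + 1), equal to 1 at n = 0; the factor 1/2 keeps even the first term
    strictly below t. *)
Lemma between_seq {R : realType} (s t : R) : s < t ->
  (forall n, s < s + (t - s) / 2 * harmonic n) /\
  (forall n, s + (t - s) / 2 * harmonic n < t).
Proof.
move=> st; have p : 0 < (t - s) / 2 by rewrite divr_gt0// subr_gt0.
split=> n; first by rewrite ltrDl mulr_gt0// harmonic_gt0.
have : (t - s) / 2 * harmonic n <= (t - s) / 2.
  by apply: ler_piMr; [exact: ltW|rewrite /= invf_le1 ?ltr0n ?ler1n].
by move: p; lra.
Qed.

(** * From independent increments to the martingale property and the isometry *)

Section independence.
Context {d : measure_display} {O : measurableType d} {R : realType}
  (P : probability O R).

(** A |-> P(A and V) and A |-> P(V) P(A) are finite measures that agree on a pi-system containing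
    the whole space. *)
Lemma indep_setI_closed (G : set (set O)) (V : set O) : setI_closed G ->
  G setT -> G `<=` measurable -> measurable V ->
  (forall A, G A -> P (A `&` V) = (P A * P V)%E) ->
  forall A, <<s G >> A -> P (A `&` V) = (P A * P V)%E.
Proof.
move=> GI GT Gm mV H A sGA.
pose r : {nonneg R} := NngNum (fine_ge0 (measure_ge0 P V)).
have rE : (r%:num%:E = P V)%E by rewrite fineK// fin_num_measure.
have -> : P (A `&` V) = mrestr P mV A by [].
rewrite muleC -rE -[RHS]/(mscale r P A).
apply: (g_sigma_algebra_measure_unique G Gm (fun=> setT)) => //.
- by apply/seteqP; split => // x _; exists 0%N.
- by move=> B GB; rewrite -[RHS]/(r%:num%:E * P B)%E rE muleC -H.
- move=> _; rewrite -[ltLHS]/(P (setT `&` V)) setTI.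
  exact: (le_lt_trans (probability_le1 P mV) (ltry _)).
Qed.

(** Independence says that the joint law of (Y, Z) is the product of the two laws; Fubini for the
    function y z does the rest. *)
Lemma expectation_mul_indep (Y Z : O -> R) :
  P.-integrable setT (EFin \o Y) -> P.-integrable setT (EFin \o Z) ->
  P.-integrable setT (EFin \o (fun w => Y w * Z w)) ->
  (forall A B, measurable A -> measurable B ->
    P (Y @^-1` A `&` Z @^-1` B) = (P (Y @^-1` A) * P (Z @^-1` B))%E) ->
  \int[P]_w (Y w * Z w) = \int[P]_w Y w * \int[P]_w Z w.
Proof.
move=> Yi Zi YZi H.
have mY : measurable_fun setT Y by exact/measurable_EFinP/(measurable_int P).
have mZ : measurable_fun setT Z by exact/measurable_EFinP/(measurable_int P).
have mYZ : measurable_fun setT (fun w => (Y w, Z w)) by exact: measurable_fun_pair.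
pose Y' : {mfun O >-> R} :=
  MeasurableFun.Pack (MeasurableFun.Class (isMeasurableFun.Build _ _ _ _ _ mY)).
pose Z' : {mfun O >-> R} :=
  MeasurableFun.Pack (MeasurableFun.Class (isMeasurableFun.Build _ _ _ _ _ mZ)).
pose YZ : {mfun O >-> (R * R)%type} :=
  MeasurableFun.Pack (MeasurableFun.Class (isMeasurableFun.Build _ _ _ _ _ mYZ)).
pose DY := distribution P Y'; pose DZ := distribution P Z'.
have iY : DY.-integrable setT (EFin \o (id : R -> R)).
  by apply: integrable_pushforward => //; exact/measurable_EFinP.
have iZ : DZ.-integrable setT (EFin \o (id : R -> R)).
  by apply: integrable_pushforward => //; exact/measurable_EFinP.
have [_ E] := Rintegral_tensor iY iZ.
have mm : measurable_fun setT (EFin \o (fun p : R * R => p.1 * p.2)).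
  by apply/measurable_EFinP; apply: measurable_funM.
transitivity (\int[(DY \x DZ)%E]_p (p.1 * p.2)).
  rewrite /Rintegral (eq_measure_integral (distribution P YZ)); last first.
    move=> A mA _; apply: product_measure_unique => // A1 A2 mA1 mA2; exact: H.
  by rewrite integral_pushforward.
rewrite E /Rintegral !integral_pushforward//; exact/measurable_EFinP.
Qed.

(** The cylinders over the indices other than [i0] form a pi-system generating the sigma-algebra in
    question. Mutual independence factorises a cylinder intersected with an event at [i0]; taking
    the full set at [i0] identifies the remaining product as the probability of the cylinder. *)
Lemma mutual_independence_group {I : finType} {e} {E : measurableType e}
    (Y : I -> O -> E) (i0 : I) (B : set E) :
  (forall i, measurable_fun setT (Y i)) -> mutually_independent P Y ->
  measurable B -> forall A,
  <<s [set A | exists i C, [/\ i != i0, measurable C & A = Y i @^-1` C]] >> A ->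
  P (A `&` Y i0 @^-1` B) = (P A * P (Y i0 @^-1` B))%E.
Proof.
move=> mY iY mB A sA.
pose cyl (C : I -> set E) := [set w | forall i, i != i0 -> C i (Y i w)].
pose G : set (set O) := [set A | exists2 C, (forall i, measurable (C i)) & A = cyl C].
have mpre i C : measurable C -> measurable (Y i @^-1` C).
  by move=> mC; rewrite -[X in measurable X]setTI; exact: mY.
have cylE C : cyl C = \bigcap_(i in [set i | i != i0]) (Y i @^-1` C i).
  by apply/seteqP; split.
apply: (@indep_setI_closed G) => //.
- move=> _ _ [C mC ->] [C' mC' ->]; exists (fun i => C i `&` C' i).
    by move=> i; exact: measurableI.
  apply/seteqP; split => w /=; first by move=> [H H'] i ii0; split; auto.
  by move=> H; split => i ii0; have [] := H i ii0.
- by exists (fun=> setT) => //; apply/seteqP; split.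
- move=> _ [C mC ->]; rewrite cylE; apply: fin_bigcap_measurable => [|i _]; [exact: finite_finset|exact: mpre].
- exact: mpre.
- move=> _ [C mC ->].
  have prodE (D : set E) : measurable D ->
      P (cyl C `&` Y i0 @^-1` D) = ((\prod_(i | i != i0) P (Y i @^-1` C i)) *
         P (Y i0 @^-1` D))%E.
    move=> mD; pose C' i := if i == i0 then D else C i.
    have := iY C'; rewrite (bigD1 i0)//= /C' eqxx muleC.
    rewrite (eq_bigr (fun i => P (Y i @^-1` C i))); last by move=> i /negbTE ->.
    move=> <-; last by move=> i; case: ifP.
    congr (P _); apply/seteqP; split => w /=.
      by move=> [H1 H2] i; case: ifPn => [/eqP ->//|]; exact: H1.
    move=> H; split; last by have := H i0; rewrite eqxx.
    by move=> i ii0; have := H i; rewrite (negbTE ii0).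
  rewrite prodE//; congr (_ * _)%E.
  by have := prodE setT measurableT; rewrite preimage_setT setIT probability_setT mule1.
- apply: sub_sigma_algebra2 sA => _ [i [C [ii0 mC ->]]].
  exists (fun j => if j == i then C else setT) => [j|]; first by case: ifP.
  apply/seteqP; split => w /=; first by move=> Cw j _; case: ifPn => // /eqP ->.
  by move/(_ i ii0); rewrite eqxx.
Qed.

Variable F : R -> set (set O).
Hypothesis F_mono : forall s t, s <= t -> F s `<=` F t.
Hypothesis F_meas : forall t, F t `<=` measurable.
Variable T : R.

(* G u stands for the history up to time u before right-continuous augmentation. *)
Variable G : R -> set (set O).
Hypothesis F_sub_G : forall s u, s < u -> u <= T -> F s `<=` <<s G u >>.

Variables (m : R -> O -> R) (c : R).
Hypothesis m_ad : adapted_L2 P F T m.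
Hypothesis m_indep : forall u t, 0 <= u -> u < t -> t <= T ->
  forall A (B : set R), <<s G u >> A -> measurable B ->
  P (A `&` [set w | B (m t w - m u w)]) =
  (P A * P [set w | B (m t w - m u w)%R])%E.
Hypothesis m_mean : forall u t, 0 <= u -> u < t -> t <= T ->
  \int[P]_w (m t w - m u w) = 0.
Hypothesis m_var : forall u t, 0 <= u -> u < t -> t <= T ->
  \int[P]_w (m t w - m u w) ^+ 2 = c * (t - u).

Let m_incL2 u t : 0 <= u -> u <= t -> t <= T -> L2 P (fun w => m t w - m u w).
Proof.
by move=> u0 ut tT; apply: L2B; apply: (m_ad _).2; rewrite ?u0 ?tT ?(le_trans ut) ?(le_trans u0).
Qed.

Let cst1_L2 : L2 P (fun=> 1 : R).
Proof.
split; first exact: measurable_cst.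
rewrite /sqnorm expr1n integral_cst// mul1e.
exact: (le_lt_trans (probability_le1 P measurableT) (ltry _)).
Qed.

Lemma L2_integrable (Y : O -> R) : L2 P Y -> P.-integrable setT (EFin \o Y).
Proof.
by move=> Y2; have := integrable_mul Y2 cst1_L2; apply: eq_integrable => // w _ /=; rewrite mulr1.
Qed.

(** For u > s the variable Y is measurable for the history at u, hence independent of m_t - m_u,
    which has mean 0. The remaining increment m_u - m_s has variance c (u - s) and vanishes as u
    decreases to s. *)
Lemma ip_martingale_increment : martingale P F T m.
Proof.
move=> s t s0; rewrite le_eqVlt => /orP[/eqP <- _ Y mY Y2|st tT Y mY Y2].
  rewrite -[RHS](ip0r P Y); apply: eq_ip => w; by rewrite subrr.
have H u : s < u -> u < t -> ip P Y (fun w => m t w - m u w) = 0.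
  move=> su ut; have u0 : 0 <= u by exact: le_trans s0 (ltW su).
  have Z2 := m_incL2 u0 (ltW ut) tT.
  rewrite /ip expectation_mul_indep ?m_mean ?mulr0//.
  - exact: L2_integrable.
  - exact: L2_integrable.
  - exact: integrable_mul.
  move=> A B mA mB; apply: m_indep => //.
  have := mY measurableT A mA; rewrite setTI; apply: smallest_sub.
    exact: smallest_sigma_algebra.
  by apply: F_sub_G => //; exact: le_trans (ltW ut) tT.
pose u (n : nat) := s + (t - s) / 2 * harmonic n.
have [su ut] : (forall n, s < u n) /\ forall n, u n < t by exact: between_seq.
have u0 n : 0 <= u n by exact: le_trans s0 (ltW (su n)).
apply: (@ip_small_eq _ _ _ P _ Y (fun n w => m (u n) w - m s w)
  (fun n w => m t w - m (u n) w)) => //.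
- by move=> n; apply: m_incL2 => //; [exact: ltW|exact: (le_trans (ltW (ut n)))].
- by move=> n; apply: m_incL2 => //; exact: ltW.
- by move=> n; exact: H.
- move=> n; rewrite -ipDr//; last 2 first.
  + by apply: m_incL2 => //; [exact: ltW|exact: (le_trans (ltW (ut n)))].
  + by apply: m_incL2 => //; exact: ltW.
  by apply: eq_ip => w; ring.
have -> : (fun n => sqnorm P (fun w => m (u n) w - m s w)) =
          (fun n => (c * ((t - s) / 2))%:E * (harmonic n)%:E)%E.
  apply/funext => n; rewrite sqnormE; last first.
    by apply: m_incL2 => //; [exact: ltW|exact: (le_trans (ltW (ut n)))].
  rewrite -EFinM; congr (_%:E); rewrite -mulrA (_ : _ / _ * _ = u n - s); last first.
    by rewrite /u; ring.
  rewrite -m_var//; exact: (le_trans (ltW (ut n))).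
rewrite -[X in _ --> X](mule0 (c * ((t - s) / 2))%:E).
by apply: cvgeZl => //; exact: cvge_harmonic.
Qed.

(** Independence again gives the formula only from times u > s on. Splitting the increment at u, the
    mixed terms vanish by the martingale property. *)
Lemma ip_martingale_increment_sqr s t Y B : 0 <= s -> s <= t -> t <= T ->
  mfun F s Y -> (forall w, `|Y w| <= B) ->
  ip P (fun w => Y w * (m t w - m s w)) (fun w => m t w - m s w) =
  (\int[P]_w Y w) * (c * (t - s)).
Proof.
move=> s0; rewrite le_eqVlt => /orP[/eqP <- _ mY YB|st tT mY YB].
  rewrite subrr !mulr0 -[RHS](ip0r P (fun=> 0)).
  by apply: eq_ip => w; rewrite subrr !mulr0.
have mYT := mfun_measurable F_meas mY.
have Y2 : L2 P Y.
  have := L2_bounded_mul mYT YB cst1_L2; by under eq_fun do rewrite mulr1.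
have YL2 Z : L2 P Z -> L2 P (fun w => Y w * Z w) by exact: L2_bounded_mul.
have B0 : 0 <= B by exact: le_trans (YB point).
have H u : s < u -> u < t ->
  ip P (fun w => Y w * (m t w - m u w)) (fun w => m t w - m u w) =
  (\int[P]_w Y w) * (c * (t - u)).
  move=> su ut; have u0 : 0 <= u by exact: le_trans s0 (ltW su).
  have Z2 := m_incL2 u0 (ltW ut) tT.
  rewrite -m_var// -expectation_mul_indep.
  - by apply: eq_Rintegral => w _; rewrite expr2 mulrA.
  - exact: L2_integrable.
  - exact: integrable_sqr.
  - have := integrable_mul (YL2 _ Z2) Z2; apply: eq_integrable => // w _ /=.
    by rewrite expr2 mulrA.
  move=> A B' mA mB'.
  have mB2 : measurable ((fun x : R => x ^+ 2) @^-1` B').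
    by rewrite -[X in measurable X]setTI; exact: (measurable_funX _ (@measurable_id _ _ setT)).
  apply: (m_indep u0 ut tT _ mB2).
  have := mY measurableT A mA; rewrite setTI; apply: smallest_sub.
    exact: smallest_sigma_algebra.
  by apply: F_sub_G => //; exact: le_trans (ltW ut) tT.
pose u (n : nat) := s + (t - s) / 2 * harmonic n.
have [su ut] : (forall n, s < u n) /\ forall n, u n < t by exact: between_seq.
have c0 : 0 <= c.
  rewrite -(pmulr_lge0 _ (_ : 0 < t - s)) ?subr_gt0// -m_var//.
  by apply: Rintegral_ge0 => w _; exact: sqr_ge0.
apply/eqP; rewrite -subr_eq0 -normr_eq0 eq_le normr_ge0 andbT; apply/eqP.
set L := ip P _ _; set EY := \int[P]_w Y w.
(* The discrepancy consists of E(Y (m_u - m_s)^2), at most B c (u - s) in absolute value, and of the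
   missing part E(Y) c (u - s). *)
suff bound n : `|L - EY * (c * (t - s))| <= (B + `|EY|) * c * ((t - s) / 2) * harmonic n.
  apply/eqP; rewrite -lee_fin.
  apply: (@le_of_cvge0 _ _ _ ((B + `|EY|) * c * ((t - s) / 2)) (EFin \o harmonic)).
    exact: cvge_harmonic.
  by move=> n; rewrite adde0 -EFinM lee_fin.
have un0 : 0 <= u n by exact: le_trans s0 (ltW (su n)).
have unT : u n <= T by exact: le_trans (ltW (ut n)) tT.
have L1 : L2 P (fun w => m t w - m (u n) w) by apply: m_incL2 => //; exact: ltW.
have L3 : L2 P (fun w => m (u n) w - m s w) by apply: m_incL2 => //; exact: ltW.
have LE : L = EY * (c * (t - u n)) +
    ip P (fun w => Y w * (m (u n) w - m s w)) (fun w => m (u n) w - m s w).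
  rewrite /L (@eq_ip _ _ _ _ _ _
    (fun w => Y w * (m t w - m (u n) w) + Y w * (m (u n) w - m s w))
    (fun w => (m t w - m (u n) w) + (m (u n) w - m s w))); last by move=> w; ring.
  rewrite ipDl; [|exact: L2D|exact: YL2|exact: YL2].
  rewrite ipDr; [|exact: YL2|exact: L1|exact: L3].
  rewrite [X in _ + X]ipDr; [|exact: YL2|exact: L1|exact: L3].
  rewrite H// -/EY.
  have Z0 : ip P (fun w => Y w * (m (u n) w - m s w)) (fun w => m t w - m (u n) w) = 0.
    apply: ip_martingale_increment => //; [exact: ltW| |exact: YL2].
    apply: mfunM; first exact: mfun_mono (ltW (su n)) mY.
    apply: mfunB; first by apply: (m_ad _).1; rewrite un0 unT.
    by apply: mfun_mono (ltW (su n)) _ => //; apply: (m_ad _).1; rewrite s0 (le_trans (ltW st)).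
  rewrite Z0 add0r (_ : ip P _ (fun w => m (u n) w - m s w) = 0) ?addr0//.
  rewrite -[RHS]Z0; apply: eq_ip => w; ring.
rewrite LE (_ : _ - _ = ip P (fun w => Y w * (m (u n) w - m s w))
    (fun w => m (u n) w - m s w) - EY * c * (u n - s)); last by ring.
have uns : u n - s = (t - s) / 2 * harmonic n by rewrite /u; ring.
rewrite -[leRHS]mulrA -uns mulrDl mulrDl.
apply: le_trans (ler_normB _ _) _; apply: lerD; last first.
  by rewrite !normrM (ger0_norm c0) (@ger0_norm _ (u n - s))// subr_ge0 ltW.
rewrite -mulrA -m_var//.
apply: le_trans (le_normr_Rintegral _ _) _ => //.
  by apply: integrable_mul => //; exact: YL2.
rewrite -RintegralZl//; last exact: integrable_sqr.
apply: le_Rintegral => //.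
- by apply: integrable_norm; apply: integrable_mul => //; exact: YL2.
- by have := integrableZl measurableT B (integrable_sqr L3); apply: eq_integrable => // w _ /=.
move=> w _; rewrite -mulrA -expr2 normrM [X in _ * X]ger0_norm ?sqr_ge0//.
by rewrite ler_wpM2r ?sqr_ge0.
Qed.

End independence.

Import HBNNSimple.

(** * Mean and variance of the centred normal law *)

Section gaussian_moments.
Context {R : realType}.
Variable s : R.
Hypothesis s_gt0 : 0 < s.
Let mu := @lebesgue_measure R.
Let p : R -> R := normal_pdf 0 s.

Let sN0 : s != 0. Proof. by rewrite gt_eqF. Qed.

Let pE x : p x = normal_peak s * expR (- x ^+ 2 / (s ^+ 2 *+ 2)).
Proof. by rewrite /p normal_pdfE// /normal_fun subr0. Qed.

Let p_ge0 x : 0 <= p x. Proof. exact: normal_pdf_ge0. Qed.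

Let p_cont : continuous p. Proof. exact: continuous_normal_pdf. Qed.

Let p_even x : p (- x) = p x. Proof. by rewrite !pE sqrrN. Qed.

Let p_meas : measurable_fun setT p. Proof. exact: measurable_normal_pdf. Qed.

Let p_derive (x : R) : is_derive x 1 p (- (x / s ^+ 2) * p x).
Proof.
have -> : p = (fun x => normal_peak s *: expR (- (s ^+ 2 *+ 2)^-1 *: (x ^+ 2))).
  apply/funext => y; rewrite pE /GRing.scale/=; congr (_ * expR _); by ring.
apply: is_derive_eq.
by rewrite /GRing.scale/=; field.
Qed.

(** The density solves p' = - x p / s^2, so - s^2 p is an antiderivative of x p; the integrand is
    read as x times x p. *)
Let gaussian_by_parts (b : R) : 0 < b ->
  (\int[mu]_(x in `[0%R, b]) (x ^+ 2 * p x)%:E =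
   (- s ^+ 2 * (b * p b))%:E + (s ^+ 2)%:E * \int[mu]_(x in `[0%R, b]) (p x)%:E)%E.
Proof.
move=> b0.
pose G x := - s ^+ 2 * p x.
have dG (x : R) : is_derive x 1 G (x * p x).
  apply: (is_derive_eq (is_deriveZ (- s ^+ 2) (p_derive x))).
  by rewrite /GRing.scale/=; field.
have cG : continuous G.
  by move=> x; apply: cvgM; [exact: cvg_cst|exact: p_cont].
have cp2 : continuous (fun x : R => x * p x).
  by move=> x; apply: cvgM; [exact: cvg_id|exact: p_cont].
transitivity (\int[mu]_(x in `[0%R, b]) (x * (x * p x))%:E)%E.
  by apply: eq_integral => x _; rewrite expr2 mulrA.
rewrite (@integration_by_parts _ id G (cst 1) (fun x => x * p x))//; last 6 first.
- by apply: continuous_subspaceT; exact: cst_continuous.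
- split => //.
  + exact: cvg_at_right_filter.
  + exact: cvg_at_left_filter.
- by move=> x _; rewrite derive1E derive_id.
- exact: continuous_subspaceT.
- split => //.
  + by apply: cvg_at_right_filter; exact: cG.
  + by apply: cvg_at_left_filter; exact: cG.
- by move=> x _; rewrite derive1E derive_val.
rewrite mul0r subr0.
have -> : (\int[mu]_(x in `[0%R, b]) (cst 1 x * G x)%:E =
    (- s ^+ 2)%:E * \int[mu]_(x in `[0%R, b]) (p x)%:E)%E.
  rewrite -integralZl//; last first.
    apply: continuous_compact_integrable; first exact: segment_compact.
    exact: continuous_subspaceT.
  by apply: eq_integral => x _; rewrite /= mul1r EFinM.
by rewrite EFinN mulNe oppeK /G mulrCA.
Qed.

(** The boundary term of the integration by parts, bounded through exp(y) >= y at y = (n + 1)^2 / (2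
    s^2). *)
Let gaussian_tail n : n.+1%:R * p n.+1%:R <= normal_peak s * (s ^+ 2 *+ 2) * harmonic n.
Proof.
rewrite pE /= mulrCA -mulrA ler_pM2l ?normal_peak_gt0//.
set x : R := n.+1%:R; have x0 : 0 < x by rewrite ltr0n.
have c0 : 0 < s ^+ 2 *+ 2 by rewrite pmulrn_lgt0// exprn_gt0.
rewrite mulNr expRN ler_pdivrMr ?expR_gt0// mulrAC -mulrA.
rewrite -ler_pdivrMl//; apply: (@le_trans _ _ (x ^-1 * (x ^+ 2 / (s ^+ 2 *+ 2)))).
  by rewrite le_eqVlt; apply/orP; left; apply/eqP; field; rewrite !gt_eqF.
rewrite mulrC ler_pM2r ?invr_gt0//; apply: le_trans (expR_ge1Dx _); rewrite lerDr//.
Qed.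

(** On the half-line, integration by parts on [0, n + 1] and n -> oo turn the integral of x^2 p into
    s^2 times that of p. Evenness doubles both, and p has total mass 1. *)
Lemma gaussian_second_moment : (\int[mu]_x (x ^+ 2 * p x)%:E = (s ^+ 2)%:E)%E.
Proof.
have cont2 : continuous (fun x : R => x ^+ 2 * p x).
  by move=> x; apply: cvgM; [exact: exprn_continuous|exact: p_cont].
have ge2 x : 0 <= x ^+ 2 * p x by rewrite mulr_ge0// sqr_ge0.
have half2 := ge0_symfun_integralT ge2 cont2.
rewrite {}half2; last by move=> x /=; rewrite sqrrN p_even.
have half := ge0_symfun_integralT p_ge0 p_cont.
have {half} : (1 = 2%:E * \int[mu]_(x in [set x | (0 <= x)%R]) (p x)%:E)%E.
  by rewrite -half ?integral_normal_pdf// => x /=; rewrite p_even.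
rewrite -set_itvcy => H.
suff -> : (\int[mu]_(x in `[0%R, +oo[) (x ^+ 2 * p x)%:E =
    (s ^+ 2)%:E * \int[mu]_(x in `[0%R, +oo[) (p x)%:E)%E by rewrite muleCA -H mule1.
have m2 : measurable_fun setT (fun x : R => x ^+ 2 * p x).
  exact: continuous_measurable_fun.
have L : (fun n => \int[mu]_(x in `[0%R, n.+1%:R]) (x ^+ 2 * p x)%:E)%E @ \oo -->
    (\int[mu]_(x in `[0%R, +oo[) (x ^+ 2 * p x)%:E)%E.
  rewrite (cvg_shiftS (fun n => \int[mu]_(x in `[0%R, n%:R]) (x ^+ 2 * p x)%:E)%E).
  exact: ge0_cvgn_integral.
have L' : (fun n => \int[mu]_(x in `[0%R, n.+1%:R]) (p x)%:E)%E @ \oo -->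
    (\int[mu]_(x in `[0%R, +oo[) (p x)%:E)%E.
  rewrite (cvg_shiftS (fun n => \int[mu]_(x in `[0%R, n%:R]) (p x)%:E)%E).
  exact: ge0_cvgn_integral.
rewrite -(cvg_lim _ L)//; apply/cvg_lim => //.
have -> : (fun n => \int[mu]_(x in `[0%R, n.+1%:R]) (x ^+ 2 * p x)%:E)%E =
    (fun n => (- s ^+ 2 * (n.+1%:R * p n.+1%:R))%:E +
      (s ^+ 2)%:E * \int[mu]_(x in `[0%R, n.+1%:R]) (p x)%:E)%E.
  by apply/funext => n; rewrite gaussian_by_parts ?ltr0n.
rewrite -[X in _ --> X]add0e.
apply: cvgeD => //; last exact: cvgeZl.
rewrite -(mule0 (- s ^+ 2)%:E); under eq_fun do rewrite EFinM.
apply: cvgeZl => //.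
apply: (@squeeze_cvge _ _ _ _ (cst 0%E) _
  (fun n => (normal_peak s * (s ^+ 2 *+ 2))%:E * (harmonic n)%:E)%E).
- by apply: nearW => n; rewrite -EFinM !lee_fin gaussian_tail mulr_ge0.
- exact: cvg_cst.
- rewrite -[X in _ --> X](mule0 (normal_peak s * (s ^+ 2 *+ 2))%:E).
  by apply: cvgeZl => //; exact: cvge_harmonic.
Qed.

(** For indicators this is how [normal_prob] is defined; the general case follows by linearity and
    monotone convergence along simple functions. *)
Lemma ge0_integral_normal (f : R -> R) : measurable_fun setT f ->
  (forall x, 0 <= f x) ->
  (\int[normal_prob 0 s]_x (f x)%:E = \int[mu]_x (f x * p x)%:E)%E.
Proof.
move=> mf f0.
have mfE : measurable_fun setT (EFin \o f) by exact/measurable_EFinP.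
have fE0 x : setT x -> (0 <= (EFin \o f) x)%E by rewrite lee_fin.
pose g := nnsfun_approx measurableT mfE.
have gf x : (g n x)%:E @[n --> \oo] --> (f x)%:E by exact: cvg_nnsfun_approx.
have gmono x : {homo (fun n => g n x) : a b / (a <= b)%N >-> a <= b}.
  by move=> a b ab; exact/lefP/nd_nnsfun_approx.
have mgE n : measurable_fun setT (fun x : R => (g n x)%:E).
  by apply/measurable_EFinP; exact: measurable_funPT.
have -> : (\int[normal_prob 0 s]_x (f x)%:E =
    limn (fun n => \int[normal_prob 0 s]_x (g n x)%:E))%E.
  rewrite -monotone_convergence//.
  - by apply: eq_integral => x _; apply/esym/cvg_lim.
  - by move=> n x _; rewrite lee_fin.
  - by move=> x _ a b ab; rewrite lee_fin gmono.
have mgp (h : R -> R) : measurable_fun setT h -> measurable_fun setT (fun x => (h x * p x)%:E).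
  by move=> mh; apply/measurable_EFinP; exact: measurable_funM.
have mgpE n : measurable_fun setT (fun x : R => (g n x * p x)%:E).
  by apply: mgp; exact: measurable_funPT.
have -> : (\int[mu]_x (f x * p x)%:E =
    limn (fun n => \int[mu]_x (g n x * p x)%:E))%E.
  rewrite -monotone_convergence//.
  - apply: eq_integral => x _; apply/esym/cvg_lim => //.
    rewrite EFinM; under eq_fun do rewrite EFinM.
    exact: cvgeZr.
  - by move=> n x _; rewrite lee_fin mulr_ge0.
  - by move=> x _ a b ab; rewrite lee_fin ler_wpM2r// gmono.
congr (limn _); apply/funext => n.
have indE (A : set R) : measurable A ->
    (\int[normal_prob 0 s]_x (\1_A x)%:E = \int[mu]_x (\1_A x * p x)%:E)%E.
  move=> mA; rewrite integral_indic// setIT.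
  transitivity (\int[mu]_(x in A) (p x)%:E)%E; first by [].
  rewrite integral_mkcond; apply: eq_integral => x _; rewrite /patch indicE.
  by case: ifPn => _; rewrite ?mul1r ?mul0r.
have mi y : measurable (g n @^-1` [set y]) by exact: measurable_funPTI.
have mind y : measurable_fun setT (fun x : R => y * \1_(g n @^-1` [set y]) x).
  by apply: measurable_funM => //; exact: measurable_indic.
have mindE y : measurable_fun setT (fun x : R => (y * \1_(g n @^-1` [set y]) x)%:E).
  exact/measurable_EFinP.
transitivity (\sum_(y \in range (g n))
    \int[normal_prob 0 s]_x (y * \1_(g n @^-1` [set y]) x)%:E)%E.
  rewrite -ge0_integral_fsum//; last by move=> r x _; rewrite nnfun_muleindic_ge0.
  by apply: eq_integral => x _; rewrite fimfunE -fsumEFin.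
transitivity (\sum_(y \in range (g n))
    \int[mu]_x (y * \1_(g n @^-1` [set y]) x * p x)%:E)%E; last first.
  have mindp y : measurable_fun setT (fun x : R => (y * \1_(g n @^-1` [set y]) x * p x)%:E).
    exact: mgp.
  rewrite -ge0_integral_fsum//; last first.
    move=> r x _; rewrite EFinM; apply: mule_ge0; last by rewrite lee_fin.
    by rewrite EFinM nnfun_muleindic_ge0.
  apply: eq_integral => x _; rewrite fimfunE EFinM -fsumEFin// ge0_mule_fsuml//.
  by move=> i; rewrite nnfun_muleindic_ge0.
apply: eq_fsbigr => y; rewrite inE => -[x _ <-].
under eq_integral do rewrite EFinM.
under [RHS]eq_integral do rewrite -mulrA EFinM.
have mone : measurable_fun setT (fun z : R => \1_(g n @^-1` [set g n x]) z : R).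
  exact: measurable_indic.
have moneE : measurable_fun setT (fun z : R => (\1_(g n @^-1` [set g n x]) z : R)%:E).
  exact/measurable_EFinP.
have monep := mgp _ mone.
rewrite ge0_integralZl//; last by rewrite lee_fin.
rewrite ge0_integralZl//; last 2 first.
- by move=> z _; rewrite lee_fin mulr_ge0.
- by rewrite lee_fin.
by rewrite indE.
Qed.

Lemma normal_integral_odd (f : R -> R) : measurable_fun setT f ->
  (forall x, 0 <= f x) ->
  (\int[normal_prob 0 s]_x (f (- x))%:E = \int[normal_prob 0 s]_x (f x)%:E)%E.
Proof.
move=> mf f0.
have mfN : measurable_fun setT (fun x : R => f (- x)) by exact: measurableT_comp.
rewrite !ge0_integral_normal//.
have mN : measurable_fun setT (-%R : measurableTypeR R -> measurableTypeR R).
  exact: oppr_measurable.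
have mfp : measurable_fun setT (fun x : measurableTypeR R => (f x * p x)%:E).
  by apply/measurable_EFinP; exact: measurable_funM.
have fp0 : {in setT, forall x : measurableTypeR R, (0 <= (f x * p x)%:E)%E}.
  by move=> x _; rewrite lee_fin mulr_ge0.
transitivity (\int[mu]_x (f (- x) * p (- x))%:E)%E.
  by apply: eq_integral => x _; rewrite p_even.
rewrite -[LHS](@ge0_integral_pushforward _ _ _ _ R _ mN mu setT _ measurableT mfp).
  by apply: eq_measure_integral => A mA _; exact: lebesgue_measureN.
exact: fp0.
Qed.

End gaussian_moments.

Section centered_gaussian.
Context {d : measure_display} {O : measurableType d} {R : realType}
  (P : probability O R).

(** The second moment comes first because it yields integrability. The law is symmetric, so the
    positive and negative parts of Z have the same integral, and as it is finite the mean is 0. *)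
Lemma gaussian_law_moments (Z : O -> R) (v : R) : 0 < v ->
  measurable_fun setT Z ->
  (forall B : set R, measurable B ->
     P [set w | B (Z w)] = normal_prob 0 (Num.sqrt v) B) ->
  [/\ L2 P Z, \int[P]_w Z w = 0 & \int[P]_w Z w ^+ 2 = v].
Proof.
move=> v0 mZ law; have s0 : 0 < Num.sqrt v by rewrite sqrtr_gt0.
have tr (f : R -> R) : measurable_fun setT f -> (forall x, 0 <= f x) ->
    (\int[P]_w (f (Z w))%:E = \int[normal_prob 0 (Num.sqrt v)]_x (f x)%:E)%E.
  move=> mf f0.
  rewrite -[LHS](@ge0_integral_pushforward _ _ _ (measurableTypeR R) _ Z mZ P setT (EFin \o f))//.
  - by apply: eq_measure_integral => A mA _; exact: law.
  - exact/measurable_EFinP.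
  - by move=> y _; rewrite lee_fin.
have E2 : (\int[P]_w (Z w ^+ 2)%:E = v%:E)%E.
  have m2 : measurable_fun setT (fun x : R => x ^+ 2) by exact: measurable_funX.
  have p2 (x : R) : 0 <= x ^+ 2 by exact: sqr_ge0.
  rewrite (tr _ m2 p2) (@ge0_integral_normal _ _ _ m2 p2).
  by rewrite gaussian_second_moment// sqr_sqrtr// ltW.
have Z2 : L2 P Z by split => //; rewrite /sqnorm E2 ltry.
split => //; last by rewrite /Rintegral E2.
have Zi := L2_integrable Z2.
rewrite /Rintegral integralE.
have -> : (\int[P]_w (fun x => (Z x)%:E)^\- w = \int[P]_w (fun x => (Z x)%:E)^\+ w)%E.
  have mmax : measurable_fun setT (fun x : R => Num.max x 0) by exact: measurable_maxr.
  have max0 (x : R) : 0 <= Num.max x 0 by rewrite le_max lexx orbT.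
  transitivity (\int[normal_prob 0 (Num.sqrt v)]_x (Num.max (- x) 0)%:E)%E.
    have mmaxN : measurable_fun setT (fun x : R => Num.max (- x) 0).
      exact: (measurableT_comp mmax).
    rewrite -(tr _ mmaxN) => [|x]; last exact: max0.
    by apply: eq_integral => w _; rewrite funenegE /= EFin_max.
  rewrite (@normal_integral_odd _ _ s0 _ mmax max0) -(tr _ mmax max0).
  by apply: eq_integral => w _; rewrite funeposE /= EFin_max.
rewrite subee//; exact: integrable_pos_fin_num.
Qed.

End centered_gaussian.

(** * Mean and variance of the Poisson law *)

Section poisson_moments.
Context {d : measure_display} {O : measurableType d} {R : realType}
  (P : probability O R).
Variables (X : O -> \bar R) (r : R).
Hypothesis r0 : 0 <= r.
Hypothesis mX : measurable_fun setT X.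
Hypothesis X_nat : forall w, exists j : nat, X w = j%:R%:E.
Hypothesis X_law : forall j : nat, P [set w | X w = j%:R%:E] =
  (expR (- r) * r ^+ j / j`!%:R)%:E.

Let PT : P setT = 1%E := probability_setT P.

Let p (j : nat) : R := expR (- r) * r ^+ j / j`!%:R.

Let p_ge0 j : 0 <= p j.
Proof. by rewrite divr_ge0// mulr_ge0 ?expR_ge0// exprn_ge0. Qed.

Let p_succ j : j.+1%:R * p j.+1 = r * p j.
Proof.
rewrite /p factS natrM exprS; field; rewrite nat1r !pnatr_eq0 -lt0n fact_gt0.
by [].
Qed.

(** The sample space is partitioned by the value of X. Nonnegativity is asked for at the integers
    only, since x^2 - x, to which this is applied, is negative on ]0, 1[. *)
Let poisson_expectation (g : R -> R) : measurable_fun setT g ->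
  (forall j : nat, 0 <= g j%:R) ->
  (\int[P]_w (g (fine (X w)))%:E = \sum_(j <oo) (g j%:R * p j)%:E)%E.
Proof.
move=> mg g0; pose E j := [set w | X w = j%:R%:E].
have mE j : measurable (E j).
  by rewrite -[X in measurable X]setTI; exact: (mX measurableT (emeasurable_set1 _)).
have ET : setT = \bigcup_j E j.
  by apply/seteqP; split => // w _; have [j Xw] := X_nat w; exists j.
rewrite {1}ET ge0_integral_bigcup//; last 3 first.
- apply: measurable_funTS; apply/measurable_EFinP; apply: measurableT_comp => //.
  exact: measurableT_comp.
- by move=> w _; have [j ->] := X_nat w; exact: g0.
- apply/trivIsetP => i j _ _ ij; apply/seteqP; split => // w [].
  rewrite /E /= => -> [] /eqP; by rewrite eqr_nat (negbTE ij).
apply: eq_eseriesr => j _.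
transitivity (\int[P]_(w in E j) (g j%:R)%:E)%E.
  by apply: eq_integral => w; rewrite inE => ->.
rewrite EFinM -[X in _ = (_ * X)%E]X_law.
exact: (@integral_cst _ _ _ P (E j) (mE j) (g j%:R)%:E).
Qed.

Let sum_p : (\sum_(j <oo) (p j)%:E = 1)%E.
Proof.
have := poisson_expectation (measurable_cst (1 : R)) (fun=> ler01).
have -> : (\int[P]_w (cst 1 (fine (X w)) : R)%:E = 1)%E.
  by transitivity (1 * P setT)%E; [exact: (@integral_cst _ _ _ P setT measurableT 1%E)|rewrite PT mule1].
by move=> ->; apply: eq_eseriesr => j _; rewrite mul1r.
Qed.

Let series_shift (g : nat -> R) : (forall j, 0 <= g j) -> g 0%N = 0 ->
  (\sum_(j <oo) (g j)%:E = \sum_(j <oo) (g j.+1)%:E)%E.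
Proof.
move=> g0 g00; rewrite nneseries_recl//; last by move=> k _; rewrite lee_fin.
rewrite g00 add0e -(@nneseries_addn _ (fun j => (g j)%:E) 1)//.
by apply: eq_eseriesr => j _; rewrite addn1.
Qed.

(** The recursion (j + 1) p_{j+1} = r p_j turns the series of j p_j into r times the total mass
    after one shift, and that of j (j - 1) p_j into r^2 after two. *)
Lemma poisson_law_moments : [/\ L2 P (fun w => fine (X w) - r),
  \int[P]_w (fine (X w) - r) = 0 & \int[P]_w (fine (X w) - r) ^+ 2 = r].
Proof.
have E1 : (\int[P]_w (fine (X w))%:E = r%:E)%E.
  rewrite (poisson_expectation (g := id))// series_shift//; last 2 first.
  - by move=> j; rewrite mulr_ge0.
  - by rewrite mul0r.
  rewrite (eq_eseriesr (g := fun j => (r%:E * (p j)%:E)%E)); last first.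
    by move=> j _; rewrite p_succ EFinM.
  by rewrite nneseriesZl ?sum_p ?mule1// => j _; rewrite lee_fin.
have mfX : measurable_fun setT (fun w => fine (X w)) by exact: measurableT_comp.
have X0 w : 0 <= fine (X w) by have [j ->] := X_nat w.
(* The second factorial moment; its first two terms vanish, which permits two shifts of the
   series. *)
have E2 : (\int[P]_w (fine (X w) ^+ 2 - fine (X w))%:E = (r ^+ 2)%:E)%E.
  have mg : measurable_fun setT (fun x : R => x ^+ 2 - x).
    by apply: measurable_funB => //; exact: measurable_funX.
  have g0 (j : nat) : 0 <= j%:R ^+ 2 - j%:R :> R.
    by rewrite subr_ge0 -natrX ler_nat; case: j => // j; rewrite expnS leq_pmulr// expn_gt0.
  rewrite (poisson_expectation mg g0) series_shift//; last 2 first.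
  - by move=> j; rewrite mulr_ge0.
  - by rewrite expr0n/= subr0 mul0r.
  rewrite series_shift//; last 2 first.
  - by move=> j; rewrite mulr_ge0.
  - by rewrite expr1n subrr mul0r.
  rewrite (eq_eseriesr (g := fun j => ((r ^+ 2)%:E * (p j)%:E)%E)); last first.
    move=> j _; rewrite -EFinM; congr EFin.
    rewrite (_ : _ * _ = j.+1%:R * (j.+2%:R * p j.+2)); last first.
      by rewrite -[j.+2%:R]natr1; ring.
    by rewrite p_succ mulrCA p_succ; ring.
  by rewrite nneseriesZl ?sum_p ?mule1// => j _; rewrite lee_fin.
have S2 : (\int[P]_w (fine (X w) ^+ 2)%:E = (r ^+ 2 + r)%:E)%E.
  rewrite EFinD -E1 -E2 -ge0_integralD//.
  - by apply: eq_integral => w _; rewrite -EFinD subrK.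
  - move=> w _; have [j ->] := X_nat w; rewrite lee_fin /= subr_ge0 -natrX ler_nat.
    by case: j => // j; rewrite expnS leq_pmulr// expn_gt0.
  - by apply/measurable_EFinP; apply: measurable_funB => //; exact: measurable_funX.
  - by move=> w _; rewrite lee_fin.
  - exact/measurable_EFinP.
have XL2 : L2 P (fun w => fine (X w)) by split => //; rewrite /sqnorm S2 ltry.
have cL2 : L2 P (fun=> r).
  split; first exact: measurable_cst.
  rewrite /sqnorm integral_cst// lte_mul_pinfty//; first by rewrite lee_fin sqr_ge0.
  exact: (le_lt_trans (probability_le1 P measurableT) (ltry _)).
have ZL2 := L2B XL2 cL2.
have Xi := L2_integrable XL2; have ci := L2_integrable cL2.
have intc : \int[P]_w r = r.
  rewrite /Rintegral (_ : (\int[P]_w r%:E)%E = r%:E)//.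
  by transitivity (r%:E * P setT)%E; [exact: (@integral_cst _ _ _ P setT measurableT r%:E)|rewrite PT mule1].
have m1 : \int[P]_w (fine (X w) - r) = 0.
  by rewrite RintegralB// intc /Rintegral E1 subrr.
split => //.
have -> : \int[P]_w (fine (X w) - r) ^+ 2 =
    ip P (fun w => fine (X w) - r) (fun w => fine (X w) - r).
  by apply: eq_Rintegral => w _; rewrite expr2.
rewrite ipBl// ipBr// ipBr// /ip.
have -> : \int[P]_w (fine (X w) * fine (X w)) = r ^+ 2 + r.
  by rewrite -[RHS]/(fine (r ^+ 2 + r)%:E) -S2.
have E1' : \int[P]_w fine (X w) = r by rewrite /Rintegral E1.
have -> : \int[P]_w (r * r) = r * r by transitivity (r * \int[P]_w r); [rewrite -RintegralZl|rewrite intc].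
by rewrite RintegralZr// RintegralZl// E1'; ring.
Qed.

End poisson_moments.

(** * Independence of increments from the past of each noise *)

Section cylinders.
Context {d : measure_display} {O : measurableType d} {R : realType}.
Variables (Q : Type) (valid : Q -> Prop) (ev : Q -> set O).

(** Finite intersections of elementary events, the pi-system for uniqueness of measures. [List.In]
    is used since [Q] is a bare type without a boolean equality. *)
Definition cylinder (L : seq Q) : set O := [set w | forall q, List.In q L -> ev q w].

Definition cylinders : set (set O) :=
  [set A | exists L, (forall q, List.In q L -> valid q) /\ A = cylinder L].

Lemma cylindersT : cylinders setT.
Proof. by exists [::]; split => //; apply/seteqP; split => // w _ q []. Qed.

Lemma cylindersI : setI_closed cylinders.
Proof.
move=> _ _ [L [vL ->]] [L' [vL' ->]]; exists (L ++ L'); split.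
  by move=> q /List.in_app_iff []; [exact: vL|exact: vL'].
apply/seteqP; split => w /=.
  by move=> [H H'] q /List.in_app_iff []; [exact: H|exact: H'].
by move=> H; split => q qL; apply: H; apply/List.in_app_iff; [left|right].
Qed.

Lemma cylinders1 q : valid q -> cylinders (ev q).
Proof.
move=> vq; exists [:: q]; split; first by move=> _ [<-|[]].
apply/seteqP; split => w /=; first by move=> H _ [<-|[]].
by apply; left.
Qed.

Lemma cylinder_sub (G : set (set O)) L :
  (forall q, List.In q L -> <<s G >> (ev q)) -> <<s G >> (cylinder L).
Proof.
elim: L => [|q L IH] H.
  rewrite (_ : cylinder _ = setT); last by apply/seteqP; split => // w _ q [].
  exact: (@measurableT _ (g_sigma_algebraType G)).
rewrite (_ : cylinder _ = ev q `&` cylinder L).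
  apply: (@measurableI _ (g_sigma_algebraType G)); first by apply: H; left.
  by apply: IH => q' q'L; apply: H; right.
apply/seteqP; split => w /=; first by move=> Hw; split; [apply: Hw; left|move=> q' ?; apply: Hw; right].
by move=> [? ?] q' [<-//|]; auto.
Qed.

End cylinders.

Section brownian_history.
Context {R : realType} {e1 : measure_display} {O1 : measurableType e1}
  (PW : probability O1 R) (T : R) (d : nat) (W : 'I_d -> R -> O1 -> R).
Hypothesis W_bm : brownian_motion PW T W.

Definition brownian_valid (u : R) (q : 'I_d * R * set R) :=
  0 <= q.1.2 <= u /\ measurable q.2.

Definition brownian_event (q : 'I_d * R * set R) : set O1 :=
  [set w | q.2 (W q.1.1 q.1.2 w)].

Definition brownian_history u := cylinders (brownian_valid u) brownian_event.

Let bm_meas m t : 0 <= t <= T -> measurable_fun setT (W m t).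
Proof. by have [+ _ _ _ _] := W_bm; apply. Qed.

Let bm0 m w : W m 0 w = 0.
Proof. by have [_ + _ _ _] := W_bm; apply. Qed.

Lemma brownian_event_measurable u q : u <= T -> brownian_valid u q ->
  measurable (brownian_event q).
Proof.
move=> uT [/andP[q0 qu] mq]; rewrite -[X in measurable X]setTI.
by apply: bm_meas => //; rewrite q0 (le_trans qu).
Qed.

(** The observation times are sorted together with 0 and u, so the grid starts at 0 and its last
    listed point is u. The point t follows as the default value of [nth], one position past the end.
    Repeated times do no harm. *)
Let grid_exists (l : seq R) (u t : R) : 0 <= u -> u < t ->
  (forall r, r \in l -> 0 <= r <= u) ->
  exists p (s : nat -> R), [/\ s 0%N = 0, forall j, (j < p.+1)%N -> s j <= s j.+1,
    s p = u, s p.+1 = t & forall r, r \in l -> exists2 j, (j <= p)%N & s j = r].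
Proof.
move=> u0 ut lu; pose ts := sort <=%R (0 :: u :: l).
have sz : size ts = (size l).+2 by rewrite size_sort.
have memts r : (r \in ts) = (r \in 0 :: u :: l) by rewrite mem_sort.
have tsu r : r \in ts -> 0 <= r <= u.
  by rewrite memts !inE => /or3P[/eqP ->|/eqP ->|/lu//]; rewrite lexx u0.
have so : sorted <=%R ts by apply: sort_sorted; exact: le_total.
have mono i j : (i <= j)%N -> (j < (size l).+2)%N -> nth t ts i <= nth t ts j.
  move=> ij jl; apply: (sorted_leq_nth le_trans lexx) => //; rewrite inE sz//.
  exact: leq_ltn_trans jl.
have nth_in j : (j < (size l).+2)%N -> 0 <= nth t ts j <= u.
  by move=> jl; apply: tsu; apply: mem_nth; rewrite sz.
have idx r : r \in ts -> (index r ts < (size l).+2)%N.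
  by rewrite -index_mem sz.
have z0 : 0 \in ts by rewrite memts inE eqxx.
have zu : u \in ts by rewrite memts !inE eqxx orbT.
have su : nth t ts (size l).+1 = u.
  apply/eqP; rewrite eq_le; have /andP[_ ->] /= := nth_in (size l).+1 (ltnSn _).
  by rewrite -{1}(nth_index t zu) mono// -ltnS idx.
exists (size l).+1, (nth t ts); split => //.
- apply/eqP; rewrite eq_le; have /andP[-> _] := nth_in 0%N isT; rewrite andbT.
  by rewrite -[leRHS](nth_index t z0) mono// idx.
- move=> j; rewrite ltnS leq_eqVlt => /orP[/eqP ->|jl]; last by rewrite mono.
  by rewrite su nth_default ?sz// ltW.
- by rewrite nth_default// sz.
- move=> r rl; exists (index r ts); last by rewrite nth_index// memts !inE rl !orbT.
  by rewrite -ltnS idx// memts !inE rl !orbT.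
Qed.

(** An event of the past involves finitely many times; on a grid through these times it belongs to
    the sigma-algebra of the increments other than that of component m over ]u, t]. *)
Lemma brownian_increment_indep m u t (A : set O1) (B : set R) :
  0 <= u -> u < t -> t <= T -> brownian_history u A -> measurable B ->
  PW (A `&` [set w | B (W m t w - W m u w)]) =
  (PW A * PW [set w | B (W m t w - W m u w)%R])%E.
Proof.
move=> u0 ut tT [L [vL ->]] mB.
have lP r : r \in [seq q.1.2 | q <- L] -> 0 <= r <= u.
  elim: L vL => //= q L IH vL; rewrite inE => /orP[/eqP ->|].
    by have [] := vL q (or_introl erefl).
  by apply: IH => q' q'L; apply: vL; right.
have [p [s [s0 smono sp sp1 sL]]] := grid_exists u0 ut lP.
have sle i j : (i <= j)%N -> (j <= p.+1)%N -> s i <= s j.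
  move=> /subnK <-; elim: (j - i)%N => // k IH kp.
  by rewrite addSn; apply: le_trans (IH (ltnW kp)) _; exact: smono.
have sT j : (j <= p.+1)%N -> 0 <= s j <= T.
  by move=> jp; rewrite -{1}s0 sle//= (le_trans (sle _ _ jp (leqnn _)))// sp1.
have [_ _ _ _ /(_ p.+1 s)] := W_bm; rewrite s0 sp1 => /(_ (lexx _) smono tT) indep.
pose Y (mj : 'I_d * 'I_p.+1) w := W mj.1 (s mj.2.+1) w - W mj.1 (s mj.2) w.
have mY i : measurable_fun setT (Y i).
  by apply: measurable_funB; apply: bm_meas; apply: sT => //; exact: ltnW.
have := @mutual_independence_group _ _ _ PW _ _ _ Y (m, ord_max) B mY indep mB.
rewrite /Y /= sp sp1; apply.
set GY := (X in <<s X >>); apply: cylinder_sub => q qL.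
have qin : q.1.2 \in [seq q.1.2 | q <- L].
  elim: L qL {vL lP sL} => //= q' L IH [->|/IH qL]; rewrite inE ?eqxx//.
  by rewrite qL orbT.
have [j jp sj] := sL _ qin.
have [_ mq] := vL _ qL.
(* As W starts at 0, its value at s_k is the sum of the increments of index below k, none of which
   is the last index p. *)
have mW k : (k <= p)%N ->
    measurable_fun setT (W q.1.1 (s k) : g_sigma_algebraType GY -> R).
  elim: k => [_|k IH kp].
    rewrite s0 (_ : W q.1.1 0 = cst 0); last by apply/funext => w; exact: bm0.
    exact: measurable_cst.
  pose k' : 'I_p.+1 := Ordinal (leqW kp).
  rewrite (_ : W _ _ = (fun w => W q.1.1 (s k) w + Y (q.1.1, k') w)); last first.
    by apply/funext => w; rewrite /Y/= addrC subrK.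
  apply: (@measurable_funD _ (g_sigma_algebraType GY)); first exact: IH (ltnW kp).
  move=> _ C mC; rewrite setTI; apply: sub_sigma_algebra.
  exists (q.1.1, k'), C; split => //.
  by apply/negP => /eqP [_ kp']; move: (kp); rewrite kp' ltnn.
by rewrite /brownian_event -sj -[X in <<s _ >> X]setTI; exact: mW.
Qed.

End brownian_history.

Section poisson_history.
Context {R : realType} {e2 : measure_display} {O2 : measurableType e2}
  (PN : probability O2 R) (T : R)
  (mu : {finite_measure set (measurableTypeR R) -> \bar R})
  (N : R.-ker O2 ~> (R * R)%type).
Hypothesis N_prm : poisson_random_measure PN T mu N.

Definition poisson_valid (u : R) (q : set (R * R) * set (\bar R)) :=
  [/\ measurable q.1, q.1 `<=` marked_times u & measurable q.2].

Definition poisson_event (q : set (R * R) * set (\bar R)) : set O2 :=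
  [set w | q.2 (N w q.1)].

Definition poisson_history u := cylinders (poisson_valid u) poisson_event.

Lemma poisson_event_measurable u q : poisson_valid u q ->
  measurable (poisson_event q).
Proof.
move=> [m1 _ m2]; rewrite -[X in measurable X]setTI.
exact: (measurable_kernel N).
Qed.

Lemma measurable_marked_times (u : R) : measurable (marked_times u).
Proof.
rewrite (_ : marked_times u = nonzero_mark `*` `[0, u]%classic); last first.
  by apply/seteqP; split => p /=; rewrite in_itv /= /nonzero_mark.
apply: measurableX => //.
rewrite (_ : nonzero_mark = ~` [set 0]); first exact: measurableC.
by apply/seteqP; split => z /= /eqP.
Qed.

Definition window (A : set R) (s t : R) : set (R * R) := A `*` `]s, t]%classic.

Lemma measurable_window A s t : measurable A -> measurable (window A s t).
Proof. by move=> mA; exact: measurableX. Qed.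

Lemma window_marked A s t : A `<=` nonzero_mark -> 0 <= s ->
  window A s t `<=` marked_times t.
Proof.
move=> A0 s0 p [/A0 pA] /=; rewrite in_itv /= => /andP[sp pt].
by split => //; rewrite pt andbT (le_trans s0) ?ltW.
Qed.

Lemma marked_times_le u t : u <= t -> @marked_times R u `<=` marked_times t.
Proof. by move=> ut p [p0 /andP[q0 qu]]; split => //; rewrite q0 (le_trans qu). Qed.

(** Independence is given for disjoint sets, but the sets observed in the past may overlap. They are
    replaced by the atoms of the finite algebra which they generate; the future window is added as
    one more disjoint set. *)
Lemma poisson_increment_indep A' u t (A : set O2) (B : set (\bar R)) :
  measurable A' -> A' `<=` nonzero_mark ->
  0 <= u -> u < t -> t <= T -> poisson_history u A -> measurable B ->
  PN (A `&` [set w | B (N w (window A' u t))]) =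
  (PN A * PN [set w | B (N w (window A' u t))])%E.
Proof.
move=> mA' A'0 u0 ut tT [L [vL ->]] mB.
pose n := size L.
pose Bs (i : 'I_n) : set (R * R) := (nth (set0, set0) L i).1.
have LIn i : (i < n)%N -> List.In (nth (set0, set0) L i) L.
  by rewrite /n; elim: (L) i => //= q l IH [|i]; [left|right; exact: IH].
pose I : finType := option {ffun 'I_n -> bool}.
(* x records which of the observed sets contain the points of this atom; cutting at time u separates
   it from the window ]u, t]. *)
pose part (x : {ffun 'I_n -> bool}) : set (R * R) :=
  marked_times u `&` \bigcap_(i in [set: 'I_n]) (if x i then Bs i else ~` Bs i).
pose E (j : 'I_#|I|) := if enum_val j is Some x then part x else window A' u t.
have mpart x : measurable (part x).
  apply: measurableI; first exact: measurable_marked_times.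
  apply: fin_bigcap_measurable; first exact: finite_finset.
  move=> i _; have [mi _ _] := vL _ (LIn i (ltn_ord i)).
  by case: ifP => // _; exact: measurableC.
have mE j : measurable (E j).
  by rewrite /E; case: (enum_val j) => [x|]; [exact: mpart|exact: measurable_window].
have ET j : E j `<=` marked_times T.
  rewrite /E; case: (enum_val j) => [x p [+ _]|].
    by apply: marked_times_le; rewrite (le_trans (ltW ut)).
  apply: subset_trans (window_marked A'0 u0) _; exact: marked_times_le.
have part_triv x y p : part x p -> part y p -> x = y.
  move=> [_ px] [_ py]; apply/ffunP => i; move: (px i Logic.I) (py i Logic.I).
  by case: (x i) (y i) => [] [].
have trivE : trivIset setT E.
  move=> i j _ _ [p [pi pj]]; apply: enum_val_inj; move: pi pj; rewrite /E.
  case: (enum_val i) (enum_val j) => [x|] [y|] //.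
  - by move=> px py; rewrite (part_triv _ _ _ px py).
  - move=> [[_ /andP[_ pu]] _] [_] /=; rewrite in_itv /= => /andP[+ _].
    by rewrite ltNge pu.
  - move=> [_] /= + [[_ /andP[_ pu]] _]; rewrite in_itv /= => /andP[+ _].
    by rewrite ltNge pu.
have [_ _ /(_ _ E mE ET trivE) indep] := N_prm.
pose i0 : 'I_#|I| := enum_rank (None : I).
have mY i : measurable_fun setT (fun w => N w (E i)) by exact: (measurable_kernel N).
have := @mutual_independence_group _ _ _ PN _ _ _ (fun i w => N w (E i)) i0 B mY indep mB.
have Ei0 : E i0 = window A' u t by rewrite /E /i0 enum_rankK.
rewrite Ei0; apply.
set GY := (X in <<s X >>); apply: cylinder_sub => q qL.
have [i iq] : exists i : 'I_n, nth (set0, set0) L i = q.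
  rewrite /n; elim: (L) qL => //= q' l IH [->|/IH [i <-]]; first by exists ord0.
  by exists (lift ord0 i).
have [mq qu mC] := vL _ qL.
(* An observed set is the union of the atoms contained in it; the index [None] of the window never
   occurs. *)
have qE : q.1 = \big[setU/set0]_(j < #|I| | if enum_val j is Some x then x i else false) E j.
  apply/seteqP; split => p.
    move=> qp; pose x : {ffun 'I_n -> bool} := [ffun j => `[< Bs j p >]].
    rewrite (bigD1 (enum_rank (Some x : I)))/=; last first.
      by rewrite enum_rankK ffunE; apply/asboolP; rewrite /Bs iq.
    left; rewrite /E enum_rankK; split; first exact: qu.
    by move=> j _; rewrite ffunE; case: asboolP.
  elim/big_ind: _ => // [X Y HX HY [/HX|/HY]//|j]; rewrite /E.
  by case: (enum_val j) => // x xi [_ /(_ i Logic.I)]; rewrite xi /Bs iq.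
have NqE w : N w q.1 = (\sum_(j < #|I| | if enum_val j is Some x then x i else false)
    N w (E j))%E.
  rewrite qE; apply: (measure_bigsetU_ord_cond (N w)); first by move=> *; exact: mE.
  exact: (sub_trivIset (@subsetT _ _) trivE).
rewrite /poisson_event -[X in <<s _ >> X]setTI.
suff : measurable_fun setT ((fun w => N w q.1) : g_sigma_algebraType GY -> \bar R) by apply.
rewrite (_ : (fun w => _) = (fun w => \sum_(j < #|I|)
  (if (if enum_val j is Some x then x i else false) then N w (E j) else 0))%E); last first.
  by apply/funext => w; rewrite NqE big_mkcond.
apply: (@emeasurable_sum _ (g_sigma_algebraType GY)) => j.
have step (c : bool) : (c -> j != i0) -> measurable_fun setT
    ((fun w => if c then N w (E j) else 0%E) : g_sigma_algebraType GY -> \bar R).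
  case: c => [/(_ isT) ji|_]; last exact: measurable_cst.
  by move=> _ C' mC'; rewrite setTI; apply: sub_sigma_algebra; exists j, C'.
by apply: step => ji; apply: contraTneq ji => ->; rewrite /i0 enum_rankK.
Qed.

End poisson_history.

(** * Brownian motion and compensated Poisson measure as noises for the common filtration *)

Section noises_of_the_basis.
Context {R : realType} {e1 e2 : measure_display}
  {O1 : measurableType e1} {O2 : measurableType e2}
  (PW : probability O1 R) (PN : probability O2 R)
  (P : probability (O1 * O2)%type R).
Hypothesis P_rect : forall A1 A2, measurable A1 -> measurable A2 ->
  P (A1 `*` A2) = (PW A1 * PN A2)%E.
Variables (T : R) (d : nat) (W : 'I_d -> R -> O1 -> R)
  (mu : {finite_measure set (measurableTypeR R) -> \bar R})
  (N : R.-ker O2 ~> (R * R)%type).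
Hypothesis W_bm : brownian_motion PW T W.
Hypothesis N_prm : poisson_random_measure PN T mu N.

Local Notation F := (filtration P T W N).

Lemma noise_events_mono (s t : R) : s <= t ->
  @noise_events R e1 e2 O1 O2 d W N s `<=` noise_events W N t.
Proof.
move=> st A [[m [u [B [/andP[u0 us] mB ->]]]]|[B [C [mB Bs mC ->]]]].
  by left; exists m, u, B; split => //; rewrite u0 (le_trans us).
right; exists B, C; split => //; apply: subset_trans Bs _.
exact: marked_times_le.
Qed.

Lemma filtration_mono s t : s <= t -> F s `<=` F t.
Proof. by move=> st A FA u tu; apply: FA; exact: le_lt_trans tu. Qed.

Lemma noise_events_measurable : noise_events W N T `<=` measurable.
Proof.
have [bm_meas _ _ _ _] := W_bm.
move=> A [[m [u [B [uT mB ->]]]]|[B [C [mB _ mC ->]]]].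
  rewrite (_ : [set w | _] = (W m u @^-1` B) `*` setT); last first.
    by apply/seteqP; split => w //= [].
  apply: measurableX => //; rewrite -[X in measurable X]setTI.
  exact: bm_meas.
rewrite (_ : [set w | _] = setT `*` ((N ^~ B) @^-1` C)); last first.
  by apply/seteqP; split => w //= [].
apply: measurableX => //; rewrite -[X in measurable X]setTI.
exact: (measurable_kernel N).
Qed.

Lemma filtration_measurable t : F t `<=` measurable.
Proof.
move=> A /(_ (t + 1)) /=; rewrite ltrDl ltr01 => /(_ isT).
apply: smallest_sub; first exact: sigma_algebra_measurable.
move=> B [/noise_events_mono BT|[]//].
by apply: noise_events_measurable; apply: BT; rewrite ge_min lexx orbT.
Qed.

Lemma noise_events_filtration t : t <= T -> noise_events W N t `<=` F t.
Proof.
move=> tT A tA u /= tu; apply: sub_sigma_algebra; left.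
by apply: noise_events_mono tA; rewrite le_min tT ltW.
Qed.

(** Rectangles of past cylinders together with the null events: a pi-system whose generated
    sigma-algebra contains the filtration at all earlier times. *)
Definition history (u : R) : set (set (O1 * O2)) :=
  [set A | exists A1 A2, [/\ brownian_history W u A1, poisson_history N u A2 &
     A = A1 `*` A2]] `|` [set A | measurable A /\ P A = 0%E].

(** The filtration at s is an intersection over later times, and u is one of them; hence the strict
    inequality. *)
Lemma filtration_history s u : s < u -> u <= T -> F s `<=` <<s history u>>.
Proof.
move=> su uT A /(_ u su); rewrite (min_l uT); apply: sub_sigma_algebra2.
move=> B [|nB]; last by right.
case=> [[m [r [C [ru mC ->]]]]|[D [C [mD Du mC ->]]]]; left.
  exists (brownian_event W (m, r, C)), setT; split.
  - exact: cylinders1.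
  - exact: cylindersT.
  - by apply/seteqP; split => w //= [].
exists setT, (poisson_event N (D, C)); split.
- exact: cylindersT.
- exact: cylinders1.
- by apply/seteqP; split => w //= [].
Qed.

Let brownian_historyM u : u <= T -> brownian_history W u `<=` measurable.
Proof.
move=> uT _ [L [vL ->]]; rewrite -(sigma_algebra_id (@sigma_algebra_measurable _ O1)).
apply: cylinder_sub => q /vL vq; apply: sub_sigma_algebra.
exact: (brownian_event_measurable W_bm uT vq).
Qed.

Let poisson_historyM u : poisson_history N u `<=` measurable.
Proof.
move=> _ [L [vL ->]]; rewrite -(sigma_algebra_id (@sigma_algebra_measurable _ O2)).
apply: cylinder_sub => q /vL vq; apply: sub_sigma_algebra.
exact: poisson_event_measurable vq.
Qed.

Let historyM u : u <= T -> history u `<=` measurable.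
Proof.
move=> uT A [[A1 [A2 [H1 H2 ->]]]|[]//].
by apply: measurableX; [exact: brownian_historyM H1|exact: poisson_historyM H2].
Qed.

Let historyI u : u <= T -> setI_closed (history u).
Proof.
move=> uT A B HA HB.
have null C D : measurable C -> measurable D -> P C = 0%E -> P (C `&` D) = 0%E.
  move=> mC mD PC; apply/eqP; rewrite eq_le measure_ge0 andbT -PC.
  by apply: le_measure; rewrite ?inE//; exact: measurableI.
have mA := historyM uT HA; have mB := historyM uT HB.
case: HA => [[A1 [A2 [H1 H2 AE]]]|[_ PA]]; last first.
  by right; split; [exact: measurableI|exact: null].
case: HB => [[B1 [B2 [H3 H4 BE]]]|[_ PB]]; last first.
  by right; split; [exact: measurableI|rewrite setIC; exact: null].
left; exists (A1 `&` B1), (A2 `&` B2); split; [exact: cylindersI|exact: cylindersI|].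
by rewrite AE BE; apply/seteqP; split => w /=; tauto.
Qed.

(** For a null event both sides of the product formula are 0, so only rectangles have to be
    checked. *)
Let history_indep u (V : set (O1 * O2)) : u <= T -> measurable V ->
  (forall A1 A2, brownian_history W u A1 -> poisson_history N u A2 ->
     P ((A1 `*` A2) `&` V) = (P (A1 `*` A2) * P V)%E) ->
  forall A, <<s history u >> A -> P (A `&` V) = (P A * P V)%E.
Proof.
move=> uT mV HV; apply: indep_setI_closed => //.
- exact: historyI.
- left; exists setT, setT; split; [exact: cylindersT|exact: cylindersT|].
  by apply/seteqP; split.
- exact: historyM.
- move=> A [[A1 [A2 [H1 H2 ->]]]|[mA PA]]; first exact: HV.
  rewrite PA mul0e; apply/eqP; rewrite eq_le measure_ge0 andbT -PA.
  by apply: le_measure; rewrite ?inE//; exact: measurableI.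
Qed.

Let PWT : PW setT = 1%E := probability_setT PW.
Let PNT : PN setT = 1%E := probability_setT PN.

Let P_fst (A : set O1) : measurable A -> P [set w | A w.1] = PW A.
Proof.
move=> mA; rewrite (_ : [set w | _] = A `*` setT).
  by rewrite P_rect// PNT mule1.
by apply/seteqP; split => w //= [].
Qed.

Let P_snd (A : set O2) : measurable A -> P [set w | A w.2] = PN A.
Proof.
move=> mA; rewrite (_ : [set w | _] = setT `*` A).
  by rewrite P_rect// PWT mul1e.
by apply/seteqP; split => w //= [].
Qed.

Section brownian.
Variable m : 'I_d.
Let B (t : R) (w : O1 * O2) := W m t w.1.

Let mB t : 0 <= t <= T -> measurable_fun setT (W m t).
Proof. by have [+ _ _ _ _] := W_bm; apply. Qed.

Let mB_event u t (C : set R) : 0 <= u -> u <= t -> t <= T -> measurable C ->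
  measurable [set w | C (W m t w - W m u w)].
Proof.
move=> u0 ut tT mC; rewrite -[X in measurable X]setTI.
apply: measurable_funB => //; apply: mB; rewrite ?u0 ?tT ?(le_trans ut)//.
by rewrite (le_trans u0).
Qed.

Let B_moments u t : 0 <= u -> u < t -> t <= T ->
  [/\ L2 P (fun w => B t w - B u w), \int[P]_w (B t w - B u w) = 0 &
      \int[P]_w (B t w - B u w) ^+ 2 = t - u].
Proof.
move=> u0 ut tT; apply: gaussian_law_moments; first by rewrite subr_gt0.
  apply: measurable_funB; apply: (measurableT_comp _ measurable_fst); apply: mB.
    by rewrite tT (le_trans u0 (ltW ut)).
  by rewrite u0 (le_trans (ltW ut)).
move=> C mC; have [_ _ _ + _] := W_bm => /(_ m u t u0 ut tT C mC) <-.
by apply: P_fst; apply: mB_event => //; exact: ltW.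
Qed.

Let B_adapted : adapted_L2 P F T B.
Proof.
move=> t /andP[t0 tT]; split.
  move=> _ C mC; rewrite setTI; apply: sub_sigma_algebra.
  by apply: noise_events_filtration => //; left; exists m, t, C; rewrite t0 lexx.
have [_ W0 _ _ _] := W_bm.
(* W starts at 0, so its value at t is an increment and its moments are known. *)
have {1}-> : B t = (fun w => B t w - B 0 w).
  by apply/funext => w; rewrite /B W0 subr0.
move: t0; rewrite le_eqVlt => /orP[/eqP <-|t0]; last by have [] := B_moments (lexx 0) t0 tT.
rewrite (_ : (fun w => _) = (fun=> 0)); first exact: L20.
by apply/funext => w; rewrite subrr.
Qed.

Let B_indep u t : 0 <= u -> u < t -> t <= T ->
  forall A (C : set R), <<s history u >> A -> measurable C ->
  P (A `&` [set w | C (B t w - B u w)]) =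
  (P A * P [set w | C (B t w - B u w)%R])%E.
Proof.
move=> u0 ut tT A C HA mC; have uT := le_trans (ltW ut) tT.
have mV := mB_event u0 (ltW ut) tT mC.
apply: (history_indep uT) HA.
  rewrite (_ : [set w | _] = [set w | C (W m t w - W m u w)] `*` setT).
    exact: measurableX.
  by apply/seteqP; split => w //= [].
move=> A1 A2 H1 H2; have m1 := brownian_historyM uT H1; have m2 := poisson_historyM H2.
have -> : P [set w | C (B t w - B u w)] = PW [set w | C (W m t w - W m u w)] := P_fst mV.
rewrite P_rect// -muleA [X in (_ * X)%E]muleC muleA -(brownian_increment_indep W_bm m u0 ut tT H1 mC).
rewrite -P_rect//; last exact: measurableI.
by congr (P _); apply/seteqP; split => w /=; rewrite /B; tauto.
Qed.

Definition brownian_noise (A : set R) (t : R) (w : O1 * O2) : R := W m t w.1.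

Lemma brownian_noiseP :
  noise P T F (\d_(1 : measurableTypeR R) : set R -> \bar R) (eq setT) brownian_noise.
Proof.
have mart := ip_martingale_increment filtration_history B_adapted B_indep.
have sqr := ip_martingale_increment_sqr filtration_mono filtration_measurable
  filtration_history B_adapted B_indep.
have E0 u t : 0 <= u -> u < t -> t <= T -> \int[P]_w (B t w - B u w) = 0.
  by move=> u0 ut tT; have [] := B_moments u0 ut tT.
have E2 u t : 0 <= u -> u < t -> t <= T ->
    \int[P]_w (B t w - B u w) ^+ 2 = 1 * (t - u).
  by move=> u0 ut tT; rewrite mul1r; have [] := B_moments u0 ut tT.
split.
- by move=> A t _; exact: B_adapted.
- by move=> A s t _ s0 st tT Y; exact: (mart _ E0 E2).
- move=> A A' s t <- <- s0 st tT Y C mY YC.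
  by rewrite (sqr 1 E0 E2 s t Y C)// setIT diracT mul1r mulr1.
Qed.

End brownian.

Definition mark_cell (A : set R) := measurable A /\ A `<=` nonzero_mark.

Definition poisson_noise (A : set R) (t : R) (w : O1 * O2) : R :=
  compensated mu N A 0 t w.2.

Let N_nat w (B : set (R * R)) : measurable B -> B `<=` marked_times T ->
  exists j : nat, N w B = j%:R%:E.
Proof. by have [+ _ _] := N_prm; apply. Qed.

Let N_setU w B C : measurable B -> measurable C -> B `<=` marked_times T ->
  C `<=` marked_times T -> B `&` C = set0 ->
  fine (N w (B `|` C)) = fine (N w B) + fine (N w C).
Proof.
move=> mB mC BT CT BC; rewrite measureU//.
have fB : N w B \is a fin_num by have [j ->] := N_nat w mB BT.
have fC : N w C \is a fin_num by have [j ->] := N_nat w mC CT.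
exact: fineD fB fC.
Qed.

Let N_windowU A s u t w : mark_cell A -> 0 <= s -> s <= u -> u <= t -> t <= T ->
  fine (N w (window A s t)) = fine (N w (window A s u)) + fine (N w (window A u t)).
Proof.
move=> [mA A0] s0 su ut tT; have u0 := le_trans s0 su; have uT := le_trans ut tT.
rewrite (_ : window A s t = window A s u `|` window A u t); last first.
  apply/seteqP; split => p /=; rewrite /window /= !in_itv /=.
    by move=> [Ap /andP[sp pt]]; case: (leP p.2 u) => pu; [left|right]; rewrite ?sp ?pt.
  by move=> [[Ap /andP[sp pu]]|[Ap /andP[up pt]]]; split => //;
    rewrite ?sp ?pt ?(le_trans pu)//= ?andbT ?(le_lt_trans su).
apply: N_setU; [exact: measurable_window|exact: measurable_window| | |].
- by apply: subset_trans (window_marked A0 s0) _; exact: marked_times_le.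
- by apply: subset_trans (window_marked A0 u0) _; exact: marked_times_le.
- apply/seteqP; split => // p [[_ /=]] + [_ /=]; rewrite !in_itv /=.
  by move=> /andP[_ pu] /andP[up _]; move: up; rewrite ltNge pu.
Qed.

Lemma compensatedB A s u t w : mark_cell A -> 0 <= s -> s <= u -> u <= t -> t <= T ->
  compensated mu N A s t w - compensated mu N A s u w = compensated mu N A u t w.
Proof.
move=> cA s0 su ut tT; have := N_windowU w cA s0 su ut tT.
by rewrite /compensated /window => ->; ring.
Qed.

Let compensated_disjoint A A' u t w : mark_cell A -> mark_cell A' ->
  A `&` A' = set0 -> 0 <= u -> t <= T ->
  compensated mu N (A `|` A') u t w =
  compensated mu N A u t w + compensated mu N A' u t w.
Proof.
move=> [mA A0] [mA' A'0] AA' u0 tT; rewrite /compensated.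
have -> : (A `|` A') `*` `]u, t]%classic = window A u t `|` window A' u t.
  by apply/seteqP; split => p /=; rewrite /window /=; tauto.
rewrite N_setU; last 5 first.
- exact: measurable_window.
- exact: measurable_window.
- by apply: subset_trans (window_marked A0 u0) _; exact: marked_times_le.
- by apply: subset_trans (window_marked A'0 u0) _; exact: marked_times_le.
- apply/seteqP; split => // p [[pA _] [pA' _]].
  by have : (A `&` A') p.1 by []; rewrite AA'.
rewrite measureU// fineD ?fin_num_measure// /window; ring.
Qed.

Let rateE A u t : mark_cell A -> u <= t ->
  fine ((mu \x lebesgue_measure)%E (window A u t)) = fine (mu A) * (t - u).
Proof.
move=> [mA _] ut.
have mI : measurable (`]u, t]%classic : set (measurableTypeR R)) by [].
have -> : (mu \x lebesgue_measure)%E (window A u t) =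
    (mu A * lebesgue_measure (`]u, t]%classic : set R))%E by exact: product_measure1E.
rewrite lebesgue_measure_itv /= lte_fin; case: ltP => [_|tu].
  by rewrite -EFinD fineM ?fin_num_measure.
by rewrite mule0 /= (@le_anti _ R u t) ?ut// subrr mulr0.
Qed.

Let J A (t : R) (w : O1 * O2) := poisson_noise A t w.

Let J_inc A u t w : mark_cell A -> 0 <= u -> u <= t -> t <= T ->
  J A t w - J A u w = fine (N w.2 (window A u t)) - fine (mu A) * (t - u).
Proof. by move=> cA u0 ut tT; rewrite /J /poisson_noise compensatedB. Qed.

Let J_moments A : mark_cell A -> forall u t, 0 <= u -> u < t -> t <= T ->
  [/\ L2 P (fun w => J A t w - J A u w), \int[P]_w (J A t w - J A u w) = 0 &
      \int[P]_w (J A t w - J A u w) ^+ 2 = fine (mu A) * (t - u)].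
Proof.
move=> cA u t u0 ut tT.
have mD : measurable (window A u t) by apply: measurable_window; exact: cA.1.
have DT : window A u t `<=` marked_times T.
  by apply: subset_trans (window_marked cA.2 u0) _; exact: marked_times_le.
have mN := measurable_kernel N _ mD.
have [_ law _] := N_prm.
have inc w := J_inc w cA u0 (ltW ut) tT.
have [H1 H2 H3] : [/\ L2 P (fun w => fine (N w.2 (window A u t)) - fine (mu A) * (t - u)),
    \int[P]_w (fine (N w.2 (window A u t)) - fine (mu A) * (t - u)) = 0 &
    \int[P]_w (fine (N w.2 (window A u t)) - fine (mu A) * (t - u)) ^+ 2 =
    fine (mu A) * (t - u)].
  apply: (@poisson_law_moments _ _ _ P (fun w => N w.2 (window A u t))).
  - by apply: mulr_ge0; [exact: fine_ge0|rewrite subr_ge0 ltW].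
  - exact: (measurableT_comp mN measurable_snd).
  - by move=> w; exact: N_nat.
  move=> j; rewrite -rateE ?ltW// -(law _ mD DT); apply: P_snd.
  by have := mN measurableT [set j%:R%:E] (emeasurable_set1 _); rewrite setTI.
split.
- by rewrite (_ : (fun w => _) = (fun w => fine (N w.2 (window A u t)) -
    fine (mu A) * (t - u)))//; apply/funext.
- by rewrite -H2; apply: eq_Rintegral => w _; rewrite inc.
- by rewrite -H3; apply: eq_Rintegral => w _; rewrite inc.
Qed.

Let J_adapted A : mark_cell A -> adapted_L2 P F T (J A).
Proof.
move=> cA t /andP[t0 tT]; split.
  apply: (@measurable_funB _ (g_sigma_algebraType (F t))); last exact: measurable_cst.
  move=> _ C mC; rewrite setTI; apply: sub_sigma_algebra.
  apply: noise_events_filtration => //; right; exists (window A 0 t), (fine @^-1` C).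
  split => //; [exact: measurable_window cA.1|exact: window_marked cA.2 _|].
  by rewrite -[X in measurable X]setTI; exact: fine_measurable.
have J0 w : J A 0 w = 0.
  rewrite /J /poisson_noise /compensated subrr mulr0 subr0.
  rewrite (_ : _ `*` _ = set0) ?measure0//.
  apply/seteqP; split => // p [_] /=; rewrite in_itv /= => /andP[p0 p1].
  by have := lt_le_trans p0 p1; rewrite ltxx.
have {1}-> : J A t = (fun w => J A t w - J A 0 w).
  by apply/funext => w; rewrite J0 subr0.
move: t0; rewrite le_eqVlt => /orP[/eqP <-|t0].
  rewrite (_ : (fun w => _) = (fun=> 0)); first exact: L20.
  by apply/funext => w; rewrite subrr.
by have [] := J_moments cA (lexx 0) t0 tT.
Qed.

Let J_indep A : mark_cell A -> forall u t, 0 <= u -> u < t -> t <= T ->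
  forall V (C : set R), <<s history u >> V -> measurable C ->
  P (V `&` [set w | C (J A t w - J A u w)]) =
  (P V * P [set w | C (J A t w - J A u w)%R])%E.
Proof.
move=> [mA A0] u t u0 ut tT V C HV mC; have uT := le_trans (ltW ut) tT.
pose C' : set (\bar R) := [set y | C (fine y - fine (mu A) * (t - u))].
have mC' : measurable C'.
  have m1 : measurable_fun setT (fun y : \bar R => fine y - fine (mu A) * (t - u)).
    by apply: measurable_funB => //; exact: fine_measurable.
  by rewrite -[X in measurable X]setTI; exact: m1.
have SE : [set w | C (J A t w - J A u w)] = [set w | C' (N w.2 (window A u t))].
  by apply/seteqP; split => w; rewrite /mkset /C' (J_inc w (conj mA A0) u0 (ltW ut) tT).
rewrite SE.
have mV : measurable [set w | C' (N w (window A u t))].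
  rewrite -[X in measurable X]setTI; apply: (measurable_kernel N) => //.
  exact: measurable_window.
apply: (history_indep uT) HV.
  rewrite (_ : [set w | _] = setT `*` [set w | C' (N w (window A u t))]).
    exact: measurableX.
  by apply/seteqP; split => w //= [].
move=> A1 A2 H1 H2; have m1 := brownian_historyM uT H1; have m2 := poisson_historyM H2.
rewrite P_rect// (P_snd mV) -muleA.
rewrite -(poisson_increment_indep N_prm mA A0 u0 ut tT H2 mC').
rewrite -P_rect//; last exact: measurableI.
by congr (P _); apply/seteqP; split => w /=; tauto.
Qed.

(** The independence argument gives the isometry for A = A' only. Polarisation extends it: two cells
    are split into their intersection and two differences, and noises on disjoint cells are
    orthogonal. *)
Lemma poisson_noiseP : noise P T F mu mark_cell poisson_noise.
Proof.
have E0 A (cA : mark_cell A) u t : 0 <= u -> u < t -> t <= T ->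
    \int[P]_w (J A t w - J A u w) = 0.
  by move=> u0 ut tT; have [] := J_moments cA u0 ut tT.
have E2 A (cA : mark_cell A) u t : 0 <= u -> u < t -> t <= T ->
    \int[P]_w (J A t w - J A u w) ^+ 2 = fine (mu A) * (t - u).
  by move=> u0 ut tT; have [] := J_moments cA u0 ut tT.
split.
- by move=> A t cA; exact: J_adapted.
- move=> A s t cA s0 st tT Y.
  exact: (ip_martingale_increment filtration_history (J_adapted cA) (J_indep cA)
    (E0 _ cA) (E2 _ cA)).
move=> A A' s t cA cA' s0 st tT Y C mY YC.
have sqr D (cD : mark_cell D) : ip P (fun w => Y w * (J D t w - J D s w))
    (fun w => J D t w - J D s w) = (\int[P]_w Y w) * (fine (mu D) * (t - s)).
  exact: (ip_martingale_increment_sqr filtration_mono filtration_measurable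
    filtration_history (J_adapted cD) (J_indep cD) (E0 _ cD) (E2 _ cD) s0 st tT mY YC).
have mYT := mfun_measurable filtration_measurable mY.
have incL2 D : mark_cell D -> L2 P (fun w => J D t w - J D s w).
  move=> cD; apply: L2B; apply: (J_adapted cD _).2.
    by rewrite tT (le_trans s0 st).
  by rewrite s0 (le_trans st tT).
have YL2 D : mark_cell D -> L2 P (fun w => Y w * (J D t w - J D s w)).
  by move=> cD; apply: (L2_bounded_mul mYT YC); exact: incL2.
have incU D D' w : mark_cell D -> mark_cell D' -> D `&` D' = set0 ->
    J (D `|` D') t w - J (D `|` D') s w =
    (J D t w - J D s w) + (J D' t w - J D' s w).
  move=> cD cD' DD'; have cU : mark_cell (D `|` D').
    split; first by apply: measurableU; [exact: cD.1|exact: cD'.1].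
    by move=> z [/cD.2|/cD'.2].
  by rewrite /J /poisson_noise !compensatedB// compensated_disjoint.
have muU D D' : mark_cell D -> mark_cell D' -> D `&` D' = set0 ->
    fine (mu (D `|` D')) = fine (mu D) + fine (mu D').
  move=> [mD _] [mD' _] DD'; rewrite measureU// fineD ?fin_num_measure//.
(* The square formula holds for D, for D' and for their union, whose noise and intensity are the
   sums; subtracting leaves twice the mixed term, which is therefore 0. *)
have ort D D' : mark_cell D -> mark_cell D' -> D `&` D' = set0 ->
    ip P (fun w => Y w * (J D t w - J D s w)) (fun w => J D' t w - J D' s w) = 0.
  move=> cD cD' DD'; have cU : mark_cell (D `|` D').
    split; first by apply: measurableU; [exact: cD.1|exact: cD'.1].
    by move=> z [/cD.2|/cD'.2].
  have := sqr _ cU; rewrite muU// (@eq_ip _ _ _ _ _ _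
    (fun w => Y w * (J D t w - J D s w) + Y w * (J D' t w - J D' s w))
    (fun w => (J D t w - J D s w) + (J D' t w - J D' s w))); last first.
    by move=> w; rewrite incU//; ring.
  rewrite ipDl; [|exact: L2D (incL2 _ cD) (incL2 _ cD')|exact: YL2|exact: YL2].
  rewrite ipDr; [|exact: YL2|exact: incL2|exact: incL2].
  rewrite [X in _ + X]ipDr; [|exact: YL2|exact: incL2|exact: incL2].
  rewrite !sqr// [ip P (fun w => Y w * (J D' t w - _)) (fun w => J D t w - _)](_ : _ =
    ip P (fun w => Y w * (J D t w - J D s w)) (fun w => J D' t w - J D' s w)).
    by move=> H; lra.
  by apply: eq_Rintegral => w _; ring.
have cI : mark_cell (A `&` A').
  by split; [apply: measurableI; [exact: cA.1|exact: cA'.1]|move=> z [/cA.2]].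
have cD : mark_cell (A `\` A').
  by split; [apply: measurableD; [exact: cA.1|exact: cA'.1]|move=> z [/cA.2]].
have cD' : mark_cell (A' `\` A).
  by split; [apply: measurableD; [exact: cA'.1|exact: cA.1]|move=> z [/cA'.2]].
have I0 : (A `&` A') `&` (A `\` A') = set0 by apply/seteqP; split => z //= [[? ?] []].
have I0' : (A `&` A') `&` (A' `\` A) = set0 by apply/seteqP; split => z //= [[? ?] []].
have D0 : (A `\` A') `&` (A' `\` A) = set0 by apply/seteqP; split => z //= [[? ?] []].
have AE : A = (A `&` A') `|` (A `\` A') by rewrite setUIDK.
have A'E : A' = (A `&` A') `|` (A' `\` A) by rewrite setIC setUIDK.
have incA w : J A t w - J A s w = (J (A `&` A') t w - J (A `&` A') s w) +
    (J (A `\` A') t w - J (A `\` A') s w) by rewrite -incU// -AE.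
have incA' w : J A' t w - J A' s w = (J (A `&` A') t w - J (A `&` A') s w) +
    (J (A' `\` A) t w - J (A' `\` A) s w) by rewrite -incU// -A'E.
rewrite (@eq_ip _ _ _ _ _ _
    (fun w => Y w * (J (A `&` A') t w - J (A `&` A') s w) +
              Y w * (J (A `\` A') t w - J (A `\` A') s w))
    (fun w => (J (A `&` A') t w - J (A `&` A') s w) +
              (J (A' `\` A) t w - J (A' `\` A) s w))); last first.
  move=> w; rewrite -[LHS]/(Y w * (J _ t w - J _ s w) * (J _ t w - J _ s w)).
  by rewrite incA incA'; ring.
rewrite ipDl; [|exact: L2D (incL2 _ cI) (incL2 _ cD')|exact: YL2|exact: YL2].
rewrite ipDr; [|exact: YL2|exact: incL2|exact: incL2].
rewrite [X in _ + X]ipDr; [|exact: YL2|exact: incL2|exact: incL2].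
rewrite sqr// ort// (ort (A `\` A') (A `&` A'))//; last by rewrite setIC.
by rewrite (ort (A `\` A'))// !addr0 mulrA.
Qed.

End noises_of_the_basis.

(** * The stochastic integrals as defined satisfy [isint] *)

Section limits_of_elementary_integrals.
Context {d : measure_display} {O : measurableType d} {R : realType}
  (P : probability O R) (T : R).
Variable F : R -> set (set O).
Hypothesis F_mono : forall s t, s <= t -> F s `<=` F t.
Hypothesis F_meas : forall t, F t `<=` measurable.
Variable nu : {finite_measure set (measurableTypeR R) -> \bar R}.
Variable cell : set R -> Prop.
Hypothesis cell_meas : forall A, cell A -> measurable A.
Variable M : set R -> R -> O -> R.
Hypothesis M_noise : noise P T F nu cell M.
Local Notation Q := (product_measure P (@lebesgue_measure R) \x nu)%E.
Local Notation atom := (atom T F cell).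

Lemma atom_int_clamp (c : atom) a b t w : a <= b -> a <= atom_start c ->
  atom_end c <= b -> atom_int M c (clamp a b t) w = atom_int M c t w.
Proof.
move=> ab ac cb; have := atom_le c; rewrite /atom_int /clamp => cc.
case: (leP b t) => bt.
  rewrite (max_r ab) !min_l//; try lra.
case: (leP a t) => // ta; rewrite !min_r ?subrr//; lra.
Qed.

Lemma atom_int_before (c : atom) a w : a <= atom_start c -> atom_int M c a w = 0.
Proof.
by move=> ac; have := atom_le c; rewrite /atom_int => cc; rewrite !min_r ?subrr ?mulr0//; lra.
Qed.

(** An integral over [a, b] becomes a process on [0, T] that is constant outside [a, b]. All simple
    integrals vanish at a, so I_a has L^2-norm 0; being zero only almost everywhere it is
    subtracted, and the new process starts at 0 for every w, as the maximal inequality below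
    requires. *)
Lemma isint_of_approx (a b : R) (f : O * R * R -> R) (I : R -> O -> R)
    (L : nat -> seq atom) :
  0 <= a -> a <= b -> b <= T -> measurable_fun setT f ->
  (forall t, a <= t <= b -> mfun F t (I t)) ->
  (forall j t w, list_int M (L j) (clamp a b t) w = list_int M (L j) t w) ->
  (forall j w, list_int M (L j) a w = 0) ->
  sqnorm Q (fun p => f p - list_fun (L j) p) @[j --> \oo] --> 0%E ->
  (\int[P]_w ereal_sup [set ((I t w - list_int M (L j) t w) ^+ 2)%:E | t in `[a, b]])%E
    @[j --> \oo] --> 0%E ->
  isint P T F nu cell M f (fun t w => I (clamp a b t) w - I a w) /\
  sqnorm P (I a) = 0%E.
Proof.
move=> a0 ab bT mf mI Lclamp La fL IL.
set e := (X in X @ _ --> _) in IL.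
have aa : a <= a <= b by rewrite lexx ab.
have e_le j t : a <= t <= b -> (sqnorm P (fun w => (I t w - list_int M (L j) t w)%R) <= e j)%E.
  move=> tab; apply: ge0_le_integral_any => w; first by rewrite lee_fin sqr_ge0.
  by apply: ereal_sup_ubound; exists t => //=; rewrite in_itv.
have mL j t : 0 <= t <= T -> measurable_fun setT (list_int M (L j) t).
  by move=> tT; have [_ []] := list_int_adapted F_mono F_meas M_noise (L j) tT.
have tT t : a <= t <= b -> 0 <= t <= T.
  by move=> /andP[at_ tb]; rewrite (le_trans a0 at_) (le_trans tb bT).
have mIT t : a <= t <= b -> measurable_fun setT (I t).
  by move=> tab; apply: (mfun_measurable F_meas); exact: mI.
have clampP t : a <= clamp a b t <= b.
  by rewrite /clamp le_max lexx ge_max ab/= ge_min lexx.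
have Ia_le j : (sqnorm P (I a) <= e j)%E.
  apply: le_trans (e_le j a aa); rewrite le_eqVlt; apply/orP; left; apply/eqP.
  by apply: eq_integral => w _; rewrite La subr0.
have Ia0 : sqnorm P (I a) = 0%E.
  apply/eqP; rewrite eq_le sqnorm_ge0 andbT.
  by apply: (@le_of_cvge0 _ _ _ 1 _ IL) => j; rewrite adde0 mul1e; exact: Ia_le.
split => //; split => //.
  move=> t /andP[t0 tT']; case: (leP a t) => at_; last first.
    rewrite (_ : (fun w => _) = fun=> 0); first exact: mfun_cst.
    apply/funext => w; rewrite /clamp (_ : Num.max _ _ = a) ?subrr//.
    by rewrite max_l// ge_min (ltW at_) orbT.
  apply: mfunB; last exact: (mfun_mono F_mono at_ (mI _ aa)).
  apply: (mfun_mono F_mono _ (mI _ (clampP t))).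
  by rewrite /clamp ge_max at_ ge_min lexx orbT.
exists L; split => // t t0T.
apply: (@squeeze_cvge _ _ _ _ (fun=> 0%E) _ (fun j => 4%:E * e j)%E); last 2 first.
- exact: cvg_cst.
- by rewrite -[X in _ --> X](mule0 4%:E); apply: cvgeZl.
apply: nearW => j; rewrite sqnorm_ge0 /=.
have := @sqnormD_le _ _ _ P (fun w => I (clamp a b t) w - list_int M (L j) (clamp a b t) w)
  (fun w => - I a w).
have -> : (fun w => I (clamp a b t) w - list_int M (L j) (clamp a b t) w + - I a w) =
          (fun w => I (clamp a b t) w - I a w - list_int M (L j) t w).
  by apply/funext => w; rewrite Lclamp; ring.
rewrite sqnormN Ia0 mule0 adde0 => H; apply: le_trans (H _ _) _.
- by apply: measurable_funB; [exact: mIT|apply: mL; exact: tT].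
- by apply: measurable_funN; exact: mIT.
apply: le_trans (lee_wpmul2l _ (e_le j _ (clampP t))) _ => //.
apply: lee_wpmul2r; last by rewrite lee_fin ler_nat.
exact: le_trans (sqnorm_ge0 _ _) (e_le j _ aa).
Qed.

End limits_of_elementary_integrals.

Section stochastic_integrals.
Context {R : realType} {e1 e2 : measure_display}
  {O1 : measurableType e1} {O2 : measurableType e2}
  (PW : probability O1 R) (PN : probability O2 R)
  (P : probability (O1 * O2)%type R).
Hypothesis P_rect : forall A1 A2, measurable A1 -> measurable A2 ->
  P (A1 `*` A2) = (PW A1 * PN A2)%E.
Variables (T : R) (d : nat) (W : 'I_d -> R -> O1 -> R)
  (mu : {finite_measure set (measurableTypeR R) -> \bar R})
  (N : R.-ker O2 ~> (R * R)%type).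
Hypothesis W_bm : brownian_motion PW T W.
Hypothesis N_prm : poisson_random_measure PN T mu N.
Local Notation O := (O1 * O2)%type.
Local Notation F := (filtration P T W N).

Definition brownian_isint m := isint P T F
  (\d_(1 : measurableTypeR R) : {finite_measure set _ -> \bar R}) (eq setT)
  (brownian_noise W m).

Definition poisson_isint := isint P T F mu mark_cell (poisson_noise mu N).

Let F_mono := @filtration_mono R e1 e2 O1 O2 P T d W N.
Let F_meas := @filtration_measurable R e1 e2 O1 O2 PW P T d W N W_bm.

Let at_time_id t : measurable_fun setT (fun w : O => w : at_time P T W N t).
Proof.
move=> _ A mA; rewrite setTI; apply: smallest_sub mA; last exact: F_meas.
exact: sigma_algebra_measurable.
Qed.

Lemma simple_grid_bounds (g : nat -> R) n j :
  (forall i, (i < n)%N -> g i <= g i.+1) -> (j <= n)%N -> g 0%N <= g j <= g n.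
Proof.
move=> gle jn.
have mono i k : (i <= k)%N -> (k <= n)%N -> g i <= g k.
  move=> /subnK <-; elim: (k - i)%N => // l IH ln.
  by rewrite addSn; apply: le_trans (IH (ltnW ln)) _; exact: gle.
by rewrite !mono.
Qed.

(** Progressive measurability is used at the final time b only, where the sigma-algebra of the past
    is contained in the ambient one. *)
Lemma progressive_measurable (a b : R) (H : R -> O -> R) : a <= b -> progressive P T W N a b H ->
  measurable_fun setT (fun q : O * R => H q.2 q.1 * \1_(`]a, b]) q.2).
Proof.
move=> ab /(_ b); rewrite ab lexx => /(_ isT) mH.
pose D := [set q : O * R | a <= q.2 <= b].
have mD : measurable D.
  rewrite (_ : D = setT `*` `[a, b]%classic); first exact: measurableX.
  by apply/seteqP; split => q /=; rewrite /D /= in_itv /=; [move=> ->|case].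
have mHD : measurable_fun D (fun q : O * R => H q.2 q.1).
  have mid : measurable_fun setT (fun q : O * R => (q.1 : at_time P T W N b, q.2)).
    apply: measurable_fun_pair => //.
    exact: (measurableT_comp (@at_time_id b) measurable_fst).
  move=> _ A mA; pose D' := [set p : at_time P T W N b * R | a <= p.2 <= b].
  have mD' : measurable D'.
    rewrite (_ : D' = setT `*` `[a, b]%classic); first exact: measurableX.
    by apply/seteqP; split => q /=; rewrite /D' /= in_itv /=; [move=> ->|case].
  by have := mid measurableT _ (mH mD' A mA); rewrite setTI.
rewrite (_ : (fun q => _) = (fun q => ((fun q : O * R => H q.2 q.1) \_ D) q * \1_(`]a, b]) q.2)).
  apply: measurable_funM; first exact/(measurable_restrictT _ mD).
  by apply: (measurableT_comp _ measurable_snd).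
apply/funext => q; rewrite patchE; case: ifPn => // /negP qD.
rewrite indic_oc (_ : _ && _ = false) ?mulr0//.
by apply/negP => /andP[aq qb]; apply: qD; rewrite inE /D /= (ltW aq) qb.
Qed.

Lemma progressive_field_measurable (a b : R) (G : R -> R -> O -> R) : a <= b ->
  progressive_field P T W N a b G ->
  measurable_fun setT (fun p : O * R * R =>
    G p.1.2 p.2 p.1.1 * \1_(`]a, b]) p.1.2 * \1_nonzero_mark p.2).
Proof.
move=> ab /(_ b); rewrite ab lexx => /(_ isT) mG.
have mz : measurable (@nonzero_mark R).
  rewrite (_ : nonzero_mark = ~` [set 0]); first exact: measurableC.
  by apply/seteqP; split => z /= /eqP.
pose D := [set p : O * R * R | a <= p.1.2 <= b /\ nonzero_mark p.2].
have mD : measurable D.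
  rewrite (_ : D = (setT `*` `[a, b]%classic) `*` nonzero_mark).
    by apply: measurableX => //; exact: measurableX.
  by apply/seteqP; split => q /=; rewrite /D /= in_itv /=; [move=> [-> ?]|move=> [[_ ->]]].
have mGD : measurable_fun D (fun p : O * R * R => G p.1.2 p.2 p.1.1).
  have mid : measurable_fun setT (fun p : O * R * R =>
      ((p.1.1 : at_time P T W N b, p.1.2), p.2)).
    apply: measurable_fun_pair; last exact: measurable_snd.
    apply: measurable_fun_pair.
      by apply: (measurableT_comp (@at_time_id b)); exact: (measurableT_comp measurable_fst measurable_fst).
    exact: (measurableT_comp measurable_snd measurable_fst).
  move=> _ A mA.
  pose D' := [set p : at_time P T W N b * R * R | a <= p.1.2 <= b /\ nonzero_mark p.2].
  have mD' : measurable D'.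
    rewrite (_ : D' = (setT `*` `[a, b]%classic) `*` nonzero_mark).
      by apply: measurableX => //; exact: measurableX.
    by apply/seteqP; split => q /=; rewrite /D' /= in_itv /=; [move=> [-> ?]|move=> [[_ ->]]].
  by have := mid measurableT _ (mG mD' A mA); rewrite setTI.
rewrite (_ : (fun p => _) = (fun p => ((fun p : O * R * R => G p.1.2 p.2 p.1.1) \_ D) p *
    \1_(`]a, b]) p.1.2 * \1_nonzero_mark p.2)).
  apply: measurable_funM; last exact: (measurableT_comp _ measurable_snd).
  apply: measurable_funM; first exact/(measurable_restrictT _ mD).
  by apply: measurableT_comp => //; exact: (measurableT_comp measurable_snd).
apply/funext => p; rewrite patchE; case: ifPn => // /negP pD.
rewrite indic_oc mul0r mul0r; case: (pselect (nonzero_mark p.2)) => pz; last first.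
  by rewrite indicE memNset// mulr0.
rewrite (_ : _ && _ = false) ?mulr0 ?mul0r//.
by apply/negP => /andP[ap pb]; apply: pD; rewrite inE /D /= (ltW ap) pb.
Qed.

Lemma sqnorm_triple (nu : {finite_measure set (measurableTypeR R) -> \bar R})
    (f : O * R * R -> R) : measurable_fun setT f ->
  sqnorm (product_measure P (@lebesgue_measure R) \x nu)%E f =
  (\int[P]_w \int[lebesgue_measure]_s \int[nu]_z (f (w, s, z) ^+ 2)%:E)%E.
Proof.
move=> mf; rewrite /sqnorm fubini_tonelli1; last 2 first.
- by apply/measurable_EFinP; exact: measurable_funX.
- by move=> p; rewrite lee_fin sqr_ge0.
have mf2 : measurable_fun setT (fun p : O * measurableTypeR R * measurableTypeR R =>
    (f p ^+ 2)%:E).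
  by apply/measurable_EFinP; exact: measurable_funX.
have f20 (p : O * measurableTypeR R * measurableTypeR R) : (0 <= (f p ^+ 2)%:E)%E.
  by rewrite lee_fin sqr_ge0.
have mh := @measurable_fun_fubini_tonelli_F _ _ _ _ _ nu _ mf2 f20.
have h0 q : (0 <= fubini_F nu (fun p => (f p ^+ 2)%:E) q)%E.
  by apply: integral_ge0 => z _; exact: f20.
exact: (@fubini_tonelli1 _ _ _ _ _ P (@lebesgue_measure R) _ mh h0).
Qed.

Lemma brownian_integral_isint m (a b : R) H I : 0 <= a -> a <= b -> b <= T ->
  brownian_integral P T W N m a b H I ->
  brownian_isint m (fun p => H p.1.2 p.1.1 * \1_(`]a, b]) p.1.2)
    (fun t w => I (clamp a b t) w - I a w) /\ sqnorm P (I a) = 0%E.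
Proof.
move=> a0 ab bT [pH aI _ [G [HG IG]]].
have mH := progressive_measurable ab pH.
pose f (p : O * R * R) := H p.1.2 p.1.1 * \1_(`]a, b]) p.1.2.
have mf : measurable_fun setT f by exact: (measurableT_comp mH measurable_fst).
have gP j l : (l <= sp_size (G j))%N -> a <= sp_grid (G j) l <= b.
  have := simple_grid_bounds (@sp_grid_le _ _ _ _ _ _ _ _ _ _ _ _ (G j)).
  by rewrite sp_grid0 sp_gridn; apply.
(* An atom contains proofs that depend on l being an index of the j-th grid, so atoms are chosen
   over the dependent pairs (j, l). *)
have /choice [c cP] : forall jl : {j : nat & 'I_(sp_size (G j))},
    exists c : atom T F (eq [set: R]),
    [/\ atom_start c = sp_grid (G (tag jl)) (tagged jl),
        atom_end c = sp_grid (G (tag jl)) (tagged jl).+1,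
        atom_cell c = setT & atom_val c = sp_val (G (tag jl)) (tagged jl)].
  move=> [j l] /=; have ln := ltn_ord l.
  have [M0 spM] := sp_bounded (G j).
  have /andP[g1 _] := gP j l (ltnW ln); have /andP[_ g2] := gP j l.+1 ln.
  have v3 : exists B : R, forall w, `|sp_val (G j) l w| <= B.
    by exists M0 => w; exact: spM.
  by exists (Atom (le_trans a0 g1) (sp_grid_le ln) (le_trans g2 bT)
    (erefl [set: R]) (sp_meas ln) v3).
pose L j := [seq c (Tagged (fun j => 'I_(sp_size (G j))) l) | l : 'I_(sp_size (G j))].
have LE j p : list_fun (L j) p = simple_fun (G j) p.1.2 p.1.1.
  rewrite /list_fun big_map big_enum /simple_fun; apply: eq_bigr => l _.
  have [cs ce cc cv] := cP (Tagged (fun j => 'I_(sp_size (G j))) l).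
  by rewrite /atom_fun cs ce cc cv /= indicT /= mulr1.
have LI j t w : list_int (brownian_noise W m) (L j) t w = simple_integral (G j) m t w.
  rewrite /list_int big_map big_enum /simple_integral; apply: eq_bigr => l _.
  have [cs ce cc cv] := cP (Tagged (fun j => 'I_(sp_size (G j))) l).
  by rewrite /atom_int cs ce cv.
apply: (@isint_of_approx _ _ _ P T F F_mono F_meas _ _ (brownian_noise W m)
  (brownian_noiseP P_rect N W_bm m) a b f I L) => //.
- move=> j t w; rewrite /list_int big_map big_enum [RHS]big_map big_enum; apply: eq_bigr => l _.
  have [cs ce _ _] := cP (Tagged (fun j => 'I_(sp_size (G j))) l).
  apply: atom_int_clamp => //; rewrite ?cs ?ce /=.
    by have /andP[] := gP j l (ltnW (ltn_ord l)).
  by have /andP[] := gP j l.+1 (ltn_ord l).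
- move=> j w; rewrite /list_int big_map big_enum; apply: big1 => l _.
  have [cs _ _ _] := cP (Tagged (fun j => 'I_(sp_size (G j))) l).
  apply: atom_int_before; rewrite cs /=.
  by have /andP[] := gP j l (ltnW (ltn_ord l)).
- apply: (@squeeze_cvge _ _ _ _ (fun=> 0%E) _ _ _ _ _ HG); last exact: cvg_cst.
  apply: nearW => j; rewrite sqnorm_ge0 /=.
  have cm A : [set: R] = A -> measurable A by move=> <-.
  have [mL _] := list_funL2 P F_meas (\d_(1 : measurableTypeR R) : {finite_measure set _ -> \bar R}) cm (L j).
  rewrite sqnorm_triple; last exact: measurable_funB.
  apply: ge0_le_integral_any => w.
    by apply: integral_ge0 => s _; apply: integral_ge0 => z _; rewrite lee_fin sqr_ge0.
  rewrite [leRHS]integral_mkcond; apply: ge0_le_integral_any => s.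
    by apply: integral_ge0 => z _; rewrite lee_fin sqr_ge0.
  (* Nothing depends on the mark, so integration against the unit mass is evaluation; the mark 0 is
     an arbitrary choice. *)
  rewrite (_ : (\int[_]_z _)%E = ((f (w, s, 0) - list_fun (L j) (w, s, 0)) ^+ 2)%:E); last first.
    rewrite (eq_integral (cst ((f (w, s, 0) - list_fun (L j) (w, s, 0)) ^+ 2)%:E)).
      by rewrite integral_cst// [X in (_ * X)%E]diracT mule1.
    by move=> z _; rewrite !LE.
  (* The definition integrates over [a, b], while [f] lives on ]a, b]. At s = a the left-hand side
     is 0, and only an inequality is needed. *)
  rewrite LE /f /= indic_oc patchE; case: (boolP (a < s <= b)%R) => sab.
    by rewrite mulr1 ifT// inE /= in_itv /=; have /andP[/ltW -> ->] := sab.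
  rewrite mulr0 (_ : simple_fun _ _ _ = 0).
    by rewrite subr0 expr0n; case: ifP => // _; rewrite lee_fin sqr_ge0.
  apply: big1 => l _; rewrite indic_oc (_ : _ && _ = false) ?mulr0//.
  apply: contraNF sab => /andP[gs sg].
  have /andP[g1 _] := gP j l (ltnW (ltn_ord l)); have /andP[_ g2] := gP j l.+1 (ltn_ord l).
  by rewrite (le_lt_trans g1 gs) (le_trans sg g2).
- suff -> : (fun j => \int[P]_w ereal_sup [set ((I t w - list_int (brownian_noise W m) (L j) t w) ^+ 2)%:E | t in `[a, b]])%E
     = (fun j => sup_norm2 P a b (fun t w => I t w - simple_integral (G j) m t w)) by [].
  apply/funext => j; apply: eq_integral => w _; congr ereal_sup.
  by apply/seteqP; split => _ [t tab <-]; exists t => //; rewrite LI.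
Qed.

Lemma poisson_integral_isint (a b : R) G I : 0 <= a -> a <= b -> b <= T ->
  poisson_integral P T W mu N a b G I ->
  poisson_isint (fun p => G p.1.2 p.2 p.1.1 * \1_(`]a, b]) p.1.2 * \1_nonzero_mark p.2)
    (fun t w => I (clamp a b t) w - I a w) /\ sqnorm P (I a) = 0%E.
Proof.
move=> a0 ab bT [pG aI _ [S [SG IS]]].
have mf := progressive_field_measurable ab pG.
pose f (p : O * R * R) := G p.1.2 p.2 p.1.1 * \1_(`]a, b]) p.1.2 * \1_nonzero_mark p.2.
have gP j l : (l <= sf_size (S j))%N -> a <= sf_grid (S j) l <= b.
  have := simple_grid_bounds (@sf_grid_le _ _ _ _ _ _ _ _ _ _ _ _ (S j)).
  by rewrite sf_grid0 sf_gridn; apply.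
pose K j := ('I_(sf_size (S j)) * 'I_(sf_cells (S j)))%type.
have /choice [c cP] : forall jl : {j : nat & K j},
    exists c : atom T F mark_cell,
    [/\ atom_start c = sf_grid (S (tag jl)) (tagged jl).1,
        atom_end c = sf_grid (S (tag jl)) (tagged jl).1.+1,
        atom_cell c = @sf_cell _ _ _ _ _ _ _ _ _ _ _ _ (S (tag jl)) (tagged jl).2 &
        atom_val c = @sf_val _ _ _ _ _ _ _ _ _ _ _ _ (S (tag jl)) (tagged jl).1 (tagged jl).2].
  move=> [j [l i]] /=; have ln := ltn_ord l.
  have [M0 spM] := sf_bounded (S j).
  have /andP[g1 _] := gP j l (ltnW ln); have /andP[_ g2] := gP j l.+1 ln.
  have v3 : exists B : R, forall w, `|@sf_val _ _ _ _ _ _ _ _ _ _ _ _ (S j) l i w| <= B.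
    by exists M0 => w; exact: spM.
  by exists (Atom (le_trans a0 g1) (sf_grid_le ln) (le_trans g2 bT)
    (conj (sf_cell_meas i) (@sf_cell_neq0 _ _ _ _ _ _ _ _ _ _ _ _ (S j) i))
    (sf_meas i ln) v3).
pose L j := [seq c (Tagged K li) | li : K j].
have LE j p : list_fun (L j) p = simple_field_fun (S j) p.1.2 p.2 p.1.1.
  rewrite /list_fun big_map big_enum /simple_field_fun pair_big /=.
  apply: eq_bigr => li _; have [cs ce cc cv] := cP (Tagged K li).
  by rewrite /atom_fun cs ce cc cv.
have LI j t w : t <= b -> list_int (poisson_noise mu N) (L j) t w = simple_field_integral mu (S j) t w.
  move=> tb; rewrite /list_int big_map big_enum /simple_field_integral pair_big /=.
  apply: eq_bigr => li _; have [cs ce cc cv] := cP (Tagged K li).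
  rewrite /atom_int cs ce cv cc /=; congr (_ * _).
  have ln := ltn_ord li.1.
  have /andP[g1 _] := gP j li.1 (ltnW ln); have /andP[_ g2] := gP j li.1.+1 ln.
  have gg := sf_grid_le ln.
  have cc' : mark_cell (@sf_cell _ _ _ _ _ _ _ _ _ _ _ _ (S j) li.2) by rewrite -cc; exact: atom_cellP.
  (* For t < 0 both grid points are clipped to t: the increment on the left is 0 and the window on
     the right is empty. *)
  have [t0|t0] := leP 0 t; last first.
    rewrite !min_r ?subrr; try lra.
    rewrite /compensated subrr mulr0 subr0 (_ : _ `*` _ = set0) ?measure0//.
    apply/seteqP; split => // q [_] /=; rewrite in_itv /= => /andP[p0 p1].
    by have := lt_le_trans p0 p1; rewrite ltxx.
  rewrite /poisson_noise (compensatedB N_prm)//.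
  - by rewrite le_min t0 (le_trans a0 g1).
  - by rewrite le_min !ge_min lexx gg orbT.
  - by rewrite ge_min (le_trans g2 bT).
apply: (@isint_of_approx _ _ _ P T F F_mono F_meas _ _ (poisson_noise mu N)
  (poisson_noiseP P_rect W_bm N_prm) a b f I L) => //.
- move=> j t w; rewrite /list_int big_map big_enum [RHS]big_map big_enum.
  apply: eq_bigr => li _; have [cs ce _ _] := cP (Tagged K li).
  apply: atom_int_clamp => //; rewrite ?cs ?ce /=.
    by have /andP[] := gP j li.1 (ltnW (ltn_ord li.1)).
  by have /andP[] := gP j li.1.+1 (ltn_ord li.1).
- move=> j w; rewrite /list_int big_map big_enum; apply: big1 => li _.
  have [cs _ _ _] := cP (Tagged K li).
  apply: atom_int_before; rewrite cs /=.
  by have /andP[] := gP j li.1 (ltnW (ltn_ord li.1)).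
- apply: (@squeeze_cvge _ _ _ _ (fun=> 0%E) _ _ _ _ _ SG); last exact: cvg_cst.
  apply: nearW => j; rewrite sqnorm_ge0 /=.
  have cm (A : set R) : mark_cell A -> measurable A by case.
  have [mL _] := list_funL2 P F_meas mu cm (L j).
  rewrite sqnorm_triple; last exact: measurable_funB.
  apply: ge0_le_integral_any => w.
    by apply: integral_ge0 => s _; apply: integral_ge0 => z _; rewrite lee_fin sqr_ge0.
  rewrite [leRHS]integral_mkcond; apply: ge0_le_integral_any => s.
    by apply: integral_ge0 => z _; rewrite lee_fin sqr_ge0.
  rewrite patchE; case: (boolP (a < s <= b)%R) => sab.
    rewrite ifT; last by rewrite inE /= in_itv /=; have /andP[/ltW -> ->] := sab.
    rewrite [leRHS]integral_mkcond; apply: ge0_le_integral_any => z.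
      by rewrite lee_fin sqr_ge0.
    rewrite LE /f /= indic_oc sab mulr1 patchE indicE; case: ifPn => zz.
      by rewrite mulr1.
    rewrite mulr0 (_ : simple_field_fun _ _ _ _ = 0) ?subr0 ?expr0n//.
    apply: big1 => l _; apply: big1 => i _.
    rewrite [X in _ * X]indicE memNset ?mulr0// => zi; case/negP: zz; rewrite inE.
    exact: (@sf_cell_neq0 _ _ _ _ _ _ _ _ _ _ _ _ (S j) i).
  rewrite (_ : (\int[_]_z _)%E = 0%E).
    case: ifP => // _; apply: integral_ge0 => z _; by rewrite lee_fin sqr_ge0.
  transitivity (\int[mu]_(z in setT) 0)%E; last exact: integral0.
  apply: eq_integral => z _; rewrite LE /f /= indic_oc (negbTE sab) mulr0 mul0r.
  rewrite (_ : simple_field_fun _ _ _ _ = 0) ?subr0 ?expr0n//.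
  apply: big1 => l _; apply: big1 => i _; rewrite indic_oc (_ : _ && _ = false) ?mulr0 ?mul0r//.
  apply: contraNF sab => /andP[gs sg].
  have /andP[g1 _] := gP j l (ltnW (ltn_ord l)); have /andP[_ g2] := gP j l.+1 (ltn_ord l).
  by rewrite (le_lt_trans g1 gs) (le_trans sg g2).
- suff -> : (fun j => \int[P]_w ereal_sup [set ((I t w - list_int (poisson_noise mu N) (L j) t w) ^+ 2)%:E | t in `[a, b]])%E
     = (fun j => sup_norm2 P a b (fun t w => I t w - simple_field_integral mu (S j) t w)) by [].
  apply/funext => j; apply: eq_integral => w _; congr ereal_sup.
  apply/seteqP; split => _ [t tab <-]; exists t => //; rewrite LI//;
    by move: tab; rewrite /= in_itv /= => /andP[].
Qed.

End stochastic_integrals.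

(** * Clamped paths and energy estimates on a time grid *)

Section elementary_estimates.
Context {R : realType}.

Lemma enorm_sqr k (v : 'rV[R]_k) : enorm v ^+ 2 = \sum_i v 0 i ^+ 2.
Proof. by rewrite /enorm sqr_sqrtr// sumr_ge0// => i _; exact: sqr_ge0. Qed.

Lemma enorm_ge0 k (v : 'rV[R]_k) : 0 <= enorm v.
Proof. exact: sqrtr_ge0. Qed.

Lemma coord_le_enorm k (v : 'rV[R]_k) i : v 0 i ^+ 2 <= enorm v ^+ 2.
Proof.
by rewrite enorm_sqr (bigD1 i)//= lerDl sumr_ge0// => j _; exact: sqr_ge0.
Qed.

Lemma sqrD_le (x y : R) : (x + y) ^+ 2 <= 2 * x ^+ 2 + 2 * y ^+ 2.
Proof. by have := sqr_ge0 (x - y); rewrite !expr2; nra. Qed.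

(** A crude induction on (x + y)^2 <= 2 x^2 + 2 y^2; any constant depending only on the number of
    terms will do. *)
Lemma sqr_sum_le (I : Type) (r : seq I) (F : I -> R) :
  (\sum_(i <- r) F i) ^+ 2 <= (2 ^ size r)%:R * \sum_(i <- r) F i ^+ 2.
Proof.
elim: r => [|i r IH]; first by rewrite !big_nil expr0n mulr0.
rewrite !big_cons; apply: le_trans (sqrD_le _ _) _.
have h1 : 1 <= (2 ^ size r)%:R :> R by rewrite ler1n expn_gt0.
have s0 : 0 <= \sum_(i <- r) F i ^+ 2 by apply: sumr_ge0 => j _; exact: sqr_ge0.
have := sqr_ge0 (F i); rewrite /= expnS natrM => h0.
nra.
Qed.

Lemma clamp_itv (a b t : R) : a <= b -> a <= clamp a b t <= b.
Proof. by move=> ab; rewrite /clamp le_max lexx ge_max ab/= ge_min lexx. Qed.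

Lemma clamp_id (a b t : R) : a <= t <= b -> clamp a b t = t.
Proof. by move=> /andP[at_ tb]; rewrite /clamp (min_r tb) (max_r at_). Qed.

Lemma clamp_left (a b t : R) : t <= a -> clamp a b t = a.
Proof. by move=> ta; rewrite /clamp max_l// ge_min ta orbT. Qed.

Lemma clamp_right (a b t : R) : a <= b -> b <= t -> clamp a b t = b.
Proof. by move=> ab bt; rewrite /clamp (min_l bt) (max_r ab). Qed.

Lemma grid_mono (g : nat -> R) J i j : (forall l, (l < J)%N -> g l <= g l.+1) ->
  (i <= j)%N -> (j <= J)%N -> g i <= g j.
Proof.
move=> gle /subnK <-; elim: (j - i)%N => // l IH lJ.
by rewrite addSn; apply: le_trans (IH (ltnW lJ)) _; exact: gle.
Qed.

(** Cells before t contribute their whole increment, the cell of t a partial one, later cells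
    nothing. *)
Lemma clamp_telescope (g : nat -> R) J (y : R -> R) t :
  (forall l, (l < J)%N -> g l <= g l.+1) -> g 0%N <= t <= g J ->
  y t - y (g 0%N) = \sum_(l < J) (y (clamp (g l) (g l.+1) t) - y (g l)).
Proof.
elim: J t => [|J IH] t gle /andP[t0 tJ].
  by rewrite big_ord0 (@le_anti _ R t (g 0%N)) ?t0 ?tJ// subrr.
have gle' l : (l < J)%N -> g l <= g l.+1 by move=> lJ; apply: gle; exact: leqW.
rewrite big_ord_recr /=; case: (leP t (g J)) => tgJ.
  by rewrite -IH ?t0// clamp_left// subrr addr0.
rewrite (clamp_id (a := g J)) ?(ltW tgJ)//.
have -> : \sum_(l < J) (y (clamp (g l) (g l.+1) t) - y (g l)) =
  \sum_(l < J) (y (clamp (g l) (g l.+1) (g J)) - y (g l)).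
  apply: eq_bigr => l _; have l1 : g l.+1 <= g J by apply: (grid_mono gle').
  by rewrite !clamp_right ?gle'// (le_trans l1)// ltW.
rewrite -IH//; first by ring.
by rewrite lexx andbT; exact: (grid_mono gle').
Qed.

Lemma cadlag_clamp (a b : R) (f : R -> R) t : a <= b -> cadlag a b f ->
  f (clamp a b s) @[s --> t^'+] --> f (clamp a b t).
Proof.
move=> ab [rc _]; have [ta|at_] := ltP t a.
  rewrite (clamp_left _ (ltW ta)); have H : f a @[_ --> t^'+] --> f a by exact: cvg_cst.
  apply: cvg_trans H.
  apply: near_eq_cvg; near=> s; rewrite clamp_left//; apply/ltW.
  by near: s; exact: nbhs_right_lt.
have [tb|bt] := ltP t b; last first.
  rewrite (clamp_right ab bt); have H : f b @[_ --> t^'+] --> f b by exact: cvg_cst.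
  apply: cvg_trans H.
  apply: near_eq_cvg; near=> s; rewrite clamp_right//; apply: (le_trans bt).
  by apply/ltW; near: s; exact: nbhs_right_gt.
rewrite clamp_id ?at_ ?ltW//; apply: cvg_trans (rc t _); last by rewrite at_.
apply: near_eq_cvg; near=> s; rewrite clamp_id//; apply/andP; split.
  by apply: (le_trans at_); apply/ltW; near: s; exact: nbhs_right_gt.
by apply/ltW; near: s; exact: nbhs_right_lt.
Unshelve. all: by end_near. Qed.

End elementary_estimates.

Section probability_estimates.
Context {d : measure_display} {O : measurableType d} {R : realType}
  (P : probability O R).

Lemma L2_cst (c : R) : L2 P (fun=> c).
Proof.
split; first exact: measurable_cst.
rewrite /sqnorm integral_cst// lte_mul_pinfty ?lee_fin ?sqr_ge0//.
exact: (le_lt_trans (probability_le1 P measurableT) (ltry _)).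
Qed.

Lemma sqr_mean_le (h : O -> R) (c : R) : measurable_fun setT h ->
  (sqnorm P h <= c%:E)%E -> (\int[P]_w h w) ^+ 2 <= c.
Proof.
move=> mh hc; have h2 : L2 P h by split => //; exact: le_lt_trans hc (ltry _).
have := cauchy_schwarz h2 (L2_cst 1).
have -> : ip P h (fun=> 1) = \int[P]_w h w.
  by apply: eq_Rintegral => w _; rewrite mulr1.
have -> : ip P (fun=> 1) (fun=> 1) = 1.
  rewrite /ip /Rintegral (_ : (\int[P]_x (1 * 1)%:E)%E = 1%E)//.
  rewrite mulr1; transitivity (1 * P setT)%E; last by rewrite probability_setT mule1.
  exact: (@integral_cst _ _ _ P setT measurableT 1%E).
by rewrite mulr1 => /le_trans; apply; rewrite -lee_fin -sqnormE.
Qed.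

(** The path is approximated by its value at the right end of the grid cell containing s;
    right-continuity gives convergence at each s < T as the mesh T / (n + 1) shrinks. *)
Lemma right_continuous_jointly_measurable (T : R) (f : R -> O -> R) : 0 < T ->
  (forall t, 0 <= t <= T -> measurable_fun setT (f t)) ->
  (forall w t, 0 <= t < T -> f s w @[s --> t^'+] --> f t w) ->
  measurable_fun setT (fun q : O * R => f q.2 q.1 * \1_(`[0, T]) q.2).
Proof.
move=> T0 mf rc.
pose h (n : nat) : R := T / n.+1%:R.
have h0 n : 0 < h n by rewrite divr_gt0.
(* Open on the right, so the sampling time (k + 1) h is strictly larger than s, as a limit from the
   right demands. *)
pose cell n (k : nat) : set R := `[k%:R * h n, k.+1%:R * h n[%classic.
pose g (n : nat) (q : O * R) :=
  \sum_(k < n.+1) f (k.+1%:R * h n) q.1 * \1_(cell n k) q.2.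
have mg n : measurable_fun setT (g n).
  apply: measurable_sum => k; apply: measurable_funM.
    apply: (measurableT_comp _ measurable_fst); apply: mf.
    rewrite mulr_ge0 ?(ltW (h0 _))//= /h mulrA ler_pdivrMr// mulrC ler_pM2l//.
    by rewrite ler_nat; exact: ltn_ord.
  have mi : measurable_fun setT (fun s : R => \1_(cell n k) s : R).
    by apply: measurable_indic; exact: measurable_itv.
  exact: (measurableT_comp mi measurable_snd).
have gE n (q : O * R) (k : nat) : (k < n.+1)%N -> cell n k q.2 ->
    g n q = f (k.+1%:R * h n) q.1.
  move=> kn ck; rewrite /g (bigD1 (Ordinal kn))//= big1 ?addr0; last first.
    move=> i ik; rewrite indicE memNset ?mulr0// => ci; case/eqP: ik; apply: val_inj => /=.
    move: ck ci; rewrite /cell /= !in_itv /= => /andP[a1 a2] /andP[b1 b2].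
    have := le_lt_trans a1 b2; have := le_lt_trans b1 a2.
    by rewrite !ltr_pM2r// !ltr_nat !ltnS => *; apply/eqP; rewrite eqn_leq; apply/andP.
  by rewrite indicE mem_set// mulr1.
have mlim : measurable_fun setT (fun q : O * R => f q.2 q.1 * \1_(`[0, T[) q.2).
  apply: (measurable_fun_cvg mg) => q _; rewrite indicE.
  case: (boolP (q.2 \in `[0, T[%classic)) => qT; last first.
    rewrite mulr0 (_ : (fun n => g n q) = cst 0); first exact: cvg_cst.
    apply/funext => n; apply: big1 => k _; rewrite indicE memNset ?mulr0// => ck.
    case/negP: qT; rewrite inE /= in_itv /=; move: ck; rewrite /cell /= in_itv /=.
    move=> /andP[k1 k2]; apply/andP; split.
      by apply: le_trans k1; apply: mulr_ge0 => //; exact: ltW.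
    apply: (lt_le_trans k2); rewrite /h mulrA ler_pdivrMr// mulrC ler_pM2l//.
    by rewrite ler_nat; exact: ltn_ord.
  move: qT; rewrite inE /= in_itv /= mulr1 => qT; have /andP[q0 qT'] := qT.
  apply/cvgrPdist_lt => e e0.
  have /at_right_near [r r0 Hr] : \forall s \near q.2^'+, `|f q.2 q.1 - f s q.1| < e.
    by have /cvgrPdist_lt := rc q.1 q.2 qT; exact.
  have : \forall n \near \oo, h n < r.
    near=> n; rewrite /h ltr_pdivrMr// mulrC -ltr_pdivrMr//.
    apply: (@le_lt_trans _ _ n%:R); last by rewrite ltr_nat.
    by near: n; exact: nbhs_infty_ger.
  apply: filterS => n hr.
  have s0 : 0 <= q.2 / h n by rewrite divr_ge0// ltW.
  have /andP[k1 k2] := truncn_itv s0; set k := Num.truncn _ in k1 k2.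
  have ck : cell n k q.2.
    by rewrite /cell /= in_itv /= -ler_pdivlMr// -ltr_pdivrMr// k1 k2.
  have kn : (k < n.+1)%N.
    rewrite -(ltr_nat R); apply: (le_lt_trans k1).
    by rewrite /h invf_div mulrA ltr_pdivrMr// mulrC ltr_pM2l.
  rewrite (gE _ _ _ kn ck); move: ck; rewrite /cell /= in_itv /= => /andP[c1 c2].
  apply: Hr => //; apply: (le_lt_trans _ (_ : q.2 + h n < _)); last by rewrite ltrD2l.
  by rewrite -natr1 mulrDl mul1r lerD2r.
(* At T there is no right limit within the interval; this single time is added separately. *)
rewrite (_ : (fun q => _) = (fun q : O * R => f q.2 q.1 * \1_(`[0, T[) q.2 +
    f T q.1 * \1_[set T] q.2)).
  apply: measurable_funD => //; apply: measurable_funM.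
    by apply: (measurableT_comp _ measurable_fst); apply: mf; rewrite lexx ltW.
  have mi : measurable_fun setT (fun s : R => \1_([set T] : set R) s : R).
    exact: measurable_indic.
  exact: (measurableT_comp mi measurable_snd).
apply/funext => q; rewrite !indicE; have [->|qT] := eqVneq q.2 T.
  have -> : (T \in `[0, T[%classic) = false by apply: memNset; rewrite /= in_itv /= ltxx andbF.
  by rewrite !mem_set//= ?in_itv /= ?lexx ?ltW// mulr0 add0r.
have -> : (q.2 \in [set T]) = false by apply: memNset; exact/eqP.
rewrite mulr0 addr0; congr (_ * _%:R); congr nat_of_bool.
by apply/idP/idP; rewrite !inE /= !in_itv /= [q.2 <= T]le_eqVlt (negbTE qT).
Unshelve. all: by end_near. Qed.

Variable nu : {finite_measure set (measurableTypeR R) -> \bar R}.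
Local Notation Q := (product_measure P (@lebesgue_measure R) \x nu)%E.

(** Moment bounds are available for each fixed time and mark, so Tonelli puts the expectation
    innermost. The rate r(z) is the weight of the jumps of mark z and is integrated last. *)
Lemma sqnorm_window_le (f : O * R * R -> R) (u v : R) (r : R -> R) (c Rr : R) :
  measurable_fun setT f -> measurable_fun setT r -> (forall z, 0 <= r z) ->
  (\int[nu]_z (r z)%:E <= Rr%:E)%E -> 0 <= c -> u <= v ->
  (forall s z, u < s <= v -> (\int[P]_w (f (w, s, z) ^+ 2)%:E <= (r z * c)%:E)%E) ->
  (sqnorm Q (fun p => f p * \1_(`]u, v]) p.1.2)%R <= (Rr * c * (v - u))%:E)%E.
Proof.
move=> mf mr r0 rR c0 uv fP.
have mi : measurable_fun setT (fun s : R => \1_(`]u, v]) s : R) by exact: measurable_indic.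
have mf1 : measurable_fun setT (fun p : O * R * R => f p * \1_(`]u, v]) p.1.2).
  apply: measurable_funM => //; apply: measurableT_comp => //.
  exact: (measurableT_comp measurable_snd measurable_fst).
set F := fun p : O * R * R => ((f p * \1_(`]u, v]) p.1.2) ^+ 2)%:E.
have mF : measurable_fun setT (F : O * measurableTypeR R * measurableTypeR R -> \bar R).
  by apply/measurable_EFinP; exact: measurable_funX.
have F0 (p : O * measurableTypeR R * measurableTypeR R) : (0 <= F p)%E.
  by rewrite lee_fin sqr_ge0.
rewrite (_ : sqnorm _ _ = \int[nu]_z fubini_G (product_measure P (@lebesgue_measure R)) F z)%E;
  last exact: (@fubini_tonelli2 _ _ _ _ _ (product_measure P (@lebesgue_measure R)) nu F mF F0).
apply: (@le_trans _ _ (\int[nu]_z ((r z)%:E * (c * (v - u))%:E))%E); last first.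
  rewrite ge0_integralZr//; last 3 first.
  - exact/measurable_EFinP.
  - by move=> z _; rewrite lee_fin.
  - by rewrite lee_fin mulr_ge0// subr_ge0.
  by rewrite -mulrA [leRHS]EFinM lee_wpmul2r// lee_fin mulr_ge0// subr_ge0.
apply: ge0_le_integral_any => z; first by apply: integral_ge0 => q _; exact: F0.
have mFz : measurable_fun setT (fun q : O * measurableTypeR R => F (q, z)).
  exact: (measurableT_comp mF (measurable_fun_pair (@measurable_id _ _ setT) (measurable_cst z))).
have Fz0 (q : O * measurableTypeR R) : (0 <= F (q, z))%E by exact: F0.
apply: (@le_trans _ _ (\int[@lebesgue_measure R]_s fubini_G P (fun q => F (q, z)) s)%E).
  rewrite le_eqVlt; apply/orP; left; apply/eqP.
  exact: (@fubini_tonelli2 _ _ _ _ _ P (@lebesgue_measure R) _ mFz Fz0).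
apply: (@le_trans _ _ (\int[lebesgue_measure]_s ((r z * c)%:E * (\1_(`]u, v]) (s : R))%:E))%E); last first.
  rewrite ge0_integralZl//; last 2 first.
  - apply/measurable_EFinP; exact: mi.
  - by rewrite lee_fin mulr_ge0.
  rewrite (_ : (\int[_]_s _)%E = lebesgue_measure (`]u, v]%classic : set R)); last first.
    by rewrite integral_indic// setIT.
  rewrite lebesgue_measure_itv /= lte_fin; case: ltP => [_|vu].
    by rewrite -EFinD -!EFinM mulrA.
  by rewrite mule0 lee_fin !mulr_ge0// subr_ge0.
apply: ge0_le_integral_any => s; first by apply: integral_ge0 => w _; exact: F0.
rewrite /fubini_G /F /= indic_oc; case: (boolP (u < s <= v)) => suv.
  rewrite mule1; apply: le_trans (fP s z suv).
  by apply: ge0_le_integral_any => w; rewrite lee_fin ?sqr_ge0// mulr1.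
rewrite mule0 -[leRHS](integral0 P setT); apply: ge0_le_integral_any => w.
  by rewrite lee_fin sqr_ge0.
by rewrite mulr0 expr0n.
Qed.

Lemma sqnorm_grid_le (f : O * R * R -> R) (g : nat -> R) J (r : R -> R) (c : nat -> R) (Rr : R) :
  measurable_fun setT f -> measurable_fun setT r -> (forall z, 0 <= r z) ->
  (\int[nu]_z (r z)%:E <= Rr%:E)%E -> (forall l, (l < J)%N -> 0 <= c l) ->
  (forall l, (l < J)%N -> g l <= g l.+1) ->
  (forall l s z, (l < J)%N -> g l < s <= g l.+1 ->
    (\int[P]_w (f (w, s, z) ^+ 2)%:E <= (r z * c l)%:E)%E) ->
  (sqnorm Q (fun p => f p * \1_(`]g 0%N, g J]) p.1.2)%R <=
    (Rr * \sum_(l < J) c l * (g l.+1 - g l))%:E)%E.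
Proof.
move=> mf mr r0 rR; elim: J => [|J IH] c0 gle fP.
  have := @sqnorm_window_le f (g 0%N) (g 0%N) r 0 Rr mf mr r0 rR (lexx 0) (lexx _).
  rewrite subrr !mulr0 big_ord0 mulr0; apply => s z /andP[s1 s2].
  by have := lt_le_trans s1 s2; rewrite ltxx.
have gle' l : (l < J)%N -> g l <= g l.+1 by move=> lJ; apply: gle; exact: leqW.
have mi (u v : R) : measurable_fun setT (fun p : O * R * R => \1_(`]u, v]) p.1.2 : R).
  apply: measurableT_comp => //; exact: (measurableT_comp measurable_snd measurable_fst).
have mfi (u v : R) : measurable_fun setT (fun p : O * R * R => f p * \1_(`]u, v]) p.1.2).
  exact: measurable_funM.
rewrite big_ord_recr /= mulrDr EFinD.
have -> : sqnorm Q (fun p => f p * \1_(`]g 0%N, g J.+1]) p.1.2)%R =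
    (sqnorm Q (fun p => f p * \1_(`]g 0%N, g J]) p.1.2)%R +
     sqnorm Q (fun p => f p * \1_(`]g J, g J.+1]) p.1.2)%R)%E.
  rewrite /sqnorm -ge0_integralD//; last 4 first.
  - by move=> p _; rewrite lee_fin sqr_ge0.
  - by apply/measurable_EFinP; apply: measurable_funX; exact: mfi.
  - by move=> p _; rewrite lee_fin sqr_ge0.
  - by apply/measurable_EFinP; apply: measurable_funX; exact: mfi.
  apply: eq_integral => p _; rewrite -EFinD; congr EFin; rewrite !indic_oc.
  have g0J : g 0%N <= g J by apply: (grid_mono gle').
  have gJ := gle J (ltnSn J).
  case: (leP p.1.2 (g J)) => pJ; last first.
    rewrite andbF (le_lt_trans g0J pJ)/= mulr0 expr0n add0r; by [].
  by rewrite (le_trans pJ gJ) andbT /= mulr0 expr0n addr0.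
apply: leeD.
  by apply: IH => // l => [lJ|s z lJ]; [apply: c0|apply: fP]; exact: leqW.
rewrite mulrA; apply: (sqnorm_window_le mf mr r0 rR) => //.
- exact: c0.
- exact: gle.
- by move=> s z; exact: fP.
Qed.

End probability_estimates.

(** * Drift integrals by Cauchy-Schwarz in time *)

Section drift_estimates.
Context {R : realType}.
Local Notation leb := (@lebesgue_measure R).

Lemma sqnorm_indic (a b : R) : a <= b -> sqnorm leb (\1_(`]a, b]) : R -> R) = (b - a)%:E.
Proof.
move=> ab; transitivity (\int[leb]_s (\1_(`]a, b]) (s : R))%:E)%E.
  by apply: eq_integral => s _; rewrite indicE; case: (_ \in _); rewrite ?expr1n ?expr0n.
transitivity (lebesgue_measure (`]a, b]%classic : set R)); first by rewrite integral_indic// setIT.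
rewrite lebesgue_measure_itv /= lte_fin; case: ltP => [_|ba]; first by rewrite -EFinD.
by rewrite (@le_anti _ R a b) ?ab// subrr.
Qed.

Lemma L2_indic (a b : R) : L2 leb (\1_(`]a, b]) : R -> R).
Proof.
split; first by apply: measurable_indic; exact: measurable_itv.
have [ab|ba] := leP a b; first by rewrite sqnorm_indic// ltry.
rewrite (_ : (\1_(`]a, b]) : R -> R) = fun=> 0); first exact: (L20 leb).2.
apply/funext => s; rewrite indic_oc; case: (boolP (_ && _)) => // /andP[as_ sb].
by have := lt_le_trans as_ sb; rewrite ltNge (ltW ba).
Qed.

(** Writing the integral as an inner product with an indicator makes bilinearity and Cauchy-Schwarz
    available. The closed end point 0 has measure 0. *)
Lemma Rintegral_0t (G : R -> R) (u t : R) : 0 <= t -> t <= u -> measurable_fun setT G ->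
  \int[leb]_(s in `[0, t]) G s =
  ip leb (fun s => G s * \1_(`]0, u]) s) (\1_(`]0, t]) : R -> R).
Proof.
move=> t0 tu mG; transitivity (\int[leb]_(s in `]0, t]) G s).
  rewrite /Rintegral integral_itv_obnd_cbnd//; apply/measurable_EFinP.
  exact: (measurable_funTS mG).
rewrite /ip Rintegral_mkcond; apply: eq_Rintegral => s _; rewrite patchE !indic_oc.
rewrite (_ : (s \in `]0, t]%classic) = (0 < s <= t)); last first.
  by apply/idP/idP; rewrite inE /= in_itv.
case: ifPn => [/andP[s0 st]|_]; last by rewrite mulr0.
by rewrite s0 (le_trans st tu) !mulr1.
Qed.

Lemma ip_indic_le (h : R -> R) (a b : R) : a <= b -> measurable_fun setT h ->
  ((ip leb h (\1_(`]a, b]) : R -> R) ^+ 2)%:E <= (b - a)%:E * sqnorm leb h)%E.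
Proof.
move=> ab mh; have [hoo|hoo] := ltP (sqnorm leb h) +oo%E.
  have h2 : L2 leb h by [].
  have i2 := L2_indic a b.
  rewrite sqnormE// -(sqnorm_indic ab) (sqnormE i2) -EFinM lee_fin mulrC.
  exact: cauchy_schwarz.
(* With infinite energy the right-hand side is +oo, unless a = b, where it is 0 by convention and so
   is the left-hand side. *)
move: hoo; rewrite leye_eq => /eqP ->; move: ab; rewrite le_eqVlt => /orP[/eqP ->|ab].
  rewrite subrr mul0e lee_fin (_ : ip _ _ _ = 0) ?expr0n// -[RHS](ip0r leb h).
  apply: eq_ip => s; rewrite indic_oc; case: (boolP (_ && _)) => // /andP[s1 s2].
  by have := lt_le_trans s1 s2; rewrite ltxx.
by rewrite gt0_muley ?leey// lte_fin subr_gt0.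
Qed.

Lemma drift_increment (G : R -> R) (s t u : R) : 0 <= s -> s <= t -> t <= u ->
  measurable_fun setT G -> (sqnorm leb (fun r => G r * \1_(`]0, u]) r)%R < +oo)%E ->
  (((\int[leb]_(r in `[0, t]) G r - \int[leb]_(r in `[0, s]) G r) ^+ 2)%:E <=
   (t - s)%:E * sqnorm leb (fun r => G r * \1_(`]s, t]) r)%R)%E.
Proof.
move=> s0 st tu mG Goo.
have mi (a b : R) : measurable_fun setT (\1_(`]a, b]) : R -> R).
  by apply: measurable_indic; exact: measurable_itv.
have t0 := le_trans s0 st.
have G2 : L2 leb (fun r => G r * \1_(`]0, u]) r).
  by split => //; exact: (measurable_funM mG (mi _ _)).
rewrite !(@Rintegral_0t G u)// ?(le_trans st)// -ipBr//; [|exact: L2_indic|exact: L2_indic].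
have mGst : measurable_fun setT (fun r : R => G r * \1_(`]s, t]) r).
  exact: (measurable_funM mG (mi _ _)).
apply: le_trans (ip_indic_le st mGst); rewrite le_eqVlt; apply/orP; left; apply/eqP.
congr ((_ ^+ 2)%:E); apply: eq_ip => r; rewrite !indic_oc.
have [rs|sr] := leP r s; first by rewrite (le_trans rs st) !andbT subrr /= !mulr0.
rewrite (le_lt_trans s0 sr) /=; case: (leP r t) => rt; last by rewrite /= subr0 !mulr0.
by rewrite (le_trans rt tu) subr0 !mulr1.
Qed.

(** The clamped sum is the integral over [0, t] of the step function with values c_l, so the
    difference is the integral of [h] over an interval of length at most T. The bound does not
    depend on t, which makes it a bound for the supremum. *)
Lemma drift_decomposition (G : R -> R) (c g : nat -> R) J (t T : R) :
  g 0%N = 0 -> (forall l, (l < J)%N -> g l <= g l.+1) -> g J <= T -> 0 < T ->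
  0 <= t <= g J -> measurable_fun setT G ->
  let h s := (G s - \sum_(l < J) c l * \1_(`]g l, g l.+1]) s) * \1_(`]0, g J]) s in
  (((\int[leb]_(s in `[0, t]) G s -
    \sum_(l < J) c l * (clamp (g l) (g l.+1) t - g l)) ^+ 2)%:E <= T%:E * sqnorm leb h)%E.
Proof.
move=> g0 gle gT T0 /andP[t0 tJ] mG; cbv zeta; set h := (X in sqnorm leb X).
have mi (a b : R) : measurable_fun setT (\1_(`]a, b]) : R -> R).
  by apply: measurable_indic; exact: measurable_itv.
have mh : measurable_fun setT h.
  apply: measurable_funM => //; apply: measurable_funB => //.
  by apply: measurable_sum => l; apply: measurable_funM.
have [hoo|hoo] := ltP (sqnorm leb h) +oo%E; last first.
  by move: hoo; rewrite leye_eq => /eqP ->; rewrite gt0_muley ?leey.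
have h2 : L2 leb h by [].
have g0l l : (l <= J)%N -> 0 <= g l.
  by move=> lJ; rewrite -g0; exact: (grid_mono gle).
have c2 : L2 leb (fun s => \sum_(l < J) c l * \1_(`]g l, g l.+1]) s).
  by apply: L2_sum => l; apply: L2Z; exact: L2_indic.
have i2 := L2_indic 0 t.
rewrite (Rintegral_0t t0 tJ mG).
have -> : \sum_(l < J) c l * (clamp (g l) (g l.+1) t - g l) =
    ip leb (fun s => \sum_(l < J) c l * \1_(`]g l, g l.+1]) s) (\1_(`]0, t]) : R -> R).
  rewrite ipC ip_sumr//; last by move=> l; apply: L2Z; exact: L2_indic.
  apply: eq_bigr => l _; have ll := ltn_ord l.
  have gl := gle l ll; have gl0 := g0l l (ltnW ll).
  have /andP[k1 k2] := clamp_itv t gl.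
  rewrite ipZr//; last exact: L2_indic.
  congr (_ * _); apply: EFin_inj; rewrite -(sqnorm_indic k1) sqnormE; last exact: L2_indic.
  congr EFin; apply: eq_ip => s; rewrite !indic_oc /clamp.
  case: (leP (g l.+1) t) => gt; rewrite ?(max_r gl).
    case: (ltP (g l) s) => s1; last by rewrite /= !mulr0.
    rewrite (le_lt_trans gl0 s1)/=; case: (leP s (g l.+1)) => s2; last by rewrite /= !mulr0.
    by rewrite (le_trans s2 gt).
  case: (leP (g l) t) => lt'.
    case: (ltP (g l) s) => s1; last by rewrite /= !mulr0.
    rewrite (le_lt_trans gl0 s1)/=; case: (leP s t) => s2; last by rewrite /= !mul0r.
    by rewrite (le_trans s2 (ltW gt)).
  rewrite (_ : (g l < s <= g l) = false); last first.
    by apply/negP => /andP[s1 s2]; have := lt_le_trans s1 s2; rewrite ltxx.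
  rewrite mulr0; case: (ltP (g l) s) => s1; last by rewrite /= !mulr0.
  rewrite (_ : (s <= t) = false) ?andbF ?mul0r//.
  by apply/negbTE; rewrite -ltNge; exact: lt_trans lt' s1.
have hE s : G s * \1_(`]0, g J]) s = h s + \sum_(l < J) c l * \1_(`]g l, g l.+1]) s.
  rewrite /h indic_oc; case: (boolP (_ && _)) => s0; first by rewrite !mulr1 subrK.
  rewrite !mulr0 add0r big1// => l _; rewrite indic_oc.
  case: (boolP (_ && _)) => sl; last by rewrite /= !mulr0.
  case/negP: s0; move: sl => /andP[sl sl1]; have ll := ltn_ord l.
  rewrite (le_lt_trans (g0l l (ltnW ll)) sl) (le_trans sl1)//.
  exact: (grid_mono gle).
rewrite (_ : (fun s => G s * _) = (fun s => h s + \sum_(l < J) c l * \1_(`]g l, g l.+1]) s));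
  last by apply/funext => s; exact: hE.
rewrite ipDl// addrK.
apply: le_trans (ip_indic_le t0 mh) _.
by rewrite subr0 lee_wpmul2r ?sqnorm_ge0// lee_fin (le_trans tJ).
Qed.

End drift_estimates.

(** * Second moments and means of random vectors *)

Section vector_moments.
Context {d : measure_display} {O : measurableType d} {R : realType}
  (P : probability O R) {k : nat}.
Implicit Types Y Z : O -> 'rV[R]_k.

Definition second_moment Y : \bar R := (\int[P]_w (enorm (Y w) ^+ 2)%:E)%E.

Definition vmeasurable Y := forall i, measurable_fun setT (fun w => Y w 0 i).

Lemma measurable_borel_vector Y : vmeasurable Y ->
  measurable_fun setT (Y : O -> borel_vector R k).
Proof.
move=> mY _ A sA; rewrite setTI.
apply: (smallest_sub (C := sigma_algebra setT) (X := [set A | measurable (Y @^-1` A)]) _ _ sA).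
  split; first by rewrite /= preimage_set0.
    by move=> B /= mB; rewrite setTD preimage_setC; exact: measurableC.
  by move=> B mB /=; rewrite preimage_bigcup; exact: bigcupT_measurable.
move=> _ [i [B mB ->]] /=; rewrite -[X in measurable X]setTI; exact: mY.
Qed.

Lemma second_moment_ge0 Y : (0 <= second_moment Y)%E.
Proof. by apply: integral_ge0 => w _; rewrite lee_fin sqr_ge0. Qed.

Lemma second_momentE Y : vmeasurable Y ->
  second_moment Y = (\sum_(i < k) sqnorm P (fun w => Y w 0%R i))%E.
Proof.
move=> mY; rewrite /second_moment -ge0_integral_sum//; last 2 first.
- by move=> i; exact: measurable_sqE.
- by move=> i w _; rewrite lee_fin sqr_ge0.
by apply: eq_integral => w _; rewrite enorm_sqr sumEFin.
Qed.

Lemma sqnorm_coord_le Y i : (sqnorm P (fun w => Y w 0%R i) <= second_moment Y)%E.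
Proof.
apply: ge0_le_integral_any => w; first by rewrite lee_fin sqr_ge0.
by rewrite lee_fin coord_le_enorm.
Qed.

Lemma second_moment_L2 Y i : vmeasurable Y -> (second_moment Y < +oo)%E ->
  L2 P (fun w => Y w 0 i).
Proof. by move=> mY Yoo; split; [exact: mY|exact: le_lt_trans (sqnorm_coord_le _ _) Yoo]. Qed.

Lemma vmeasurableB Y Z : vmeasurable Y -> vmeasurable Z ->
  vmeasurable (fun w => Y w - Z w).
Proof.
move=> mY mZ i; rewrite (_ : (fun w => _) = (fun w => Y w 0 i - Z w 0 i)).
  exact: measurable_funB.
by apply/funext => w; rewrite !mxE.
Qed.

Lemma measurable_enorm_sqr Y : vmeasurable Y ->
  measurable_fun setT (fun w => enorm (Y w) ^+ 2).
Proof.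
move=> mY; rewrite (_ : (fun w => _) = (fun w => \sum_i Y w 0 i ^+ 2)).
  by apply: measurable_sum => i; exact: measurable_funX.
by apply/funext => w; rewrite enorm_sqr.
Qed.

Lemma second_momentB_le Y Z : vmeasurable Y -> vmeasurable Z ->
  (second_moment (fun w => Y w - Z w)%R <= 2%:E * second_moment Y + 2%:E * second_moment Z)%E.
Proof.
move=> mY mZ; have mE V : vmeasurable V -> measurable_fun setT (fun w => (enorm (V w) ^+ 2)%:E).
  by move=> mV; apply/measurable_EFinP; exact: measurable_enorm_sqr.
rewrite /second_moment -!ge0_integralZl//; [|exact: mE|by move=> w _; rewrite lee_fin sqr_ge0|
  exact: mE|by move=> w _; rewrite lee_fin sqr_ge0].
rewrite -ge0_integralD//; last 4 first.
- by move=> w _; rewrite -EFinM lee_fin mulr_ge0// sqr_ge0.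
- by apply: measurable_funeM; exact: mE.
- by move=> w _; rewrite -EFinM lee_fin mulr_ge0// sqr_ge0.
- by apply: measurable_funeM; exact: mE.
apply: ge0_le_integral_any => w; first by rewrite lee_fin sqr_ge0.
rewrite -!EFinM -EFinD lee_fin !enorm_sqr !mulr_sumr -big_split /=.
apply: ler_sum => i _; rewrite !mxE; apply: le_trans (sqrD_le _ _) _.
by rewrite sqrrN.
Qed.

Lemma enorm_mean_le Y (c : R) : vmeasurable Y -> (second_moment Y <= c%:E)%E ->
  enorm (mean P Y) ^+ 2 <= c.
Proof.
move=> mY Yc; rewrite -lee_fin; apply: le_trans Yc.
rewrite second_momentE// enorm_sqr -sumEFin; apply: lee_sum => i _; rewrite mxE.
have [soo|] := ltP (sqnorm P (fun w => Y w 0 i)) +oo%E; last first.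
  by rewrite leye_eq => /eqP ->; rewrite leey.
have L2i : L2 P (fun w => Y w 0 i) by split.
have := @sqr_mean_le _ _ _ P _ (ip P (fun w => Y w 0 i) (fun w => Y w 0 i)) (mY i).
by rewrite (sqnormE L2i) lee_fin; exact.
Qed.

Lemma enorm_meanB_le Y Z (c : R) : vmeasurable Y -> vmeasurable Z ->
  (second_moment Y < +oo)%E -> (second_moment Z < +oo)%E ->
  (second_moment (fun w => Y w - Z w)%R <= c%:E)%E ->
  enorm (mean P Y - mean P Z) ^+ 2 <= c.
Proof.
move=> mY mZ Yoo Zoo; rewrite (_ : mean P Y - mean P Z = mean P (fun w => Y w - Z w)).
  by apply: enorm_mean_le; exact: vmeasurableB.
apply/rowP => i; rewrite !mxE -RintegralB//.
- by apply: eq_Rintegral => w _; rewrite !mxE.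
- by apply: L2_integrable; exact: second_moment_L2.
- by apply: L2_integrable; exact: second_moment_L2.
Qed.

(** Tonelli is applied to the positive and negative parts; the real part of their difference is
    measurable whether or not the integrals are finite. *)
Lemma measurable_Rintegral_fst (f : O * R -> R) : measurable_fun setT f ->
  measurable_fun setT (fun s => \int[P]_w f (w, s)).
Proof.
move=> mf; have mEf : measurable_fun setT (fun q => (f q)%:E) by exact/measurable_EFinP.
have mp := @measurable_fun_fubini_tonelli_G _ _ _ _ _ P _
  (measurable_funepos mEf) (fun q => funepos_ge0 _ q).
have mn := @measurable_fun_fubini_tonelli_G _ _ _ _ _ P _
  (measurable_funeneg mEf) (fun q => funeneg_ge0 _ q).
have := measurableT_comp (fine_measurable measurableT) (emeasurable_funB mp mn).
rewrite (_ : _ \o _ = (fun s => \int[P]_w f (w, s)))//.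
apply/funext => s; rewrite /Rintegral integralE /=; congr (fine (_ - _)%E).
  by apply: eq_integral => w _; rewrite !funeposE.
by apply: eq_integral => w _; rewrite !funenegE.
Qed.

Lemma affine_moment_le (h : O -> R) (a c S : R) Y : 0 <= a -> 0 <= c ->
  vmeasurable Y -> (second_moment Y <= S%:E)%E ->
  (forall w, 0 <= h w) -> (forall w, h w <= a + c * enorm (Y w) ^+ 2) ->
  (\int[P]_w (h w)%:E <= (a + c * S)%:E)%E.
Proof.
move=> a0 c0 mY YS h0 hY.
have mE : measurable_fun setT (fun w => (enorm (Y w) ^+ 2)%:E).
  by apply/measurable_EFinP; exact: measurable_enorm_sqr.
apply: (@le_trans _ _ (\int[P]_w (a%:E + c%:E * (enorm (Y w) ^+ 2)%:E))%E).
  apply: ge0_le_integral_any => w; first by rewrite lee_fin.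
  by rewrite -EFinM -EFinD lee_fin.
rewrite ge0_integralD//; last 2 first.
- by move=> w _; rewrite -EFinM lee_fin mulr_ge0// sqr_ge0.
- exact: measurable_funeM.
rewrite ge0_integralZl//; last by move=> w _; rewrite lee_fin sqr_ge0.
rewrite EFinD EFinM; apply: leeD; last by rewrite lee_wpmul2l// lee_fin.
rewrite (_ : (\int[P]_w a%:E)%E = a%:E)//.
transitivity (a%:E * P setT)%E; last by rewrite probability_setT mule1.
exact: (@integral_cst _ _ _ P setT measurableT a%:E).
Qed.

(** The pathwise splitting into drift a, Brownian parts D and jump part j; its weights 2, 4 times a
    power of 2, and 4 reappear in all later constants. *)
Lemma three_sqr_le n (a j : R) (D : 'I_n -> R) :
  (a + \sum_m D m + j) ^+ 2 <=
  2 * a ^+ 2 + 4 * (2 ^ size (index_enum 'I_n))%:R * \sum_m D m ^+ 2 + 4 * j ^+ 2.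
Proof.
have h1 := sqrD_le a (\sum_m D m + j); have h2 := sqrD_le (\sum_m D m) j.
have := sqr_sum_le (index_enum 'I_n) D; rewrite addrA in h1; lra.
Qed.

Lemma integral_combination_le n (c1 c2 c3 a m j : R) (A J : O -> \bar R)
    (D : 'I_n -> O -> \bar R) : 0 <= c1 -> 0 <= c2 -> 0 <= c3 ->
  measurable_fun setT A -> (forall w, (0 <= A w)%E) -> (\int[P]_w A w <= a%:E)%E ->
  (forall l, measurable_fun setT (D l)) -> (forall l w, (0 <= D l w)%E) ->
  (forall l, (\int[P]_w D l w <= m%:E)%E) ->
  measurable_fun setT J -> (forall w, (0 <= J w)%E) -> (\int[P]_w J w <= j%:E)%E ->
  let f w := (c1%:E * A w + c2%:E * (\sum_l D l w) + c3%:E * J w)%E in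
  [/\ measurable_fun setT f, forall w, (0 <= f w)%E &
   (\int[P]_w f w <= (c1 * a + c2 * (n%:R * m) + c3 * j)%:E)%E].
Proof.
move=> c10 c20 c30 mA A0 Aa mD D0 Dm mJ J0 Jj f.
have mS : measurable_fun setT (fun w => \sum_l D l w)%E by exact: emeasurable_sum.
have S0 w : (0 <= \sum_l D l w)%E by apply: sume_ge0 => l _; exact: D0.
have m1 := measurable_funeM c1%:E mA; have m2 := measurable_funeM c2%:E mS.
have m3 := measurable_funeM c3%:E mJ.
have p1 w : (0 <= c1%:E * A w)%E by rewrite mule_ge0.
have p2 w : (0 <= c2%:E * (\sum_l D l w))%E by rewrite mule_ge0.
have p3 w : (0 <= c3%:E * J w)%E by rewrite mule_ge0.
split.
- by apply: emeasurable_funD => //; exact: emeasurable_funD.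
- by move=> w; rewrite !adde_ge0.
rewrite /f ge0_integralD//; [|by move=> w _; rewrite adde_ge0|exact: emeasurable_funD].
rewrite ge0_integralD// !ge0_integralZl// ge0_integral_sum// !EFinD !EFinM.
apply: leeD; last by rewrite lee_wpmul2l// lee_fin.
apply: leeD; first by rewrite lee_wpmul2l// lee_fin.
rewrite lee_wpmul2l// ?lee_fin//; apply: (@le_trans _ _ (\sum_(l < n) m%:E)%E).
  by apply: lee_sum => l _; exact: Dm.
by rewrite sumEFin sumr_const card_ord -EFinM mulr_natl.
Qed.

End vector_moments.

Section energies.
Context {R : realType} {e1 e2 : measure_display}
  {O1 : measurableType e1} {O2 : measurableType e2}
  (P : probability (O1 * O2)%type R).
Local Notation O := (O1 * O2)%type.
Local Notation delta1 :=
  (\d_(1 : measurableTypeR R) : {finite_measure set (measurableTypeR R) -> \bar R}).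

(** With a unit mass as mark measure the energy of the drift becomes a norm of the same kind as for
    the noises, and the same grid estimates apply. *)
Lemma path_energy (f : O * R -> R) : measurable_fun setT f ->
  measurable_fun setT (fun w => sqnorm (@lebesgue_measure R) (fun s => f (w, s))) /\
  (\int[P]_w sqnorm (@lebesgue_measure R) (fun s => f (w, s)) =
   sqnorm (product_measure P (@lebesgue_measure R) \x delta1) (fun p => f p.1))%E.
Proof.
move=> mf.
have mf2 : measurable_fun setT (fun q : O * measurableTypeR R => (f q ^+ 2)%:E).
  by apply/measurable_EFinP; exact: measurable_funX.
have f20 (q : O * measurableTypeR R) : (0 <= (f q ^+ 2)%:E)%E by rewrite lee_fin sqr_ge0.
split; first exact: (@measurable_fun_fubini_tonelli_F _ _ _ _ _ (@lebesgue_measure R) _ mf2 f20).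
rewrite sqnorm_triple; last exact: (measurableT_comp mf measurable_fst).
apply: eq_integral => w _; apply: eq_integral => s _ /=.
rewrite (eq_integral (cst (f (w, s) ^+ 2)%:E))// integral_cst//.
by rewrite [X in (_ * X)%E]diracT mule1.
Qed.

Lemma sqnorm_window_uniform (nu : {finite_measure set (measurableTypeR R) -> \bar R})
    (f : O * R * R -> R) (u v c Rr : R) :
  measurable_fun setT f -> (nu setT <= Rr%:E)%E -> 0 <= c -> u <= v ->
  (forall s z, u < s <= v -> (\int[P]_w (f (w, s, z) ^+ 2)%:E <= c%:E)%E) ->
  (sqnorm (product_measure P (@lebesgue_measure R) \x nu)
     (fun p => f p * \1_(`]u, v]) p.1.2)%R <= (Rr * c * (v - u))%:E)%E.
Proof.
move=> mf nuR c0 uv fc.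
have m1 : measurable_fun setT (fun _ : R => 1 : R) by exact: measurable_cst.
apply: (sqnorm_window_le mf m1 _ _ c0 uv) => //.
  by rewrite (@integral_cst _ _ _ nu setT measurableT 1%E) mul1e.
by move=> s z suv; rewrite mul1r; exact: fc.
Qed.

Lemma integral_delta1 : (\int[delta1]_z 1%:E = 1 :> \bar R)%E.
Proof.
transitivity (1 * (delta1 [set: measurableTypeR R] : \bar R))%E.
  exact: (@integral_cst _ _ _ delta1 _ measurableT 1%E).
by rewrite mul1e; exact: diracT.
Qed.

End energies.

(** * Moments and mean square regularity of the solution *)

Section solution.
Context {R : realType} {e1 e2 : measure_display}
  {O1 : measurableType e1} {O2 : measurableType e2}
  (PW : probability O1 R) (PN : probability O2 R)
  (P : probability (O1 * O2)%type R).
Hypothesis P_rect : forall A1 A2, measurable A1 -> measurable A2 ->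
  P (A1 `*` A2) = (PW A1 * PN A2)%E.
Variables (T : R) (d k : nat) (W : 'I_d -> R -> O1 -> R)
  (mu : {finite_measure set (measurableTypeR R) -> \bar R})
  (N : R.-ker O2 ~> (R * R)%type).
Hypothesis T0 : 0 < T.
Hypothesis W_bm : brownian_motion PW T W.
Hypothesis N_prm : poisson_random_measure PN T mu N.
Variables (b : R -> 'rV[R]_k -> 'rV[R]_k)
  (sigma : 'I_d -> (O1 * O2)%type -> R -> 'rV[R]_k -> 'rV[R]_k -> 'rV[R]_k)
  (lam : (O1 * O2)%type -> R -> 'rV[R]_k -> R -> 'rV[R]_k -> 'rV[R]_k)
  (psi xi : 'rV[R]_k -> 'rV[R]_k) (x : 'rV[R]_k).
Hypothesis coef_meas : measurable_coefficients P T W N b sigma lam psi xi.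
Hypothesis growth : linear_growth T b sigma lam psi xi.
Variable X : R -> (O1 * O2)%type -> 'rV[R]_k.
Hypothesis X_sol : sde_solution P T W mu N b sigma lam psi xi x X.
Local Notation O := (O1 * O2)%type.
Local Notation F := (filtration P T W N).

Lemma adapted_vmeasurable (Y : R -> O -> 'rV[R]_k) t : cadlag_adapted P T W N Y ->
  0 <= t <= T -> vmeasurable (Y t).
Proof.
move=> [aY _] tT i; apply: (mfun_measurable _ (aY i t tT)).
exact: (@filtration_measurable R e1 e2 O1 O2 PW P T d W N W_bm).
Qed.

Lemma solution_second_moment : exists2 S : R, 0 <= S &
  forall t, 0 <= t <= T -> (second_moment P (X t) <= S%:E)%E.
Proof.
have [_ Xoo _] := X_sol.
set s := (X in (X < _)%E) in Xoo.
have s0 : (0 <= s)%E.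
  apply: integral_ge0 => w _; apply: le_trans (ereal_sup_ubound _); last first.
    by exists 0 => //=; rewrite in_itv /= lexx ltW.
  by rewrite lee_fin sqr_ge0.
exists (fine s); first exact: fine_ge0.
move=> t tT; rewrite fineK; last by rewrite ge0_fin_numE.
apply: ge0_le_integral_any => w; first by rewrite lee_fin sqr_ge0.
by apply: ereal_sup_ubound; exists t => //=; rewrite in_itv.
Qed.

Lemma coordinate_jointly_measurable (Y : R -> O -> 'rV[R]_k) i :
  cadlag_adapted P T W N Y ->
  measurable_fun setT (fun q : O * R => Y q.2 q.1 0 i * \1_(`[0, T]) q.2).
Proof.
move=> cY; apply: (@right_continuous_jointly_measurable _ _ _ T (fun t w => Y t w 0 i)) => //.
  by move=> t tT; exact: adapted_vmeasurable.
by move=> w t tT; have [_ /(_ i w) [+ _]] := cY; apply.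
Qed.

Lemma drift_measurable (Y : R -> O -> 'rV[R]_k) i : cadlag_adapted P T W N Y ->
  measurable_fun setT (fun q : O * R =>
    b q.2 (mean P (Y q.2)) 0 i * Y q.2 q.1 0 i * \1_(`[0, T]) q.2).
Proof.
move=> cY; have mY j := coordinate_jointly_measurable j cY.
(* Joint measurability is known only after cutting off at [0, T]; on this interval [rho] is the mean
   of Y. *)
pose rho s : 'rV[R]_k := \row_j \int[P]_w (Y s w 0 j * \1_(`[0, T]) s).
have mrho : vmeasurable rho.
  move=> j; have := measurable_Rintegral_fst P (mY j).
  by rewrite (_ : (fun s => _) = (fun s => rho s 0 j))//; apply/funext => s; rewrite mxE.
have [mb _ _ _ _] := coef_meas.
have mD : measurable [set s : R | 0 <= s <= T].
  rewrite (_ : [set s | _] = `[0, T]%classic); first exact: measurable_itv.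
  by apply/seteqP; split => s /=; rewrite in_itv.
have mB : measurable_fun [set s : R | 0 <= s <= T] (fun s => b s (rho s) 0 i).
  apply: (@measurable_comp _ _ _ _ _ _
    [set p : R * borel_vector R k | 0 <= p.1 <= T]
    (fun p => b p.1 p.2 0 i) _ (fun s : R => (s, rho s : borel_vector R k))).
  - rewrite (_ : [set p | _] = `[0, T]%classic `*` setT).
      by apply: measurableX => //; exact: measurable_itv.
    by apply/seteqP; split => p /=; rewrite in_itv /=; [move=> ->|case].
  - by move=> _ [s sT <-].
  - exact: mb.
  - apply: measurable_funTS; apply: measurable_fun_pair => //.
    exact: measurable_borel_vector.
have mB' := (measurable_restrictT _ mD).1 mB.
rewrite (_ : (fun q => _) = (fun q : O * R =>
    ((fun s => b s (rho s) 0 i) \_ [set s : R | 0 <= s <= T]) q.2 *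
    (Y q.2 q.1 0 i * \1_(`[0, T]) q.2))).
  by apply: measurable_funM => //; exact: (measurableT_comp mB' measurable_snd).
apply/funext => q; rewrite patchE; case: ifPn => qT.
  rewrite mulrA; congr (b q.2 _ 0 i * _ * _); apply/rowP => j; rewrite !mxE.
  by apply: eq_Rintegral => w _; rewrite indicE mem_set ?mulr1//= in_itv; rewrite inE in qT.
rewrite mul0r indicE memNset ?mulr0//= in_itv /= => h.
by case/negP: qT; rewrite inE.
Qed.

Let sqr_le (a c : R) : 0 <= a -> a <= c -> a ^+ 2 <= c ^+ 2.
Proof. by move=> a0 ac; rewrite ler_pXn2r// nnegrE// (le_trans a0). Qed.

Let composed_mean_bound (g : 'rV[R]_k -> 'rV[R]_k) :
  (forall i, measurable_fun setT (fun y : borel_vector R k => g y 0 i)) ->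
  (exists C : R, forall y, enorm (g y) <= C * (1 + enorm y)) ->
  exists2 U : R, 0 <= U & forall t, 0 <= t <= T -> enorm (mean P (g \o X t)) ^+ 2 <= U.
Proof.
move=> mg [C gC]; have [S S0 XS] := solution_second_moment; have [cX _ _] := X_sol.
exists (2 * C ^+ 2 + 2 * C ^+ 2 * S).
  by have := sqr_ge0 C; nra.
move=> t tT; have mX := adapted_vmeasurable cX tT; apply: enorm_mean_le.
  by move=> i; exact: (measurableT_comp (mg i) (measurable_borel_vector mX)).
apply: (affine_moment_le (Y := X t)) => //.
- by rewrite mulr_ge0 ?sqr_ge0.
- by rewrite mulr_ge0 ?sqr_ge0.
- exact: XS.
- by move=> w; exact: sqr_ge0.
move=> w; apply: le_trans (sqr_le (enorm_ge0 _) (gC _)) _.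
rewrite exprMn; have := sqrD_le 1 (enorm (X t w)); have := sqr_ge0 C; nra.
Qed.

Let growth_sqr_le (C a y u U : R) : 0 <= a -> a <= C * (1 + y + u) -> u ^+ 2 <= U ->
  a ^+ 2 <= 4 * C ^+ 2 * (1 + U) + 4 * C ^+ 2 * y ^+ 2.
Proof.
move=> a0 aC uU; apply: le_trans (sqr_le a0 aC) _; rewrite exprMn.
have := sqr_ge0 C; have h1 := sqrD_le (1 + y) u; have h2 := sqrD_le 1 y.
have h3 : (1 + y + u) ^+ 2 <= 4 * (1 + U) + 4 * y ^+ 2.
  apply: le_trans h1 _; have := sqr_ge0 u; have := sqr_ge0 y; rewrite expr1n in h2; lra.
by move=> C0; have := ler_wpM2l C0 h3; lra.
Qed.

Lemma sigma_moment : exists2 c : R, 0 <= c & forall m i s, 0 <= s <= T ->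
  (\int[P]_w (sigma m w s (X s w) (mean P (psi \o X s)) 0%R i ^+ 2)%:E <= c%:E)%E.
Proof.
have [C [_ gs _ gpsi _]] := growth; have [_ _ _ mpsi _] := coef_meas.
have [U U0 HU] := composed_mean_bound mpsi (ex_intro _ C gpsi).
have [S S0 XS] := solution_second_moment; have [cX _ _] := X_sol.
have C0 : 0 <= 4 * C ^+ 2 by rewrite mulr_ge0 ?sqr_ge0.
exists (4 * C ^+ 2 * (1 + U) + 4 * C ^+ 2 * S).
  by rewrite addr_ge0// mulr_ge0// addr_ge0.
move=> m i s sT; apply: (affine_moment_le (Y := X s)) => //.
- by rewrite mulr_ge0// addr_ge0.
- exact: adapted_vmeasurable.
- exact: XS.
- by move=> w; exact: sqr_ge0.
move=> w; apply: le_trans (coord_le_enorm _ _) _.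
apply: (growth_sqr_le (enorm_ge0 _) (gs m w s _ _ sT)).
exact: HU.
Qed.

Lemma lam_moment : exists2 c : R, 0 <= c & forall i s z, 0 <= s <= T -> z != 0 ->
  (\int[P]_w (lam w s (X s w) z (mean P (xi \o X s)) 0%R i ^+ 2)%:E <= c%:E)%E.
Proof.
have [C [_ _ gl _ gxi]] := growth; have [_ _ _ _ mxi] := coef_meas.
have [U U0 HU] := composed_mean_bound mxi (ex_intro _ C gxi).
have [S S0 XS] := solution_second_moment; have [cX _ _] := X_sol.
have C0 : 0 <= 4 * C ^+ 2 by rewrite mulr_ge0 ?sqr_ge0.
exists (4 * C ^+ 2 * (1 + U) + 4 * C ^+ 2 * S).
  by rewrite addr_ge0// mulr_ge0// addr_ge0.
move=> i s z sT z0; apply: (affine_moment_le (Y := X s)) => //.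
- by rewrite mulr_ge0// addr_ge0.
- exact: adapted_vmeasurable.
- exact: XS.
- by move=> w; exact: sqr_ge0.
move=> w; apply: le_trans (coord_le_enorm _ _) _.
apply: (growth_sqr_le (enorm_ge0 _) (gl w s _ z _ sT z0)).
exact: HU.
Qed.

Lemma drift_bound : exists2 B : R, 0 <= B & forall s i, 0 <= s <= T ->
  (b s (mean P (X s)) 0 i) ^+ 2 <= B.
Proof.
have [C [gb _ _ _ _]] := growth; have [cX _ _] := X_sol.
have [S S0 XS] := solution_second_moment.
exists (2 * C ^+ 2 * (1 + S)); first by have := sqr_ge0 C; nra.
move=> s i sT; apply: le_trans (coord_le_enorm _ _) _.
apply: le_trans (sqr_le (enorm_ge0 _) (gb s _ sT)) _; rewrite exprMn.
have := enorm_mean_le (adapted_vmeasurable cX sT) (XS s sT).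
have := sqrD_le 1 (enorm (mean P (X s))); rewrite expr1n => h1 h2.
have h3 : (1 + enorm (mean P (X s))) ^+ 2 <= 2 * (1 + S) by lra.
by have := ler_wpM2l (sqr_ge0 C) h3; lra.
Qed.

Let F_mono := @filtration_mono R e1 e2 O1 O2 P T d W N.
Let F_meas := @filtration_measurable R e1 e2 O1 O2 PW P T d W N W_bm.

Lemma brownian_isint_window m (f : O * R * R -> R) I (u v c : R) :
  brownian_isint P T W N m f I -> 0 <= u -> u <= v -> v <= T -> 0 <= c ->
  (forall s z, u < s <= v -> (\int[P]_w (f (w, s, z) ^+ 2)%:E <= c%:E)%E) ->
  (sqnorm P (fun w => I v w - I u w)%R <= (4 * c * (v - u))%:E)%E.
Proof.
move=> iI u0 uv vT c0 fc; have [mf _ _] := iI.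
have cm (A : set R) : [set: R] = A -> measurable A by move=> <-.
apply: le_trans (isint_isometry F_mono F_meas cm (brownian_noiseP P_rect N W_bm m)
  iI u0 uv vT) _.
rewrite -mulrA EFinM; apply: lee_wpmul2l; first by rewrite lee_fin.
rewrite -[c]mul1r; apply: sqnorm_window_uniform => //.
by rewrite -[leLHS]/(\d_(1 : measurableTypeR R) setT : \bar R) diracT.
Qed.

Lemma poisson_isint_window (f : O * R * R -> R) I (u v c : R) :
  poisson_isint P T W mu N f I -> 0 <= u -> u <= v -> v <= T -> 0 <= c ->
  (forall s z, u < s <= v -> (\int[P]_w (f (w, s, z) ^+ 2)%:E <= c%:E)%E) ->
  (sqnorm P (fun w => I v w - I u w)%R <=
    (4 * (fine (mu setT) * c * (v - u)))%:E)%E.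
Proof.
move=> iI u0 uv vT c0 fc; have [mf _ _] := iI.
have cm (A : set R) : mark_cell A -> measurable A by case.
apply: le_trans (isint_isometry F_mono F_meas cm (poisson_noiseP P_rect W_bm N_prm)
  iI u0 uv vT) _.
rewrite EFinM; apply: lee_wpmul2l; first by rewrite lee_fin.
by apply: sqnorm_window_uniform => //; rewrite fineK//; exact: fin_num_measure.
Qed.

Lemma sde_increments (u v : R) (I : 'I_d -> 'I_k -> R -> O -> R) (J : 'I_k -> R -> O -> R) w :
  (forall t, 0 <= t <= T -> forall i,
            X t w 0 i = x 0 i
              + \int[lebesgue_measure]_(s in `[0, t])
                  cmul (b s (mean P (X s))) (X s w) 0 i
              + \sum_m I m i t w + J i t w) ->
  0 <= u -> u <= v -> v <= T -> forall i,
  X v w 0 i - X u w 0 i =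
  (\int[lebesgue_measure]_(s in `[0, v])
     (b s (mean P (X s)) 0 i * X s w 0 i * \1_(`[0, T]) s) -
   \int[lebesgue_measure]_(s in `[0, u])
     (b s (mean P (X s)) 0 i * X s w 0 i * \1_(`[0, T]) s)) +
  \sum_m (I m i v w - I m i u w) + (J i v w - J i u w).
Proof.
move=> H u0 uv vT i.
have E t : 0 <= t -> t <= T -> \int[lebesgue_measure]_(s in `[0, t])
     (b s (mean P (X s)) 0 i * X s w 0 i * \1_(`[0, T]) s) =
   \int[lebesgue_measure]_(s in `[0, t]) cmul (b s (mean P (X s))) (X s w) 0 i.
  move=> t0 tT; apply: eq_Rintegral => s; rewrite inE /= in_itv /= => /andP[s0 st].
  by rewrite mxE indicE mem_set ?mulr1//= in_itv /= s0 (le_trans st).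
have v0 := le_trans u0 uv; have uT := le_trans uv vT.
rewrite !E// (H v _ i) ?v0// (H u _ i) ?u0//.
by rewrite sumrB; ring.
Qed.

(** The isometry makes the noise parts linear in t - s. The drift part is quadratic, and (t - s)^2
    <= T (t - s). *)
Lemma solution_increment : exists2 c : R, 0 <= c & forall s t, 0 <= s -> s <= t -> t <= T ->
  (second_moment P (fun w => X t w - X s w)%R <= (c * (t - s))%:E)%E.
Proof.
have [S S0 XS] := solution_second_moment; have [B B0 bB] := drift_bound.
have [cs cs0 sM] := sigma_moment; have [cl cl0 lM] := lam_moment.
have [cX _ [I [J [HI HJ HX]]]] := X_sol.
pose D : R := (2 ^ size (index_enum 'I_d))%:R.
have D0 : 0 <= D by [].
have mu0 : 0 <= fine (mu setT) by exact: fine_ge0.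
pose ci := 2 * T * (B * S) + 4 * D * (d%:R * (4 * cs)) + 4 * (4 * (fine (mu setT) * cl)).
have ci0 : 0 <= ci.
  by rewrite !addr_ge0 ?mulr_ge0// ltW.
exists (k%:R * ci); first by rewrite mulr_ge0.
move=> s t s0 st tT; have sT := le_trans st tT; have t0 := le_trans s0 st.
have mX r : 0 <= r <= T -> vmeasurable (X r) by exact: adapted_vmeasurable.
have sT' : 0 <= s <= T by rewrite s0.
have tT' : 0 <= t <= T by rewrite t0.
rewrite second_momentE; last by apply: vmeasurableB; exact: mX.
suff H i : (sqnorm P (fun w => (X t w - X s w) 0 i)%R <= (ci * (t - s))%:E)%E.
  apply: (@le_trans _ _ (\sum_(i < k) (ci * (t - s))%:E)%E); first exact: lee_sum.
  by rewrite sumEFin sumr_const card_ord -mulrA mulr_natl.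
pose G (q : O * R) := b q.2 (mean P (X q.2)) 0 i * X q.2 q.1 0 i * \1_(`[0, T]) q.2.
have mG : measurable_fun setT G by exact: drift_measurable.
have mi (u v : R) : measurable_fun setT (fun q : O * R => \1_(`]u, v]) q.2 : R).
  have : measurable_fun setT (\1_(`]u, v]) : R -> R).
    by apply: measurable_indic; exact: measurable_itv.
  by move=> m1; exact: (measurableT_comp m1 measurable_snd).
have GE r : 0 <= r <= T -> (\int[P]_w (G (w, r) ^+ 2)%:E <= (B * S)%:E)%E.
  move=> rT; have := @affine_moment_le _ _ _ P _ (fun w => G (w, r) ^+ 2) 0 B S (X r) (lexx 0) B0.
  rewrite add0r; apply; [exact: mX|exact: XS|by move=> w; exact: sqr_ge0|].
  move=> w; rewrite add0r /G /= indicE mem_set; last by rewrite /= in_itv.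
  rewrite mulr1 exprMn; apply: ler_pM; rewrite ?sqr_ge0//; first exact: bB.
  exact: coord_le_enorm.
pose E u v w := sqnorm (@lebesgue_measure R) (fun r : R => G (w, r) * \1_(`]u, v]) r).
have EP u v : 0 <= u -> u <= v -> v <= T -> measurable_fun setT (E u v) /\
    (\int[P]_w E u v w <= (B * S * (v - u))%:E)%E.
  move=> u0 uv vT; have mGuv := measurable_funM mG (mi u v).
  have [H1 H2] := path_energy P mGuv; split => //.
  have mG1 : measurable_fun setT (fun p : O * R * R => G p.1).
    exact: (measurableT_comp mG measurable_fst).
  have H3 := @sqnorm_window_uniform _ _ _ _ _ P
    (\d_(1 : measurableTypeR R) : {finite_measure set _ -> \bar R})
    (fun p => G p.1) u v (B * S) 1 mG1.
  rewrite mul1r in H3; move: H3; rewrite -H2; apply => //.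
  - by rewrite -[leLHS]/(\d_(1 : measurableTypeR R) setT : \bar R) diracT.
  - exact: mulr_ge0.
  move=> r z /andP[ur rv]; apply: GE.
  by rewrite (le_trans u0 (ltW ur)) (le_trans rv).
have [mET ET] := EP 0 T (lexx 0) (ltW T0) (lexx T).
have [mE Est] := EP s t s0 st tT.
(* Subtracting two drift integrals as inner products needs finite energy of the path on [0, T];
   finite expected energy gives it for almost every w. *)
have Efin : {ae P, forall w, (E 0%R T w < +oo)%E}.
  have iE : P.-integrable setT (E 0 T).
    apply/integrableP; split => //; apply: le_lt_trans (ltry (B * S * (T - 0))).
    apply: le_trans ET; rewrite le_eqVlt; apply/orP; left; apply/eqP.
    by apply: eq_integral => w _; rewrite gee0_abs// sqnorm_ge0.
  have := integrable_ae measurableT iE; apply: filterS => w /(_ Logic.I).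
  by rewrite ge0_fin_numE// sqnorm_ge0.
pose DI m w := I m i t w - I m i s w; pose DJ w := J i t w - J i s w.
have cl_s : clamp 0 T s = s by apply: clamp_id.
have cl_t : clamp 0 T t = t by apply: clamp_id.
have incE (V : R -> O -> R) : (fun w => V (clamp 0 T t) w - V 0 w - (V (clamp 0 T s) w - V 0 w)) =
    (fun w => V t w - V s w).
  by apply/funext => w; rewrite cl_s cl_t; ring.
have IP m : (sqnorm P (DI m) <= (4 * cs * (t - s))%:E)%E.
  have [iI _] := brownian_integral_isint P_rect W_bm (lexx 0) (ltW T0) (lexx T) (HI m i).
  rewrite /DI -(incE (I m i)); apply: (brownian_isint_window iI) => // r z /andP[sr rt].
  have rT : 0 <= r <= T by rewrite (le_trans s0 (ltW sr)) (le_trans rt).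
  apply: le_trans (sM m i r rT); apply: ge0_le_integral_any => w; first by rewrite lee_fin sqr_ge0.
  by rewrite /= indic_oc (le_lt_trans s0 sr) (le_trans rt tT) mulr1.
have JP : (sqnorm P DJ <= (4 * (fine (mu setT) * cl * (t - s)))%:E)%E.
  have [iJ _] := poisson_integral_isint P_rect W_bm N_prm (lexx 0) (ltW T0) (lexx T) (HJ i).
  rewrite /DJ -(incE (J i)); apply: (poisson_isint_window iJ) => // r z /andP[sr rt].
  have rT : 0 <= r <= T by rewrite (le_trans s0 (ltW sr)) (le_trans rt).
  (* The moment bound for [lam] is stated for nonzero marks; at z = 0 the indicator kills the
     integrand. *)
  have [z0|z0] := eqVneq z 0.
    apply: (@le_trans _ _ 0%E); last by rewrite lee_fin.
    rewrite -[leRHS](integral0 P setT); apply: ge0_le_integral_any => w.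
      by rewrite lee_fin sqr_ge0.
    by rewrite /= z0 [X in _ * X]indicE memNset ?mulr0 ?expr0n//=; move=> /eqP.
  apply: le_trans (lM i r z rT z0); apply: ge0_le_integral_any => w; first by rewrite lee_fin sqr_ge0.
  rewrite /= indic_oc (le_lt_trans s0 sr) (le_trans rt tT) mulr1.
  by rewrite indicE mem_set// mulr1.
have mDI m : measurable_fun setT (DI m).
  have [iI _] := brownian_integral_isint P_rect W_bm (lexx 0) (ltW T0) (lexx T) (HI m i).
  rewrite /DI -(incE (I m i)); apply: measurable_funB.
    exact: (isint_adapted F_mono F_meas (brownian_noiseP P_rect N W_bm m) iI tT').2.1.
  exact: (isint_adapted F_mono F_meas (brownian_noiseP P_rect N W_bm m) iI sT').2.1.
have mDJ : measurable_fun setT DJ.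
  have [iJ _] := poisson_integral_isint P_rect W_bm N_prm (lexx 0) (ltW T0) (lexx T) (HJ i).
  rewrite /DJ -(incE (J i)); apply: measurable_funB.
    exact: (isint_adapted F_mono F_meas (poisson_noiseP P_rect W_bm N_prm) iJ tT').2.1.
  exact: (isint_adapted F_mono F_meas (poisson_noiseP P_rect W_bm N_prm) iJ sT').2.1.
have c10 : 0 <= 2 * (t - s) by rewrite mulr_ge0// subr_ge0.
have c20 : 0 <= 4 * D by rewrite mulr_ge0.
have [mf f0 fle] := @integral_combination_le _ _ _ P d (2 * (t - s)) (4 * D) 4
  (B * S * (t - s)) (4 * cs * (t - s)) (4 * (fine (mu setT) * cl * (t - s)))
  (E s t) (fun w => (DJ w ^+ 2)%:E) (fun m w => (DI m w ^+ 2)%:E) c10 c20 (ler0n R 4)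
  mE (fun w => sqnorm_ge0 _ _) Est (fun m => measurable_sqE (mDI m))
  (fun m w => sqr_ge0 (DI m w)) IP (measurable_sqE mDJ) (fun w => sqr_ge0 (DJ w)) JP.
apply: le_trans (ae_le_integral_any _ f0 mf _) (le_trans fle _).
- by move=> w; rewrite lee_fin sqr_ge0.
- move: HX Efin; apply: filterS2 => w HX Ew; rewrite !mxE (sde_increments HX s0 st tT).
  apply: (@le_trans _ _ (2 * (\int[lebesgue_measure]_(r in `[0, t]) G (w, r) -
     \int[lebesgue_measure]_(r in `[0, s]) G (w, r)) ^+ 2 +
     4 * D * (\sum_m DI m w ^+ 2) + 4 * DJ w ^+ 2)%:E).
    by rewrite lee_fin; exact: three_sqr_le.
  rewrite !EFinD; apply: leeD; last by rewrite EFinM.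
  apply: leeD; last by rewrite EFinM sumEFin.
  rewrite EFinM [X in (_ <= X * _)%E]EFinM -muleA lee_wpmul2l//.
  apply: (@drift_increment _ (fun r => G (w, r)) s t T) => //.
  exact: (measurableT_comp mG (measurable_fun_pair (measurable_cst w) (@measurable_id _ _ setT))).
rewrite lee_fin /ci; have ts : 0 <= t - s by rewrite subr_ge0.
have h : (t - s) * (t - s) <= T * (t - s) by apply: ler_wpM2r => //; lra.
have := ler_wpM2l (mulr_ge0 B0 S0) h; lra.
Qed.

End solution.

Section maximal_inequality_for_integrals.
Context {d : measure_display} {O : measurableType d} {R : realType}
  (P : probability O R) (T : R).
Variable F : R -> set (set O).
Hypothesis F_mono : forall s t, s <= t -> F s `<=` F t.
Hypothesis F_meas : forall t, F t `<=` measurable.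
Variable nu : {finite_measure set (measurableTypeR R) -> \bar R}.
Variable cell : set R -> Prop.
Hypothesis cell_meas : forall A, cell A -> measurable A.
Variable M : set R -> R -> O -> R.
Hypothesis M_noise : noise P T F nu cell M.
Local Notation Q := (product_measure P (@lebesgue_measure R) \x nu)%E.

(** The constant is 32 = 8 * 4, from the maximal inequality and from the isometry of L^2-limits. *)
Lemma isint_maximal (f : O * R * R -> R) (I : R -> O -> R) (u s : R) :
  isint P T F nu cell M f I -> 0 <= u -> u <= T -> (forall w, I 0 w = 0) ->
  (forall w t, 0 <= t < u -> I r w @[r --> t^'+] --> I t w) ->
  (sqnorm Q (fun p => f p * \1_(`]0%R, u]) p.1.2)%R <= s%:E)%E ->
  exists Z : O -> \bar R, [/\ measurable_fun setT Z, forall w, (0 <= Z w)%E,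
    forall w t, 0 <= t <= u -> ((I t w ^+ 2)%:E <= Z w)%E &
    (\int[P]_w Z w <= (32 * s)%:E)%E].
Proof.
move=> iI u0 uT I0 rc fs.
have aI : adapted_L2 P F u I.
  move=> t /andP[t0 tu]; apply: (isint_adapted F_mono F_meas M_noise iI).
  by rewrite t0 (le_trans tu).
have mI : martingale P F u I.
  move=> r t r0 rt tu; apply: (isint_martingale F_mono F_meas M_noise iI) => //.
  exact: le_trans tu uT.
have [Z [mZ IZ Zle]] := maximal_inequality F_mono F_meas u0 aI mI rc.
exists Z; split => //.
  by move=> w; apply: le_trans (IZ w 0 _); rewrite ?lee_fin ?sqr_ge0// lexx.
apply: le_trans Zle _; rewrite (_ : 32 * s = 8 * (4 * s)); last by ring.
rewrite [leRHS]EFinM lee_wpmul2l//; apply: le_trans (_ : _ <= 4%:E * s%:E)%E _ => //.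
rewrite (_ : I u = fun w => I u w - I 0 w); last by apply/funext => w; rewrite I0 subr0.
apply: le_trans (isint_isometry F_mono F_meas cell_meas M_noise iI (lexx 0) u0 uT) _.
by rewrite lee_wpmul2l.
Qed.

End maximal_inequality_for_integrals.

Lemma grid_cell_sum {R : realType} (g c : nat -> R) J l s :
  (forall i, (i < J)%N -> g i <= g i.+1) -> (l < J)%N -> g l < s <= g l.+1 ->
  \sum_(i < J) c i * \1_(`]g i, g i.+1]) s = c l.
Proof.
move=> gle lJ sl; rewrite (bigD1 (Ordinal lJ))//= indic_oc sl mulr1 big1 ?addr0// => i il.
rewrite indic_oc; case: (boolP (_ && _)) => si; last by rewrite mulr0.
case/eqP: il; apply: val_inj => /=; move: sl si => /andP[s1 s2] /andP[s3 s4].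
apply/eqP; rewrite eqn_leq; apply/andP; split; rewrite leqNgt; apply/negP => li.
  have := grid_mono gle li (ltnW (ltn_ord i)); have := le_lt_trans s2 (_ : g l.+1 < s).
  by move=> H gg; have := H (le_lt_trans gg s3); rewrite ltxx.
have gg := grid_mono gle li (ltnW lJ).
by have := lt_le_trans s1 (le_trans s4 gg); rewrite ltxx.
Qed.

Lemma ae_forall_ord {d} {O : measurableType d} {R : realType} (m : {measure set O -> \bar R})
    n (A : 'I_n -> O -> Prop) :
  (forall i, {ae m, forall w, A i w}) -> {ae m, forall w, forall i, A i w}.
Proof.
move=> H; have : {ae m, forall w, forall (j : nat) (i : 'I_n), i = j :> nat -> A i w}.
  apply: ae_foralln => j; have [[i0 i0j]|nj] := pselect (exists i : 'I_n, i = j :> nat).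
    apply: filterS (H i0) => w Hw i ij; rewrite (_ : i = i0)//.
    by apply: val_inj; rewrite /= ij i0j.
  by apply: nearW => w i ij; case: nj; exists i.
by apply: filterS => w Hw i; exact: Hw erefl.
Qed.

Lemma measurable_nonzero_mark {R : realType} : measurable (@nonzero_mark R).
Proof.
rewrite (_ : nonzero_mark = ~` [set 0]); first exact: measurableC.
by apply/seteqP; split => z /= /eqP.
Qed.

(** * Error of the Euler scheme *)

Section euler.
Context {R : realType} {e1 e2 : measure_display}
  {O1 : measurableType e1} {O2 : measurableType e2}
  (PW : probability O1 R) (PN : probability O2 R)
  (P : probability (O1 * O2)%type R).
Hypothesis P_rect : forall A1 A2, measurable A1 -> measurable A2 ->
  P (A1 `*` A2) = (PW A1 * PN A2)%E.
Variables (T : R) (d k : nat) (W : 'I_d -> R -> O1 -> R)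
  (mu : {finite_measure set (measurableTypeR R) -> \bar R})
  (N : R.-ker O2 ~> (R * R)%type).
Hypothesis T0 : 0 < T.
Hypothesis W_bm : brownian_motion PW T W.
Hypothesis N_prm : poisson_random_measure PN T mu N.
Variables (b : R -> 'rV[R]_k -> 'rV[R]_k)
  (sigma : 'I_d -> (O1 * O2)%type -> R -> 'rV[R]_k -> 'rV[R]_k -> 'rV[R]_k)
  (lam : (O1 * O2)%type -> R -> 'rV[R]_k -> R -> 'rV[R]_k -> 'rV[R]_k)
  (psi xi : 'rV[R]_k -> 'rV[R]_k) (x : 'rV[R]_k).
Hypothesis coef_meas : measurable_coefficients P T W N b sigma lam psi xi.
Hypothesis growth : linear_growth T b sigma lam psi xi.
Variables (K : R) (vrho : R -> R).
Hypothesis K0 : 0 < K.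
Hypothesis vrho_int : mu.-integrable nonzero_mark (fun z => (vrho z `^ 1)%:E).
Hypothesis coef_lip : process_lipschitz P T W N sigma lam psi xi K vrho.
Variable L : R.
Hypothesis b_lip : forall t s y u, 0 <= t <= T -> 0 <= s <= T ->
  enorm (b t y - b s u) <= L * (`|t - s| + enorm (y - u)).
Variable X : R -> (O1 * O2)%type -> 'rV[R]_k.
Hypothesis X_sol : sde_solution P T W mu N b sigma lam psi xi x X.
Local Notation O := (O1 * O2)%type.
Local Notation F := (filtration P T W N).
Let F_mono := @filtration_mono R e1 e2 O1 O2 P T d W N.
Let F_meas := @filtration_measurable R e1 e2 O1 O2 PW P T d W N W_bm.

Let X_ca : cadlag_adapted P T W N X. Proof. by case: X_sol. Qed.

Let mX t : 0 <= t <= T -> vmeasurable (X t).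
Proof. exact: (adapted_vmeasurable W_bm X_ca). Qed.

Section gap.
Variables (Y : R -> O -> 'rV[R]_k) (s r q : R).
Hypothesis Y_ca : cadlag_adapted P T W N Y.
Hypothesis s_itv : 0 <= s <= T.
Hypothesis r_itv : 0 <= r <= T.
Hypothesis Y_fin : forall t, 0 <= t <= r -> (second_moment P (Y t) < +oo)%E.
Hypothesis gap_le : (second_moment P (fun w => X s w - Y r w)%R <= q%:E)%E.

Let mY t : 0 <= t <= T -> vmeasurable (Y t).
Proof. exact: (adapted_vmeasurable W_bm Y_ca). Qed.

Let q0 : 0 <= q.
Proof. by rewrite -lee_fin; apply: le_trans gap_le; exact: second_moment_ge0. Qed.

(* The Lipschitz hypothesis is about processes square integrable on all of [0, T]; during
   the induction this is known for Y only up to the current grid point. *)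
Let stopped t w := Y (Num.min t r) w.

Let stopped_r : stopped r = Y r.
Proof. by apply/funext => w; rewrite /stopped minxx. Qed.

Let stopped_si : square_integrable_process P T W N stopped.
Proof.
have /andP[r0 rT] := r_itv.
have minP t : 0 <= t <= T -> 0 <= Num.min t r <= r.
  by move=> /andP[t0 tT]; rewrite le_min t0 r0 ge_min lexx orbT.
split => [i t tT|t tT]; last by apply: Y_fin; exact: minP.
have [aY _] := Y_ca; have /andP[m0 mr] := minP t tT.
apply: (mfun_mono F_mono (s := Num.min t r)); first by rewrite ge_min lexx.
by apply: aY; rewrite m0 (le_trans mr).
Qed.

Let X_si : square_integrable_process P T W N X.
Proof.
split; first exact: X_ca.1.
have [S S0 XS] := solution_second_moment T0 X_sol.
by move=> t tT; exact: le_lt_trans (XS t tT) (ltry _).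
Qed.

Let mgap : vmeasurable (fun w => X s w - Y r w).
Proof. by apply: vmeasurableB; [exact: mX|exact: mY]. Qed.

(** The factor 2 counts the pathwise distance, whose mean is at most q, and its expectation, which
    enters through the laws in the coefficients. *)
Let gap_expectation (h : O -> R) (c : R) : 0 <= c -> (forall w, 0 <= h w) ->
  {ae P, forall w, h w <= c * distance2 P X stopped s r w} ->
  (\int[P]_w (h w)%:E <= (c * ((s - r) ^+ 2 + 2 * q))%:E)%E.
Proof.
move=> c0 h0 hle.
have intle : \int[P]_v (enorm (X s v - stopped r v) ^+ 2) <= q.
  rewrite stopped_r -[leRHS]/(fine q%:E); apply: fine_le => //.
    rewrite ge0_fin_numE; first exact: le_lt_trans gap_le (ltry _).
    exact: second_moment_ge0.
have int0 : 0 <= \int[P]_v (enorm (X s v - stopped r v) ^+ 2).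
  by apply: Rintegral_ge0 => v _; exact: sqr_ge0.
have d0 w : 0 <= distance2 P X stopped s r w.
  by rewrite /distance2 !addr_ge0 ?sqr_ge0.
have md : measurable_fun setT (fun w => (c * distance2 P X stopped s r w)%:E).
  apply/measurable_EFinP; apply: measurable_funM => //; rewrite /distance2.
  apply: measurable_funD => //; apply: measurable_funD => //.
  by rewrite stopped_r; exact: measurable_enorm_sqr.
apply: le_trans (ae_le_integral_any (g := fun w => (c * distance2 P X stopped s r w)%:E) _ _ md _) _.
- by move=> w; rewrite lee_fin.
- by move=> w; rewrite lee_fin mulr_ge0.
- by apply: filterS hle => w hw; rewrite lee_fin.
rewrite (_ : c * _ = c * ((s - r) ^+ 2 + q) + c * q); last by ring.
apply: (affine_moment_le (Y := fun w => X s w - Y r w)) => //.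
- by rewrite mulr_ge0// addr_ge0// sqr_ge0.
- by move=> w; rewrite mulr_ge0.
move=> w; rewrite /distance2 -mulrDr ler_wpM2l// real_normK ?num_real//.
by rewrite stopped_r [leLHS]addrAC lerD2r lerD2l -{1}stopped_r.
Qed.

Lemma sigma_gap m i :
  (\int[P]_w ((sigma m w s (X s w) (mean P (psi \o X s)) 0%R i -
     sigma m w r (Y r w) (mean P (psi \o Y r)) 0%R i) ^+ 2)%:E
   <= (K * ((s - r) ^+ 2 + 2 * q))%:E)%E.
Proof.
apply: gap_expectation; [exact: ltW|by move=> w; exact: sqr_ge0|].
have [H _] := coef_lip X_si stopped_si s_itv r_itv.
apply: filterS (H m) => w; rewrite stopped_r; apply: le_trans.
by apply: le_trans (coord_le_enorm _ i); rewrite !mxE.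
Qed.

Lemma lam_gap i z : z != 0 ->
  (\int[P]_w ((lam w s (X s w) z (mean P (xi \o X s)) 0%R i -
     lam w r (Y r w) z (mean P (xi \o Y r)) 0%R i) ^+ 2)%:E
   <= (vrho z `^ 1 * ((s - r) ^+ 2 + 2 * q))%:E)%E.
Proof.
move=> z0; apply: gap_expectation; [exact: powR_ge0|by move=> w; exact: sqr_ge0|].
have [_ H] := coef_lip X_si stopped_si s_itv r_itv.
apply: filterS (H z z0) => w; rewrite stopped_r => Hw.
apply: le_trans (_ : _ <= vrho z * distance2 P X stopped s r w) _.
  by apply: le_trans Hw; apply: le_trans (coord_le_enorm _ i); rewrite !mxE.
apply: ler_wpM2r.
  rewrite /distance2 !addr_ge0 ?sqr_ge0//.
  by apply: Rintegral_ge0 => v _; exact: sqr_ge0.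
have [v0|v0] := leP 0 (vrho z); first by rewrite powRr1.
by apply: le_trans (ltW v0) (powR_ge0 _ _).
Qed.

(** The product is split as b_r (X_s - Y_r) + (b_s - b_r) X_s, with b_r taken along the scheme. Both
    coefficients are deterministic, so B bounds the first, and the Lipschitz property of b at the
    two means together with the second moment S of X bounds the other. *)
Lemma drift_gap (B S : R) i : 0 <= B -> 0 <= S -> (second_moment P (X s) <= S%:E)%E ->
  (b r (mean P (Y r)) 0 i) ^+ 2 <= B ->
  (\int[P]_w ((b s (mean P (X s)) 0%R i * X s w 0%R i -
     b r (mean P (Y r)) 0%R i * Y r w 0%R i) ^+ 2)%:E
   <= ((2 * B + 4 * L ^+ 2 * S) * ((s - r) ^+ 2 + 2 * q))%:E)%E.
Proof.
move=> B0 S0 XS bB; have /andP[r0 _] := r_itv.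
pose D := b s (mean P (X s)) 0 i - b r (mean P (Y r)) 0 i.
have Dle : D ^+ 2 <= L ^+ 2 * (2 * (s - r) ^+ 2 + 2 * q).
  apply: (@le_trans _ _ (enorm (b s (mean P (X s)) - b r (mean P (Y r))) ^+ 2)).
    by apply: le_trans (coord_le_enorm _ i); rewrite !mxE.
  apply: (@le_trans _ _ ((L * (`|s - r| + enorm (mean P (X s) - mean P (Y r)))) ^+ 2)).
    have h := b_lip (mean P (X s)) (mean P (Y r)) s_itv r_itv.
    by rewrite ler_pXn2r// nnegrE ?enorm_ge0// (le_trans (enorm_ge0 _) h).
  rewrite exprMn ler_wpM2l ?sqr_ge0//; apply: le_trans (sqrD_le _ _) _.
  rewrite real_normK ?num_real// lerD2l ler_wpM2l//.
  apply: enorm_meanB_le => //; [exact: mX|exact: mY|exact: le_lt_trans XS (ltry _)|].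
  by apply: Y_fin; rewrite r0 lexx.
have D0 := sqr_ge0 D.
pose B' := 2 * b r (mean P (Y r)) 0 i ^+ 2.
have mg : measurable_fun setT (fun w => (enorm (X s w - Y r w) ^+ 2)%:E).
  by apply/measurable_EFinP; exact: measurable_enorm_sqr.
have mXs : measurable_fun setT (fun w => (enorm (X s w) ^+ 2)%:E).
  by apply/measurable_EFinP; apply: measurable_enorm_sqr; exact: mX.
apply: (@le_trans _ _ (\int[P]_w ((2 * B)%:E * (enorm (X s w - Y r w) ^+ 2)%:E +
   (2 * D ^+ 2)%:E * (enorm (X s w) ^+ 2)%:E))%E).
  apply: ge0_le_integral_any => w; first by rewrite lee_fin sqr_ge0.
  rewrite -!EFinM -EFinD lee_fin.
  rewrite (_ : _ - _ = b r (mean P (Y r)) 0 i * (X s w 0 i - Y r w 0 i) + D * X s w 0 i); last first.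
    by rewrite /D; ring.
  apply: le_trans (sqrD_le _ _) _; rewrite !exprMn.
  have h1 := coord_le_enorm (X s w) i.
  have h2 : (X s w 0 i - Y r w 0 i) ^+ 2 <= enorm (X s w - Y r w) ^+ 2.
    by apply: le_trans (coord_le_enorm _ i); rewrite !mxE.
  have h3 := ler_pM (sqr_ge0 _) (sqr_ge0 _) bB h2; have h4 := ler_wpM2l D0 h1.
  rewrite -[X in _ <= X + _]mulrA -[X in _ <= _ + X]mulrA.
  by apply: lerD; rewrite ler_wpM2l.
rewrite ge0_integralD//; last 4 first.
- by move=> w _; apply: mule_ge0; rewrite lee_fin; [rewrite mulr_ge0|exact: sqr_ge0].
- exact: measurable_funeM.
- by move=> w _; apply: mule_ge0; rewrite lee_fin; [rewrite mulr_ge0|exact: sqr_ge0].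
- exact: measurable_funeM.
rewrite !ge0_integralZl//; try (by move=> w _; rewrite lee_fin sqr_ge0);
  try (by rewrite lee_fin mulr_ge0).
apply: (@le_trans _ _ ((2 * B)%:E * q%:E + (2 * D ^+ 2)%:E * S%:E)%E).
  by apply: leeD; apply: lee_wpmul2l => //; rewrite lee_fin mulr_ge0.
rewrite -!EFinM -EFinD lee_fin.
have h := ler_wpM2r S0 Dle; have sr := sqr_ge0 (s - r).
have h3 : 0 <= L ^+ 2 * S by rewrite mulr_ge0// sqr_ge0.
have := mulr_ge0 h3 sr; have := mulr_ge0 B0 sr; have := mulr_ge0 B0 q0.
have := mulr_ge0 h3 q0; lra.
Qed.

End gap.

Lemma second_moment_subC (U V : O -> 'rV[R]_k) :
  second_moment P (fun w => U w - V w) = second_moment P (fun w => V w - U w).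
Proof.
apply: eq_integral => w _; rewrite !enorm_sqr; congr EFin.
by apply: eq_bigr => i _; rewrite !mxE; ring.
Qed.

(** [vrho] may take negative values; its power with exponent 1 is nonnegative, dominates it and is
    integrable over the nonzero marks. *)
Let rate z : R := vrho z `^ 1 * \1_nonzero_mark z.

Let rate_bound : exists2 Rr : R, 0 <= Rr & (\int[mu]_z (rate z)%:E <= Rr%:E)%E.
Proof.
have E : (\int[mu]_z (rate z)%:E = \int[mu]_(z in nonzero_mark) (vrho z `^ 1)%:E)%E.
  rewrite [RHS]integral_mkcond; apply: eq_integral => z _.
  by rewrite patchE /rate indicE; case: ifPn; rewrite ?mulr1 ?mulr0.
have f : (\int[mu]_(z in nonzero_mark) (vrho z `^ 1)%:E)%E \is a fin_num.
  by apply: integrable_fin_num => //; exact: measurable_nonzero_mark.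
exists (fine (\int[mu]_(z in nonzero_mark) (vrho z `^ 1)%:E)%E); last by rewrite E fineK.
by apply: fine_ge0; apply: integral_ge0 => z _; rewrite lee_fin powR_ge0.
Qed.

Let rate_ge0 z : 0 <= rate z.
Proof. by rewrite /rate mulr_ge0// powR_ge0. Qed.

Let rate_measurable : measurable_fun setT rate.
Proof.
have mz := @measurable_nonzero_mark R.
have /measurable_EFinP m1 := measurable_int mu vrho_int.
have := (measurable_restrictT _ mz).1 m1.
rewrite (_ : _ \_ _ = rate)//; apply/funext => z.
by rewrite patchE /rate indicE; case: ifPn; rewrite ?mulr1 ?mulr0.
Qed.

Section scheme.
Variables (n : nat) (Y : R -> O -> 'rV[R]_k).
Hypothesis n0 : (0 < n)%N.
Hypothesis Y_eul : euler_scheme P T W mu N b sigma lam psi xi x n Y.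
Let g (j : nat) : R := j%:R * T / n%:R.
Let h : R := T / n%:R.

Let Y_ca : cadlag_adapted P T W N Y. Proof. by case: Y_eul. Qed.
Let mY t : 0 <= t <= T -> vmeasurable (Y t).
Proof. exact: (adapted_vmeasurable W_bm Y_ca). Qed.

Let n0R : (0 : R) < n%:R. Proof. by rewrite ltr0n. Qed.
Let h0 : 0 < h. Proof. by rewrite divr_gt0. Qed.
Let g0 : g 0%N = 0. Proof. by rewrite /g !mul0r. Qed.
Let gS j : g j.+1 - g j = h.
Proof. by rewrite /g /h -natr1; ring. Qed.
Let gle j : g j <= g j.+1. Proof. by rewrite -subr_ge0 gS ltW. Qed.
Let gn : g n = T. Proof. by rewrite /g mulrC mulKf// gt_eqF. Qed.
Let g_ge0 j : 0 <= g j.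
Proof. by rewrite /g divr_ge0 ?mulr_ge0// ltW. Qed.
Let gT j : (j <= n)%N -> g j <= T.
Proof. by move=> jn; rewrite -gn; apply: (grid_mono (J := n)). Qed.
Let g_itv j : (j <= n)%N -> 0 <= g j <= T.
Proof. by move=> jn; rewrite g_ge0 gT. Qed.

Variables (J : nat) (eps : nat -> R) (B S Cx : R).
Hypothesis Jn : (J <= n)%N.
Hypothesis B0 : 0 <= B.
Hypothesis S0 : 0 <= S.
Hypothesis Cx0 : 0 <= Cx.
Hypothesis XS : forall t, 0 <= t <= T -> (second_moment P (X t) <= S%:E)%E.
Hypothesis XC : forall s t, 0 <= s -> s <= t -> t <= T ->
  (second_moment P (fun w => X t w - X s w)%R <= (Cx * (t - s))%:E)%E.
Hypothesis eps0 : forall l, (l < J)%N -> 0 <= eps l.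
Hypothesis eps_le : forall l, (l < J)%N ->
  (second_moment P (fun w => X (g l) w - Y (g l) w)%R <= (eps l)%:E)%E.
Hypothesis bB : forall l i, (l < J)%N -> (b (g l) (mean P (Y (g l))) 0 i) ^+ 2 <= B.
Hypothesis Y_fin : forall l t, (l < J)%N -> 0 <= t <= g l ->
  (second_moment P (Y t) < +oo)%E.

Let ln l : (l < J)%N -> (l < n)%N. Proof. by move=> lJ; exact: leq_trans lJ Jn. Qed.

(** A bound for E|X_s - Y_{g l}|^2 on the l-th cell, obtained by inserting X_{g l}; [theta] then
    bounds the distance in the Lipschitz hypotheses, including the time difference. *)
Let q l := 2 * (Cx * h) + 2 * eps l.
Let theta l := h ^+ 2 + 2 * q l.

Let q0 l : (l < J)%N -> 0 <= q l.
Proof. by move=> /eps0 e0; rewrite /q addr_ge0 ?mulr_ge0// ltW. Qed.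

Let theta0 l : (l < J)%N -> 0 <= theta l.
Proof. by move=> lJ; rewrite /theta addr_ge0 ?sqr_ge0// mulr_ge0// q0. Qed.

Let cell_itv l s : (l < J)%N -> g l < s <= g l.+1 -> 0 <= s <= T.
Proof.
move=> lJ /andP[s1 s2]; rewrite (le_trans (g_ge0 l) (ltW s1)) (le_trans s2)//.
by apply: gT; exact: ln.
Qed.

Let cell_sqr l s : g l < s <= g l.+1 -> (s - g l) ^+ 2 <= h ^+ 2.
Proof.
move=> /andP[s1 s2]; have h1 : s - g l <= h by rewrite -(gS l) lerD2r.
by rewrite ler_pXn2r ?nnegrE ?subr_ge0// ltW.
Qed.

Let gapP l s : (l < J)%N -> g l < s <= g l.+1 ->
  (second_moment P (fun w => X s w - Y (g l) w)%R <= (q l)%:E)%E.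
Proof.
move=> lJ sl; have /andP[s1 s2] := sl; have sT := cell_itv lJ sl.
have lT := g_itv (ltnW (ln lJ)); have /andP[s0 sT'] := sT.
have := @second_momentB_le _ _ _ P k (fun w => X s w - X (g l) w)
  (fun w => Y (g l) w - X (g l) w) (vmeasurableB (mX sT) (mX lT))
  (vmeasurableB (mY lT) (mX lT)).
rewrite (_ : (fun w => X s w - X (g l) w - _) = (fun w => X s w - Y (g l) w)); last first.
  by apply/funext => w; apply/rowP => i; rewrite !mxE; ring.
move=> /le_trans; apply; rewrite (second_moment_subC (Y (g l))) /q [leRHS]EFinD; apply: leeD.
  rewrite [leRHS]EFinM lee_wpmul2l//; apply: le_trans (XC _ _ _) _ => //; first exact: ltW.
  by rewrite lee_fin ler_wpM2l// -(gS l) lerD2r.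
by rewrite [leRHS]EFinM lee_wpmul2l//; exact: eps_le.
Qed.

Let thetaP l s (c : R) : 0 <= c -> g l < s <= g l.+1 ->
  ((c * ((s - g l) ^+ 2 + 2 * q l))%:E <= (c * theta l)%:E)%E.
Proof. by move=> c0 sl; rewrite lee_fin ler_wpM2l// lerD2r; exact: cell_sqr sl. Qed.

Let Y_fin' l : (l < J)%N -> forall t, 0 <= t <= g l -> (second_moment P (Y t) < +oo)%E.
Proof. by move=> lJ t; exact: Y_fin. Qed.

Let Theta := \sum_(l < J) theta l * h.

Let ThetaE (c : nat -> R) (c0 : R) : (forall l, c l = c0 * theta l) ->
  \sum_(l < J) c l * (g l.+1 - g l) = c0 * Theta.
Proof.
by move=> cE; rewrite /Theta mulr_sumr; apply: eq_bigr => l _; rewrite cE gS mulrA.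
Qed.

Section coordinate.
Variable i : 'I_k.
Let G (p : O * R) := b p.2 (mean P (X p.2)) 0 i * X p.2 p.1 0 i * \1_(`[0, T]) p.2.
Let c l w := b (g l) (mean P (Y (g l))) 0 i * Y (g l) w 0 i.
Let gap (p : O * R) :=
  (G p - \sum_(l < J) c l p.1 * \1_(`]g l, g l.+1]) p.2) * \1_(`]0, g J]) p.2.

Let mi (u v : R) : measurable_fun setT (fun p : O * R => \1_(`]u, v]) p.2 : R).
Proof.
have m1 : measurable_fun setT (\1_(`]u, v]) : R -> R).
  by apply: measurable_indic; exact: measurable_itv.
exact: (measurableT_comp m1 measurable_snd).
Qed.

Let mG : measurable_fun setT G.
Proof. exact: (drift_measurable T0 W_bm coef_meas i X_ca). Qed.

Let mGc : measurable_fun setT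
  (fun p : O * R => G p - \sum_(l < J) c l p.1 * \1_(`]g l, g l.+1]) p.2).
Proof.
apply: measurable_funB => //; apply: measurable_sum => l; apply: measurable_funM => //.
have mc : measurable_fun setT (c l).
  apply: measurable_funM => //.
  by apply: mY; apply: g_itv; exact: ltnW (ln (ltn_ord l)).
exact: (measurableT_comp mc measurable_fst).
Qed.

Lemma drift_gap_energy :
  measurable_fun setT (fun w => sqnorm (@lebesgue_measure R) (fun s => gap (w, s))) /\
  (\int[P]_w sqnorm (@lebesgue_measure R) (fun s => gap (w, s)) <=
    ((2 * B + 4 * L ^+ 2 * S) * Theta)%:E)%E.
Proof.
have mgap : measurable_fun setT gap := measurable_funM mGc (mi 0 (g J)).
have [H1 H2] := path_energy P mgap; split => //; rewrite H2.
have m1 : measurable_fun setT (fun _ : R => 1 : R) by exact: measurable_cst.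
have mp : measurable_fun setT (fun p : O * R * R =>
    G p.1 - \sum_(l < J) c l p.1.1 * \1_(`]g l, g l.+1]) p.1.2).
  exact: (measurableT_comp mGc measurable_fst).
have BS0 : 0 <= 2 * B + 4 * L ^+ 2 * S.
  by apply: addr_ge0; rewrite mulr_ge0// mulr_ge0 ?sqr_ge0.
have H3 := @sqnorm_grid_le _ _ _ P
  (\d_(1 : measurableTypeR R) : {finite_measure set (measurableTypeR R) -> \bar R})
  (fun p => G p.1 - \sum_(l < J) c l p.1.1 * \1_(`]g l, g l.+1]) p.1.2)
  g J (fun=> 1) (fun l => (2 * B + 4 * L ^+ 2 * S) * theta l) 1 mp m1 (fun=> ler01).
rewrite (@ThetaE (fun l => (2 * B + 4 * L ^+ 2 * S) * theta l) _ (fun=> erefl)) mul1r g0 in H3.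
apply: H3.
- by rewrite integral_delta1.
- by move=> l lJ; rewrite mulr_ge0// theta0.
- by move=> l _; exact: gle.
move=> l s z lJ sl; rewrite mul1r; have sT := cell_itv lJ sl.
apply: le_trans (thetaP BS0 sl).
have := drift_gap Y_ca sT (g_itv (ltnW (ln lJ))) (Y_fin' lJ) (gapP lJ sl) (i := i) B0 S0
  (XS sT) (bB i lJ).
apply: le_trans; apply: ge0_le_integral_any => w; first by rewrite lee_fin sqr_ge0.
rewrite /= (grid_cell_sum (fun j => c j w) _ lJ sl)//.
by rewrite /G /= indicE mem_set ?mulr1//= in_itv.
Qed.

(** The equation on a cell is restated with increments of the integrals from the left end, the form
    in which the clamped processes satisfy [isint]. Beyond the last cell the choice is arbitrary. *)
Let euler_integrals : exists IJ : nat -> ('I_d -> R -> O -> R) * (R -> O -> R),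
  forall l, (l < n)%N ->
  [/\ forall m, brownian_integral P T W N m (g l) (g l.+1)
        (fun _ w => sigma m w (g l) (Y (g l) w) (mean P (psi \o Y (g l))) 0 i) ((IJ l).1 m),
      poisson_integral P T W mu N (g l) (g l.+1)
        (fun _ z w => lam w (g l) (Y (g l) w) z (mean P (xi \o Y (g l))) 0 i) (IJ l).2 &
      {ae P, forall w, forall t, g l <= t <= g l.+1 ->
        Y t w 0 i - Y (g l) w 0 i = c l w * (t - g l) +
          \sum_m ((IJ l).1 m t w - (IJ l).1 m (g l) w) +
          ((IJ l).2 t w - (IJ l).2 (g l) w)}].
Proof.
have [_ _ HY] := Y_eul.
suff /choice [IJ HIJ] : forall l, exists IJ : ('I_d -> R -> O -> R) * (R -> O -> R),
    (l < n)%N -> [/\ forall m, brownian_integral P T W N m (g l) (g l.+1)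
        (fun _ w => sigma m w (g l) (Y (g l) w) (mean P (psi \o Y (g l))) 0 i) (IJ.1 m),
      poisson_integral P T W mu N (g l) (g l.+1)
        (fun _ z w => lam w (g l) (Y (g l) w) z (mean P (xi \o Y (g l))) 0 i) IJ.2 &
      {ae P, forall w, forall t, g l <= t <= g l.+1 ->
        Y t w 0 i - Y (g l) w 0 i = c l w * (t - g l) +
          \sum_m (IJ.1 m t w - IJ.1 m (g l) w) + (IJ.2 t w - IJ.2 (g l) w)}].
  by exists IJ.
move=> l; case: (ltnP l n) => ln'; last first.
  by exists (fun _ _ _ => 0, fun _ _ => 0).
have [IY [JY [HI HJ HE]]] := HY l ln'.
exists (fun m => IY m i, JY i) => _; split => //.
apply: filterS HE => w HE t tl; have /andP[t1 t2] := tl.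
have mulE u : g l <= u -> \int[lebesgue_measure]_(s in `[g l, u])
    cmul (b (g l) (mean P (Y (g l)))) (Y (g l) w) 0 i = c l w * (u - g l).
  move=> gu; rewrite mxE -/(c l w) Rintegral_cst; last exact: measurable_itv.
  have E : lebesgue_measure (`[g l, u]%classic : set R) = (u - g l)%:E.
    rewrite lebesgue_measure_itv /= lte_fin; case: ltP => [_|ug]; first by rewrite -EFinD.
    by rewrite (@le_anti _ R u (g l)) ?gu ?ug// subrr.
  by congr (_ * _); rewrite -[RHS]/(fine (u - g l)%:E); congr fine; exact: E.
have Et := HE t tl i; have El := HE (g l) _ i; rewrite lexx gle in El.
move: (El isT); rewrite (mulE (g l) (lexx _)) subrr mulr0 addr0 => El'.
(* At t = g_l the drift integral is over a single point, so the equation itself forces the initial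
   values of the integrals to cancel. *)
have Z : \sum_m IY m i (g l) w + JY i (g l) w = 0.
  by apply: (addrI (Y (g l) w 0 i)); rewrite addr0 addrA -El'.
rewrite Et mulE// sumrB /=.
move: Z; set a := \sum_m IY m i (g l) w; set a' := JY i (g l) w => Z.
have -> : a' = - a by apply/eqP; rewrite -addr_eq0 addrC Z.
by ring.
Qed.

(** The difference consists of a drift integral, one martingale for each Brownian component and one
    for the jumps. Each has a measurable majorant valid for all t <= g J at once; [f] is their sum
    with the weights of [three_sqr_le]. *)
Lemma coordinate_error : exists f : O -> \bar R,
  [/\ measurable_fun setT f, forall w, (0 <= f w)%E,
   {ae P, forall w, forall t, 0 <= t <= g J ->
      (((X t w 0 i - Y t w 0 i) ^+ 2)%:E <= f w)%E} &
   forall Rr, 0 <= Rr -> (\int[mu]_z (rate z)%:E <= Rr%:E)%E ->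
   (\int[P]_w f w <= ((2 * T * (2 * B + 4 * L ^+ 2 * S) +
     4 * (2 ^ size (index_enum 'I_d))%:R * (d%:R * (32 * K)) + 4 * (32 * Rr)) * Theta)%:E)%E].
Proof.
have [_ _ [IX [JX [HIX HJX HX]]]] := X_sol.
have [IJ HIJ] := euler_integrals.
have Tpos := ltW T0.
(* On each cell only the summand of that cell survives, so up to g J this is the difference of the
   two coefficients. [M m] is its integral as one process on [0, T]. *)
pose f m (p : O * R * R) := sigma m p.1.1 p.1.2 (X p.1.2 p.1.1) (mean P (psi \o X p.1.2)) 0 i
    * \1_(`]0, T]) p.1.2 -
  \sum_(l < J) sigma m p.1.1 (g l) (Y (g l) p.1.1) (mean P (psi \o Y (g l))) 0 i
    * \1_(`]g l, g l.+1]) p.1.2.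
pose M m t w := (IX m i (clamp 0 T t) w - IX m i 0 w) -
  \sum_(l < J) ((IJ l).1 m (clamp (g l) (g l.+1) t) w - (IJ l).1 m (g l) w).
pose fJ (p : O * R * R) := lam p.1.1 p.1.2 (X p.1.2 p.1.1) p.2 (mean P (xi \o X p.1.2)) 0 i
    * \1_(`]0, T]) p.1.2 * \1_nonzero_mark p.2 -
  \sum_(l < J) lam p.1.1 (g l) (Y (g l) p.1.1) p.2 (mean P (xi \o Y (g l))) 0 i
    * \1_(`]g l, g l.+1]) p.1.2 * \1_nonzero_mark p.2.
pose MJ t w := (JX i (clamp 0 T t) w - JX i 0 w) -
  \sum_(l < J) ((IJ l).2 (clamp (g l) (g l.+1) t) w - (IJ l).2 (g l) w).
have cB (A : set R) : [set: R] = A -> measurable A by move=> <-.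
have cP (A : set R) : mark_cell A -> measurable A by case.
have noiseB m := brownian_noiseP P_rect N W_bm m.
have noiseP := poisson_noiseP P_rect W_bm N_prm.
have iM m : brownian_isint P T W N m (f m) (M m).
  apply: (isintD F_mono F_meas cB (noiseB m)).
    exact: (brownian_integral_isint P_rect W_bm (lexx 0) Tpos (lexx T) (HIX m i)).1.
  apply: isintN.
  apply: (isint_sum F_mono F_meas cB (noiseB m) (n := J)
    (f := fun l p => sigma m p.1.1 (g l) (Y (g l) p.1.1) (mean P (psi \o Y (g l))) 0 i
    * \1_(`]g l, g l.+1]) p.1.2)
    (I := fun l t w => (IJ l).1 m (clamp (g l) (g l.+1) t) w - (IJ l).1 m (g l) w)) => l lJ.
  have [Hs _ _] := HIJ l (ln lJ).
  exact: (brownian_integral_isint P_rect W_bm (g_ge0 l) (gle l) (gT (ln lJ)) (Hs m)).1.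
have iMJ : poisson_isint P T W mu N fJ MJ.
  apply: (isintD F_mono F_meas cP noiseP).
    exact: (poisson_integral_isint P_rect W_bm N_prm (lexx 0) Tpos (lexx T) (HJX i)).1.
  apply: isintN.
  apply: (isint_sum F_mono F_meas cP noiseP (n := J)
    (f := fun l p => lam p.1.1 (g l) (Y (g l) p.1.1) p.2 (mean P (xi \o Y (g l))) 0 i
    * \1_(`]g l, g l.+1]) p.1.2 * \1_nonzero_mark p.2)
    (I := fun l t w => (IJ l).2 (clamp (g l) (g l.+1) t) w - (IJ l).2 (g l) w)) => l lJ.
  have [_ Hs _] := HIJ l (ln lJ).
  exact: (poisson_integral_isint P_rect W_bm N_prm (g_ge0 l) (gle l) (gT (ln lJ)) Hs).1.
have clamp0 l : clamp (g l) (g l.+1) 0 = g l by exact: clamp_left.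
have M0 m w : M m 0 w = 0.
  rewrite /M clamp_left// subrr sub0r big1 ?oppr0// => l _.
  by rewrite clamp0 subrr.
have MJ0 w : MJ 0 w = 0.
  rewrite /MJ clamp_left// subrr sub0r big1 ?oppr0// => l _.
  by rewrite clamp0 subrr.
have sum_rc (V : nat -> R -> R) t : (forall l, (l < J)%N -> V l r @[r --> t^'+] --> V l t) ->
    \sum_(l < J) V l r @[r --> t^'+] --> \sum_(l < J) V l t.
  elim: (J) => [|j IH] HV.
    rewrite big_ord0; rewrite (_ : (fun r => \sum_(l < 0) V l r) = cst 0); first exact: cvg_cst.
    by apply/funext => r; rewrite big_ord0.
  rewrite big_ord_recr /= (_ : (fun r => \sum_(l < j.+1) V l r) =
    (fun r => \sum_(l < j) V l r + V j r)); last by apply/funext => r; rewrite big_ord_recr.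
  by apply: cvgD; [apply: IH => l lj; apply: HV; exact: leqW|exact: HV].
have rc_sub (V V' : R -> R) (v : R) (t : R) : V r @[r --> t^'+] --> V t ->
    V' r @[r --> t^'+] --> V' t -> V r - v - V' r @[r --> t^'+] --> V t - v - V' t.
  by move=> H H'; apply: cvgB => //; apply: cvgB => //; exact: cvg_cst.
have rc_subc (V : R -> R) (v : R) (t : R) : V r @[r --> t^'+] --> V t ->
    V r - v @[r --> t^'+] --> V t - v.
  by move=> H; apply: cvgB => //; exact: cvg_cst.
have M_rc m w (t : R) : 0 <= t < g J -> M m r w @[r --> t^'+] --> M m t w.
  move=> _; apply: (rc_sub (fun r => IX m i (clamp 0 T r) w)
    (fun r => \sum_(l < J) ((IJ l).1 m (clamp (g l) (g l.+1) r) w - (IJ l).1 m (g l) w))).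
    have [_ _ cI _] := HIX m i.
    exact: (cadlag_clamp (f := fun r => IX m i r w) Tpos (cI w)).
  apply: (sum_rc (fun l r => (IJ l).1 m (clamp (g l) (g l.+1) r) w - (IJ l).1 m (g l) w)) => l lJ.
  apply: (rc_subc (fun r => (IJ l).1 m (clamp (g l) (g l.+1) r) w)).
  have [Hs _ _] := HIJ l (ln lJ); have [_ _ cI _] := Hs m.
  exact: (cadlag_clamp (f := fun r => (IJ l).1 m r w) (gle l) (cI w)).
have MJ_rc w (t : R) : 0 <= t < g J -> MJ r w @[r --> t^'+] --> MJ t w.
  move=> _; apply: (rc_sub (fun r => JX i (clamp 0 T r) w)
    (fun r => \sum_(l < J) ((IJ l).2 (clamp (g l) (g l.+1) r) w - (IJ l).2 (g l) w))).
    have [_ _ cI _] := HJX i.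
    exact: (cadlag_clamp (f := fun r => JX i r w) Tpos (cI w)).
  apply: (sum_rc (fun l r => (IJ l).2 (clamp (g l) (g l.+1) r) w - (IJ l).2 (g l) w)) => l lJ.
  apply: (rc_subc (fun r => (IJ l).2 (clamp (g l) (g l.+1) r) w)).
  have [_ Hs _] := HIJ l (ln lJ); have [_ _ cI _] := Hs.
  exact: (cadlag_clamp (f := fun r => (IJ l).2 r w) (gle l) (cI w)).
have m1 : measurable_fun setT (fun _ : R => 1 : R) by exact: measurable_cst.
have K0' := ltW K0.
have in0T l s : (l < J)%N -> g l < s <= g l.+1 -> \1_(`]0, T]) s = 1 :> R.
  move=> lJ sl; rewrite indic_oc; have /andP[s1 _] := sl.
  by have /andP[_ ->] := cell_itv lJ sl; rewrite (le_lt_trans (g_ge0 l) s1).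
have fQ m : (sqnorm (product_measure P (@lebesgue_measure R) \x
    (\d_(1%R : measurableTypeR R) : {finite_measure set (measurableTypeR R) -> \bar R}))
    (fun p => f m p * \1_(`]0%R, g J]) p.1.2)%R <= (K * Theta)%:E)%E.
  have [mf _ _] := iM m.
  have H := @sqnorm_grid_le _ _ _ P
    (\d_(1 : measurableTypeR R) : {finite_measure set (measurableTypeR R) -> \bar R})
    (f m) g J (fun=> 1) (fun l => K * theta l) 1 mf m1 (fun=> ler01).
  rewrite (@ThetaE (fun l => K * theta l) _ (fun=> erefl)) mul1r g0 in H; apply: H.
  - by rewrite integral_delta1.
  - by move=> l lJ; rewrite mulr_ge0// theta0.
  - by move=> l _; exact: gle.
  move=> l s z lJ sl; rewrite mul1r; have sT := cell_itv lJ sl.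
  apply: le_trans (thetaP K0' sl).
  have := sigma_gap Y_ca sT (g_itv (ltnW (ln lJ))) (Y_fin' lJ) (gapP lJ sl) m i.
  apply: le_trans; apply: ge0_le_integral_any => w; first by rewrite lee_fin sqr_ge0.
  rewrite /f /= (grid_cell_sum (fun j => sigma m w (g j) (Y (g j) w) (mean P (psi \o Y (g j))) 0 i)
    _ lJ sl)//.
  by rewrite (in0T l s lJ sl) mulr1.
have gJ0 := g_ge0 J; have gJT := gT Jn.
have /choice [ZM ZMP] : forall m : 'I_d, exists Z : O -> \bar R,
    [/\ measurable_fun setT Z, forall w, (0 <= Z w)%E,
    forall w t, 0 <= t <= g J -> ((M m t w ^+ 2)%:E <= Z w)%E &
    (\int[P]_w Z w <= (32 * (K * Theta))%:E)%E].
  move=> m; exact: (isint_maximal F_mono F_meas cB (noiseB m) (iM m) gJ0 gJT (M0 m)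
    (M_rc m) (fQ m)).
have Theta0 : 0 <= Theta.
  by apply: sumr_ge0 => l _; rewrite mulr_ge0 ?theta0// ltW.
have fJQ Rr : 0 <= Rr -> (\int[mu]_z (rate z)%:E <= Rr%:E)%E ->
    (sqnorm (product_measure P (@lebesgue_measure R) \x mu)
    (fun p => fJ p * \1_(`]0%R, g J]) p.1.2)%R <= (Rr * Theta)%:E)%E.
  move=> Rr0 RrP; have [mf _ _] := iMJ.
  have H := @sqnorm_grid_le _ _ _ P mu fJ g J rate theta Rr mf rate_measurable rate_ge0 RrP.
  rewrite (_ : \sum_(l < J) theta l * (g l.+1 - g l) = Theta) ?g0 in H; last first.
    by apply: eq_bigr => l _; rewrite gS.
  apply: H.
  - by move=> l lJ; exact: theta0.
  - by move=> l _; exact: gle.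
  move=> l s z lJ sl; have sT := cell_itv lJ sl.
  have fE w : fJ (w, s, z) = (lam w s (X s w) z (mean P (xi \o X s)) 0 i -
      lam w (g l) (Y (g l) w) z (mean P (xi \o Y (g l))) 0 i) * \1_nonzero_mark z.
    rewrite /fJ /= -mulr_suml (grid_cell_sum
      (fun j => lam w (g j) (Y (g j) w) z (mean P (xi \o Y (g j))) 0 i) _ lJ sl)//.
    by rewrite (in0T l s lJ sl) mulr1 mulrBl.
  have [z0|z0] := eqVneq z 0.
    rewrite (_ : rate z = 0); last first.
      by rewrite /rate z0 indicE memNset ?mulr0//=; move=> /eqP.
    rewrite mul0r -[leRHS](integral0 P setT); apply: ge0_le_integral_any => w.
      by rewrite lee_fin sqr_ge0.
    by rewrite fE z0 indicE memNset ?mulr0 ?expr0n//=; move=> /eqP.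
  have z1 : \1_nonzero_mark z = 1 :> R by rewrite indicE mem_set.
  apply: le_trans (thetaP (rate_ge0 z) sl).
  have := lam_gap Y_ca sT (g_itv (ltnW (ln lJ))) (Y_fin' lJ) (gapP lJ sl) i z0.
  rewrite /rate z1 mulr1; apply: le_trans.
  apply: ge0_le_integral_any => w; first by rewrite lee_fin sqr_ge0.
  by rewrite fE z1 mulr1.
have [Rr0 Rr00 Rr0P] := rate_bound.
(* The majorant [f] must be fixed before [Rr], so the maximal inequality is applied with the exact
   energy; [rate_bound] only serves to show that it is finite. *)
pose s0 := fine (sqnorm (product_measure P (@lebesgue_measure R) \x mu)%E
    (fun p => fJ p * \1_(`]0%R, g J]) p.1.2)%R).
have s0E : (sqnorm (product_measure P (@lebesgue_measure R) \x mu)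
    (fun p => fJ p * \1_(`]0%R, g J]) p.1.2)%R = s0%:E)%E.
  rewrite fineK// ge0_fin_numE ?sqnorm_ge0//.
  exact: le_lt_trans (fJQ _ Rr00 Rr0P) (ltry _).
have s0le Rr : 0 <= Rr -> (\int[mu]_z (rate z)%:E <= Rr%:E)%E -> s0 <= Rr * Theta.
  by move=> Rr1 RrP; rewrite -lee_fin -s0E; exact: fJQ.
have [ZJ [mZJ ZJ0 MJZ ZJle]] := isint_maximal F_mono F_meas cP noiseP iMJ gJ0 gJT MJ0
  MJ_rc (eq_ind_r (fun y => (y <= s0%:E)%E) (lexx _) s0E).
have [mA Ale] := drift_gap_energy.
pose D : R := (2 ^ size (index_enum 'I_d))%:R.
have c10 : 0 <= 2 * T by rewrite mulr_ge0.
have c20 : 0 <= 4 * D by rewrite mulr_ge0.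
have [mf f0 fle] := @integral_combination_le _ _ _ P d (2 * T) (4 * D) 4
  ((2 * B + 4 * L ^+ 2 * S) * Theta) (32 * (K * Theta)) (32 * s0)
  (fun w => sqnorm (@lebesgue_measure R) (fun s => gap (w, s))) ZJ ZM c10 c20 (ler0n R 4)
  mA (fun w => sqnorm_ge0 _ _) Ale
  (fun m => let: And4 H _ _ _ := ZMP m in H) (fun m => let: And4 _ H _ _ := ZMP m in H)
  (fun m => let: And4 _ _ _ H := ZMP m in H) mZJ ZJ0 ZJle.
eexists; split; [exact: mf|exact: f0| |]; last first.
  move=> Rr Rr1 RrP; apply: le_trans fle _; rewrite lee_fin.
  rewrite [leRHS](_ : _ = 2 * T * ((2 * B + 4 * L ^+ 2 * S) * Theta) +
    4 * D * (d%:R * (32 * (K * Theta))) + 4 * (32 * (Rr * Theta))); last by rewrite /D; ring.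
  by rewrite lerD2l !ler_pM2l//; exact: s0le.
have HE : {ae P, forall w, forall l, (l < n)%N -> forall t, g l <= t <= g l.+1 ->
        Y t w 0 i - Y (g l) w 0 i = c l w * (t - g l) +
          \sum_m ((IJ l).1 m t w - (IJ l).1 m (g l) w) +
          ((IJ l).2 t w - (IJ l).2 (g l) w)}.
  apply: ae_foralln => l; case: (ltnP l n) => ln'; last by apply: nearW.
  by have [_ _ H] := HIJ l ln'; apply: filterS H => w Hw _; exact: Hw.
have ae0 (I : O -> R) : measurable_fun setT I -> sqnorm P I = 0%E -> {ae P, forall w, I w = 0}.
  move=> mI I0; have := (ae_eq_integral_abs P measurableT (measurable_sqE mI)).1.
  have -> : (\int[P]_w `|(I w ^+ 2)%:E|)%E = 0%E.
    by rewrite -I0; apply: eq_integral => w _; rewrite gee0_abs// lee_fin sqr_ge0.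
  move=> /(_ erefl); apply: filterS => w /(_ Logic.I) [/eqP].
  by rewrite sqrf_eq0 => /eqP.
have T00 : 0 <= (0 : R) <= T by rewrite lexx ltW.
(* Both integrals vanish almost surely at time 0, where the equation then reads X_0 = x; with Y_0 =
   x the two processes start together. *)
have IX0 m : {ae P, forall w, IX m i 0 w = 0}.
  apply: ae0; last exact: (brownian_integral_isint P_rect W_bm (lexx 0) Tpos (lexx T) (HIX m i)).2.
  by have [_ aI _ _] := HIX m i; apply: (mfun_measurable F_meas (aI 0 T00)).
have JX0 : {ae P, forall w, JX i 0 w = 0}.
  apply: ae0; last exact: (poisson_integral_isint P_rect W_bm N_prm (lexx 0) Tpos (lexx T) (HJX i)).2.
  by have [_ aI _ _] := HJX i; apply: (mfun_measurable F_meas (aI 0 T00)).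
have IX0' : {ae P, forall w, forall m, IX m i 0 w = 0}.
  exact: (@ae_forall_ord _ _ _ P d (fun m w => IX m i 0 w = 0)).
have [_ Y0 _] := Y_eul.
near=> w.
have HXw : forall t, 0 <= t <= T -> forall i, X t w 0 i = x 0 i
   + \int[lebesgue_measure]_(s in `[0, t]) cmul (b s (mean P (X s))) (X s w) 0 i
   + \sum_m IX m i t w + JX i t w by near: w.
have HEw : forall l, (l < n)%N -> forall t, g l <= t <= g l.+1 ->
   Y t w 0 i - Y (g l) w 0 i = c l w * (t - g l) +
   \sum_m ((IJ l).1 m t w - (IJ l).1 m (g l) w) + ((IJ l).2 t w - (IJ l).2 (g l) w).
  by near: w.
have IX0w : forall m, IX m i 0 w = 0 by near: w.
have JX0w : JX i 0 w = 0 by near: w.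
have Y0w : Y 0 w = x by near: w.
have X0w : X 0 w 0 i = x 0 i.
  rewrite (HXw 0 T00 i) JX0w addr0 big1 ?addr0; last by move=> m _; exact: IX0w.
  by rewrite set_itv1 Rintegral_set1 addr0.
move=> t /andP[t0 tJ]; have tT := le_trans tJ gJT.
have DE : X t w 0 i - Y t w 0 i =
    (\int[lebesgue_measure]_(s in `[0, t]) G (w, s) -
      \sum_(l < J) c l w * (clamp (g l) (g l.+1) t - g l)) +
    \sum_m M m t w + MJ t w.
  have HX0 := sde_increments HXw (lexx 0) t0 tT i.
  have HY0 := @clamp_telescope _ g J (fun r => Y r w 0 i) t (fun l _ => gle l).
  rewrite g0 t0 tJ in HY0; move: (HY0 isT) => {}HY0.
  have -> : X t w 0 i - Y t w 0 i = (X t w 0 i - X 0 w 0 i) - (Y t w 0 i - Y 0 w 0 i).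
    by rewrite X0w Y0w; ring.
  have EY : \sum_(l < J) (Y (clamp (g l) (g l.+1) t) w 0 i - Y (g l) w 0 i) =
      \sum_(l < J) c l w * (clamp (g l) (g l.+1) t - g l) +
      \sum_m \sum_(l < J) ((IJ l).1 m (clamp (g l) (g l.+1) t) w - (IJ l).1 m (g l) w) +
      \sum_(l < J) ((IJ l).2 (clamp (g l) (g l.+1) t) w - (IJ l).2 (g l) w).
    rewrite exchange_big /= -!big_split /=; apply: eq_bigr => l _.
    by rewrite HEw ?clamp_itv//; exact: ln.
  have EM : \sum_m M m t w = \sum_m (IX m i t w - IX m i 0 w) -
      \sum_m \sum_(l < J) ((IJ l).1 m (clamp (g l) (g l.+1) t) w - (IJ l).1 m (g l) w).
    by rewrite -sumrB; apply: eq_bigr => m _; rewrite /M (clamp_id (a := 0)) ?t0.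
  rewrite HX0 HY0 EY EM /MJ (clamp_id (a := 0)) ?t0// set_itv1 Rintegral_set1 subr0.
  by rewrite /G /=; ring.
have MZ m : ((M m t w ^+ 2)%:E <= ZM m w)%E.
  by have [_ _ H _] := ZMP m; apply: H; rewrite t0.
rewrite DE.
apply: (@le_trans _ _ (2 * (\int[lebesgue_measure]_(s in `[0, t]) G (w, s) -
      \sum_(l < J) c l w * (clamp (g l) (g l.+1) t - g l)) ^+ 2 +
     4 * D * (\sum_m M m t w ^+ 2) + 4 * MJ t w ^+ 2)%:E).
  by rewrite lee_fin; exact: three_sqr_le.
rewrite !EFinD; apply: leeD; last first.
  by rewrite EFinM lee_wpmul2l//; apply: MJZ; rewrite t0.
apply: leeD; last first.
  rewrite EFinM -sumEFin lee_wpmul2l ?lee_fin//; apply: lee_sum => m _; exact: MZ.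
rewrite EFinM [X in (_ <= X * _)%E]EFinM -muleA lee_wpmul2l//.
have mGw : measurable_fun setT (fun s => G (w, s)).
  exact: (measurableT_comp mG (measurable_fun_pair (measurable_cst w) (@measurable_id _ _ setT))).
apply: (@drift_decomposition _ (fun s => G (w, s)) (fun l => c l w) g J t T g0
  (fun l _ => gle l) gJT T0 _ mGw).
by rewrite t0.
Unshelve. all: by end_near. Qed.

End coordinate.

(** The supremum is compared with the sum of the measurable majorants of the k coordinates, whence
    the factor k. *)
Lemma scheme_error (Rr : R) : 0 <= Rr -> (\int[mu]_z (rate z)%:E <= Rr%:E)%E ->
  (\int[P]_w ereal_sup [set (enorm (X t w - Y t w) ^+ 2)%:E | t in `[0%R, g J]] <=
   (k%:R * (2 * T * (2 * B + 4 * L ^+ 2 * S) +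
     4 * (2 ^ size (index_enum 'I_d))%:R * (d%:R * (32 * K)) + 4 * (32 * Rr)) *
    (T * (T + 4 * Cx) * h + 4 * h * \sum_(l < J) eps l))%:E)%E.
Proof.
move=> Rr0 RrP.
set C := 2 * T * (2 * B + 4 * L ^+ 2 * S) + _ + _.
have C0 : 0 <= C.
  have T1 := ltW T0; have K1 := ltW K0.
  have h1 := addr_ge0 (mulr_ge0 (ler0n R 2) B0) (mulr_ge0 (mulr_ge0 (ler0n R 4) (sqr_ge0 L)) S0).
  rewrite /C; apply: addr_ge0; first apply: addr_ge0.
  - by apply: mulr_ge0 => //; exact: mulr_ge0.
  - by do ?[apply: mulr_ge0 => //].
  - by do ?[apply: mulr_ge0 => //].
have /choice [f fP] : forall i : 'I_k, exists f : O -> \bar R,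
    [/\ measurable_fun setT f, forall w, (0 <= f w)%E,
     {ae P, forall w, forall t, 0 <= t <= g J ->
        (((X t w 0 i - Y t w 0 i) ^+ 2)%:E <= f w)%E} &
     (\int[P]_w f w <= (C * Theta)%:E)%E].
  move=> i; have [f [H1 H2 H3 H4]] := coordinate_error i.
  by exists f; split => //; exact: H4.
have mf i : measurable_fun setT (f i) by have [] := fP i.
have f0 i w : (0 <= f i w)%E by have [_ H _ _] := fP i.
have gJ0 := g_ge0 J.
apply: (@le_trans _ _ (\int[P]_w (\sum_i f i w))%E).
  apply: ae_le_integral_any.
  - move=> w; apply: le_trans (ereal_sup_ubound _); last first.
      by exists 0 => //=; rewrite in_itv /= lexx.
    by rewrite lee_fin sqr_ge0.
  - by move=> w; apply: sume_ge0.
  - exact: emeasurable_sum.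
  have /(@ae_forall_ord _ _ _ P k (fun i w => forall t, 0 <= t <= g J ->
      (((X t w 0 i - Y t w 0 i) ^+ 2)%:E <= f i w)%E)) :
      forall i, {ae P, forall w, forall t, 0 <= t <= g J ->
        (((X t w 0 i - Y t w 0 i) ^+ 2)%:E <= f i w)%E} by move=> i; have [] := fP i.
  apply: filterS => w Hw; apply: ub_ereal_sup => _ [t tJ <-].
  rewrite enorm_sqr -sumEFin; apply: lee_sum => i _; rewrite !mxE.
  by apply: Hw; move: tJ; rewrite /= in_itv.
rewrite ge0_integral_sum//; apply: (@le_trans _ _ (\sum_(i < k) (C * Theta)%:E)%E).
  by apply: lee_sum => i _; have [] := fP i.
rewrite sumEFin lee_fin sumr_const card_ord -[leLHS]mulr_natl mulrA ler_wpM2l ?mulr_ge0//.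
have h0' := ltW h0.
have hT : h <= T by rewrite /h ler_pdivrMr// ler_peMr ?ler1n// ltW.
have JhT : J%:R * h <= T by have := gT Jn; rewrite /g /h mulrA.
rewrite /Theta /theta /q.
(* The first summand does not depend on l; as J h <= T and h <= T, its J copies sum to at most T (T
   + 4 Cx) h. *)
rewrite (eq_bigr (fun l : 'I_J => h * (h * h + 4 * (Cx * h)) + 4 * h * eps l)); last first.
  by move=> l _; ring.
rewrite big_split /= -[X in _ + X <= _]mulr_sumr lerD2r sumr_const card_ord -[leLHS]mulr_natl.
rewrite mulrA (_ : T * (T + 4 * Cx) * h = T * (h * (T + 4 * Cx))); last by ring.
apply: ler_pM => //.
- exact: mulr_ge0.
- by apply: addr_ge0; [exact: mulr_ge0|apply: mulr_ge0 => //; exact: mulr_ge0].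
by rewrite (_ : _ + _ = h * (h + 4 * Cx)); [rewrite ler_wpM2l// lerD2r|ring].
Qed.

End scheme.

(** The order of the quantifiers matters: a and c depend on the bound B for the drift coefficient,
    but not on n, the scheme or J. *)
Lemma euler_step (B : R) : 0 <= B -> exists a c : R, [/\ 0 <= a, 0 <= c &
  forall n Y, (0 < n)%N -> euler_scheme P T W mu N b sigma lam psi xi x n Y ->
  forall J eps, (J <= n)%N -> (forall l, (l < J)%N -> 0 <= eps l) ->
  (forall l, (l < J)%N -> (second_moment P (fun w => X (l%:R * T / n%:R) w -
     Y (l%:R * T / n%:R) w)%R <= (eps l)%:E)%E) ->
  (forall l i, (l < J)%N -> (b (l%:R * T / n%:R) (mean P (Y (l%:R * T / n%:R))) 0 i) ^+ 2 <= B) ->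
  (forall l t, (l < J)%N -> 0 <= t <= l%:R * T / n%:R -> (second_moment P (Y t) < +oo)%E) ->
  (\int[P]_w ereal_sup [set (enorm (X t w - Y t w) ^+ 2)%:E | t in `[0%R, (J%:R * T / n%:R)%R]] <=
   (a * (T / n%:R) + c * (T / n%:R) * \sum_(l < J) eps l)%:E)%E].
Proof.
move=> B0; have [S S0 XS] := solution_second_moment T0 X_sol.
have [Cx Cx0 XC] := solution_increment P_rect T0 W_bm N_prm coef_meas growth X_sol.
have [Rr Rr0 RrP] := rate_bound.
pose C := k%:R * (2 * T * (2 * B + 4 * L ^+ 2 * S) +
     4 * (2 ^ size (index_enum 'I_d))%:R * (d%:R * (32 * K)) + 4 * (32 * Rr)).
have T1 := ltW T0; have K1 := ltW K0.
have C0 : 0 <= C.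
  have h1 := addr_ge0 (mulr_ge0 (ler0n R 2) B0) (mulr_ge0 (mulr_ge0 (ler0n R 4) (sqr_ge0 L)) S0).
  rewrite /C; apply: mulr_ge0 => //; apply: addr_ge0; first apply: addr_ge0.
  - by apply: mulr_ge0 => //; exact: mulr_ge0.
  - by do ?[apply: mulr_ge0 => //].
  - by do ?[apply: mulr_ge0 => //].
exists (C * (T * (T + 4 * Cx))), (C * 4); split.
- apply: mulr_ge0 => //; apply: mulr_ge0 => //; apply: addr_ge0 => //; exact: mulr_ge0.
- exact: mulr_ge0.
move=> n Y n0 Y_eul J eps Jn eps0 epsle bB Yfin.
have := scheme_error n0 Y_eul Jn B0 S0 Cx0 XS XC eps0 epsle bB Yfin Rr0 RrP.
move=> /le_trans; apply; rewrite lee_fin -/C le_eqVlt; apply/orP; left; apply/eqP; ring.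
Qed.

(** Strong induction on J. The bound for the drift coefficient at a grid point may be deduced from
    the error bound there, which the induction has already reached; the same bound makes the scheme
    square integrable up to that point. *)
Lemma euler_iterate (B a c : R) n Y : 0 <= a -> 0 <= c -> (0 < n)%N ->
  euler_scheme P T W mu N b sigma lam psi xi x n Y ->
  (forall J eps, (J <= n)%N -> (forall l, (l < J)%N -> 0 <= eps l) ->
  (forall l, (l < J)%N -> (second_moment P (fun w => X (l%:R * T / n%:R) w -
     Y (l%:R * T / n%:R) w)%R <= (eps l)%:E)%E) ->
  (forall l i, (l < J)%N -> (b (l%:R * T / n%:R) (mean P (Y (l%:R * T / n%:R))) 0 i) ^+ 2 <= B) ->
  (forall l t, (l < J)%N -> 0 <= t <= l%:R * T / n%:R -> (second_moment P (Y t) < +oo)%E) ->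
  (\int[P]_w ereal_sup [set (enorm (X t w - Y t w) ^+ 2)%:E | t in `[0%R, (J%:R * T / n%:R)%R]] <=
   (a * (T / n%:R) + c * (T / n%:R) * \sum_(l < J) eps l)%:E)%E) ->
  (forall l i, (l < n)%N -> (second_moment P (Y (l%:R * T / n%:R)%R) < +oo)%E ->
     (second_moment P (fun w => X (l%:R * T / n%:R) w - Y (l%:R * T / n%:R) w)%R <=
       (a * (T / n%:R) * (1 + c * (T / n%:R)) ^+ l)%:E)%E ->
     (b (l%:R * T / n%:R) (mean P (Y (l%:R * T / n%:R))) 0 i) ^+ 2 <= B) ->
  forall J, (J <= n)%N ->
  (\int[P]_w ereal_sup [set (enorm (X t w - Y t w) ^+ 2)%:E | t in `[0%R, (J%:R * T / n%:R)%R]] <=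
   (a * (T / n%:R) * (1 + c * (T / n%:R)) ^+ J)%:E)%E.
Proof.
move=> a0 c0 n0 Y_eul step bound J; set h := T / n%:R.
have T1 := ltW T0; have nR : (0 : R) < n%:R by rewrite ltr0n.
have h0 : 0 <= h by rewrite divr_ge0// ltW.
have q1 : 0 <= 1 + c * h by rewrite addr_ge0// mulr_ge0.
have [Y_ca _ _] := Y_eul; have [S S0 XS] := solution_second_moment T0 X_sol.
(* This sequence solves the discrete Gronwall recursion with equality, so it can be used as
   [eps]. *)
have geom j : a * h + c * h * \sum_(l < j) (a * h * (1 + c * h) ^+ l) = a * h * (1 + c * h) ^+ j.
  elim: j => [|j IH]; first by rewrite big_ord0 mulr0 addr0 expr0 mulr1.
  by rewrite big_ord_recr /= mulrDr addrA IH exprS; ring.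
elim/ltn_ind: J => J IH Jn.
have gl_itv l : (l < J)%N -> 0 <= l%:R * T / n%:R <= T.
  move=> lJ; apply/andP; split; first by rewrite divr_ge0 ?mulr_ge0.
  rewrite ler_pdivrMr// mulrC ler_pM2l// ler_nat.
  exact: ltnW (leq_trans lJ Jn).
have sm l t : (l < J)%N -> 0 <= t <= l%:R * T / n%:R ->
    (second_moment P (fun w => X t w - Y t w)%R <= (a * h * (1 + c * h) ^+ l)%:E)%E.
  move=> lJ tl; apply: le_trans (IH l lJ (ltnW (leq_trans lJ Jn))).
  apply: ge0_le_integral_any => w; first by rewrite lee_fin sqr_ge0.
  by apply: ereal_sup_ubound; exists t => //=; rewrite in_itv.
have Yfin l t : (l < J)%N -> 0 <= t <= l%:R * T / n%:R -> (second_moment P (Y t) < +oo)%E.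
  move=> lJ tl; have tT : 0 <= t <= T.
    have /andP[t0 tl'] := tl; have /andP[_ lT] := gl_itv l lJ.
    by rewrite t0 (le_trans tl').
  have mYt : vmeasurable (Y t) := adapted_vmeasurable W_bm Y_ca tT.
  have := second_momentB_le P (mX tT) (vmeasurableB (mX tT) mYt).
  rewrite (_ : (fun w => X t w - (X t w - Y t w)) = Y t); last first.
    by apply/funext => w; apply/rowP => i; rewrite !mxE; ring.
  move=> /le_lt_trans; apply; rewrite lte_add_pinfty// lte_mul_pinfty//.
    exact: le_lt_trans (XS t tT) (ltry _).
  exact: le_lt_trans (sm l t lJ tl) (ltry _).
have ll l : (l < J)%N -> 0 <= l%:R * T / n%:R <= l%:R * T / n%:R.
  by move=> lJ; rewrite lexx andbT; have /andP[] := gl_itv l lJ.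
rewrite -geom; apply: (step J (fun l => a * h * (1 + c * h) ^+ l)) => //.
- by move=> l lJ; rewrite !mulr_ge0// exprn_ge0.
- by move=> l lJ; apply: sm (ll l lJ).
- move=> l i lJ; apply: bound; first exact: leq_trans lJ Jn.
    exact: Yfin lJ (ll l lJ).
  exact: sm lJ (ll l lJ).
Qed.

Lemma euler_convergence (Xn : nat -> R -> O -> 'rV[R]_k) :
  (forall n, (0 < n)%N -> euler_scheme P T W mu N b sigma lam psi xi x n (Xn n)) ->
  exists C : R, forall n, (0 < n)%N ->
  (\int[P]_w ereal_sup [set (enorm (X t w - Xn n t w) ^+ 2)%:E | t in `[0%R, T]]
     <= (C * (T / n%:R))%:E)%E.
Proof.
move=> Xn_eul; have T1 := ltW T0.
have [S S0 XS] := solution_second_moment T0 X_sol.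
have gn n : (0 < n)%N -> n%:R * T / n%:R = T.
  by move=> n0; rewrite mulrC mulKf// pnatr_eq0 -lt0n.
have h_ge0 n : 0 <= T / n%:R :> R by rewrite divr_ge0.
have /choice [Cn CnP] : forall n, exists C : R, 0 <= C /\ ((0 < n)%N ->
    (\int[P]_w ereal_sup [set (enorm (X t w - Xn n t w) ^+ 2)%:E | t in `[0%R, T]]
     <= (C * (T / n%:R))%:E)%E).
  move=> n; have [->|n0] := posnP n; first by exists 0.
  pose g l : R := l%:R * T / n%:R.
  (* For a single n the sum of all the squares is a trivial bound; the resulting constant depends on
     n and is kept for finitely many n only. *)
  pose B := \sum_(l < n) \sum_i (b (g l) (mean P (Xn n (g l))) 0 i) ^+ 2.
  have in0 l : 0 <= \sum_i (b (g l) (mean P (Xn n (g l))) 0 i) ^+ 2.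
    by apply: sumr_ge0 => i _; exact: sqr_ge0.
  have B0 : 0 <= B by apply: sumr_ge0 => l _.
  have [a [c [a0 c0 H]]] := euler_step B0.
  exists (a * (1 + c * (T / n%:R)) ^+ n); split.
    by rewrite mulr_ge0// exprn_ge0// addr_ge0// mulr_ge0.
  move=> _; have := euler_iterate a0 c0 n0 (Xn_eul n n0) (H n (Xn n) n0 (Xn_eul n n0)).
  move=> /(_ _ n (leqnn n)); rewrite gn// mulrAC; apply => l i ln _ _.
  rewrite /B (bigD1 (Ordinal ln))//= (bigD1 i)//= -addrA lerDl addr_ge0//.
    by apply: sumr_ge0 => j _; exact: sqr_ge0.
  by apply: sumr_ge0 => j _.
have [Cg [gb _ _ _ _]] := growth.
(* If the error is at most 1, then E|Y|^2 <= 2 S + 2, and linear growth gives |b|^2 <= Cg^2 (1 + |E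
   Y|)^2 <= 2 Cg^2 (1 + |E Y|^2). *)
pose B := 2 * Cg ^+ 2 * (1 + (2 * S + 2)).
have B0 : 0 <= B by have := sqr_ge0 Cg; rewrite /B; nra.
have [a [c [a0 c0 H]]] := euler_step B0.
have expB n j : (0 < n)%N -> (j <= n)%N -> (1 + c * (T / n%:R)) ^+ j <= expR (c * T).
  move=> n0 jn; have q1 : 1 <= 1 + c * (T / n%:R) by rewrite lerDl mulr_ge0.
  apply: (@le_trans _ _ ((1 + c * (T / n%:R)) ^+ n)); first exact: ler_weXn2l.
  apply: (@le_trans _ _ (expR (c * (T / n%:R)) ^+ n)).
    rewrite ler_pXn2r// ?nnegrE ?expR_ge0 ?(le_trans ler01)//.
    exact: expR_ge1Dx.
  rewrite -expRM_natl le_eqVlt; apply/orP; left; apply/eqP; congr expR.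
  by rewrite mulrCA (mulrA n%:R) gn.
(* From n1 on, a (T / n) exp(c T) <= 1, so the error bound of the induction never exceeds 1. *)
pose n1 := (Num.truncn (a * T * expR (c * T))).+1.
have big n : (n1 <= n)%N -> (0 < n)%N ->
    (\int[P]_w ereal_sup [set (enorm (X t w - Xn n t w) ^+ 2)%:E | t in `[0%R, T]]
     <= (a * expR (c * T) * (T / n%:R))%:E)%E.
  move=> n1n n0; have nR : (0 : R) < n%:R by rewrite ltr0n.
  have small : a * (T / n%:R) * expR (c * T) <= 1.
    rewrite (_ : _ * _ = a * T * expR (c * T) / n%:R); last by ring.
    rewrite ler_pdivrMr// mul1r; apply: (@le_trans _ _ n1%:R); last by rewrite ler_nat.
    apply/ltW; have := truncn_itv (_ : 0 <= a * T * expR (c * T)); rewrite !mulr_ge0 ?expR_ge0//.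
    by move=> /(_ isT) /andP[].
  have [Y_ca _ _] := Xn_eul n n0.
  have := euler_iterate a0 c0 n0 (Xn_eul n n0) (H n (Xn n) n0 (Xn_eul n n0)).
  move=> /(_ _ n (leqnn n)); rewrite gn// => K1.
  apply: le_trans (K1 _) _; last first.
    by rewrite lee_fin [leRHS]mulrAC ler_wpM2l ?mulr_ge0// expB.
  move=> l i ln Yoo gapl; set r := l%:R * T / n%:R in Yoo gapl *.
  have rT : 0 <= r <= T.
    apply/andP; split; first by rewrite divr_ge0 ?mulr_ge0.
    by rewrite ler_pdivrMr// mulrC ler_pM2l// ler_nat ltnW.
  have mYr : vmeasurable (Xn n r) := adapted_vmeasurable W_bm Y_ca rT.
  have gap1 : (second_moment P (fun w => X r w - Xn n r w)%R <= 1%:E)%E.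
    apply: le_trans gapl _; rewrite lee_fin; apply: le_trans small.
    by rewrite ler_wpM2l ?mulr_ge0// expB// ltnW.
  have rho : enorm (mean P (Xn n r)) ^+ 2 <= 2 * S + 2.
    apply: enorm_mean_le => //.
    have := second_momentB_le P (mX rT) (vmeasurableB (mX rT) mYr).
    rewrite (_ : (fun w => X r w - (X r w - Xn n r w)) = Xn n r); last first.
      by apply/funext => w; apply/rowP => j; rewrite !mxE; ring.
    move=> /le_trans; apply; rewrite [leRHS]EFinD; apply: leeD.
      by rewrite [leRHS]EFinM lee_wpmul2l//; exact: XS.
    by rewrite -[leRHS]mule1 lee_wpmul2l.
  apply: le_trans (coord_le_enorm _ _) _.
  have hb := gb r (mean P (Xn n r)) rT.
  apply: (@le_trans _ _ ((Cg * (1 + enorm (mean P (Xn n r)))) ^+ 2)).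
    by rewrite ler_pXn2r// nnegrE ?enorm_ge0// (le_trans (enorm_ge0 _) hb).
  rewrite exprMn /B (_ : 2 * Cg ^+ 2 * _ = Cg ^+ 2 * (2 * (1 + (2 * S + 2)))); last by ring.
  rewrite ler_wpM2l ?sqr_ge0//; apply: le_trans (sqrD_le _ _) _.
  by rewrite expr1n -mulrDr ler_pM2l// lerD2l.
have sum0 : 0 <= \sum_(m < n1) Cn m by apply: sumr_ge0 => m _; case: (CnP m).
exists (a * expR (c * T) + \sum_(m < n1) Cn m) => n n0.
have [n1n|nn1] := leqP n1 n.
  apply: le_trans (big n n1n n0) _.
  by rewrite lee_fin ler_wpM2r// lerDl.
have [_ H2] := CnP n; apply: le_trans (H2 n0) _.
rewrite lee_fin ler_wpM2r// (bigD1 (Ordinal nn1))//= addrCA lerDl addr_ge0//.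
  by rewrite mulr_ge0// expR_ge0.
by apply: sumr_ge0 => m _; case: (CnP m).
Qed.

End euler.

Theorem theorem6p1 (R : realType) (T : R) (d k : nat)
    (e1 e2 : measure_display)
    (O1 : measurableType e1) (O2 : measurableType e2)
    (PW : probability O1 R) (PN : probability O2 R)
    (W : 'I_d -> R -> O1 -> R)
    (mu : {finite_measure set (measurableTypeR R) -> \bar R})
    (N : R.-ker O2 ~> (R * R)%type)
    (b : R -> 'rV[R]_k -> 'rV[R]_k)
    (sigma : 'I_d -> (O1 * O2)%type -> R -> 'rV[R]_k -> 'rV[R]_k -> 'rV[R]_k)
    (lam : (O1 * O2)%type -> R -> 'rV[R]_k -> R -> 'rV[R]_k -> 'rV[R]_k)
    (psi xi : 'rV[R]_k -> 'rV[R]_k)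
    (K : R) (vrho : R -> R) (x : 'rV[R]_k)
    (X : R -> (O1 * O2)%type -> 'rV[R]_k)
    (Xn : nat -> R -> (O1 * O2)%type -> 'rV[R]_k) :
  let P : {measure set (O1 * O2)%type -> \bar R} := (PW \x PN)%E in
  0 < T -> (0 < k)%N -> x != 0 ->
  brownian_motion PW T W ->
  mu [set 0] = 0%E -> poisson_random_measure PN T mu N ->
  measurable_coefficients P T W N b sigma lam psi xi ->
  0 < K ->
  C1_coefficients T sigma lam psi xi ->
  lipschitz_coefficients T sigma lam psi xi K ->
  (forall p : R, 1 <= p ->
     mu.-integrable nonzero_mark (fun z => (vrho z `^ p)%:E)) ->
  process_lipschitz P T W N sigma lam psi xi K vrho ->
  linear_growth T b sigma lam psi xi ->
  mean_ode_well_posed T b x ->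
  drift_lipschitz T b ->
  sde_solution P T W mu N b sigma lam psi xi x X ->
  (forall n, (0 < n)%N ->
     euler_scheme P T W mu N b sigma lam psi xi x n (Xn n)) ->
  exists C : R, forall n, (0 < n)%N ->
    (\int[P]_w
       ereal_sup [set (enorm (X t w - Xn n t w) ^+ 2)%:E | t in `[0%R, T]]
     <= (C * (T / n%:R))%:E)%E.
Proof.
move=> P T0 _ _ W_bm _ N_prm coef_meas K0 _ _ vrho_int coef_lip growth _ [L b_lip]
  X_sol Xn_eul.
(* The preceding development is about an abstract probability P; factorisation on rectangles is its
   only link with [PW] and [PN]. *)
have P_rect (A : set O1) (B : set O2) : measurable A -> measurable B ->
    P (A `*` B) = (PW A * PN B)%E.
  by move=> mA mB; exact: product_measure1E.
exact: (@euler_convergence R e1 e2 O1 O2 PW PN (PW \x PN)%E P_rect T d k W mu N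
  T0 W_bm N_prm b sigma lam psi xi x coef_meas growth K vrho K0
  (vrho_int 1 (lexx 1)) coef_lip L b_lip X X_sol Xn Xn_eul).
Qed.
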